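(* Let $g\in\mathcal{L}$ and, for $\lambda\in[0,1]$, let $f_\lambda$ be the representing function of the $\lambda$-weighted operator mean $\sigma_g$. Then the following are equivalent. (1) $f_\lambda(x^{1/p})^p\ge f_\lambda(x)$ for all $p\ge1$, $\lambda\in[0,1]$ and $x\in(0,\infty)$. (2) $p\,g(x^{1/p})\ge g(x)$ for all $p\ge1$ and $x\in(0,\infty)$. (3) For all $n\ge1$, $\omega\in\Delta_n$, $\mathbb{A}=(A_1,\dots,A_n)\in\mathcal{P}^n$ and $p\ge1$: $\sigma_g(\omega;\mathbb{A})\le I$ implies $\sigma_g(\omega;\mathbb{A}^p)\le I$, where $\mathbb{A}^p=(A_1^p,\dots,A_n^p)$.
   Context: $\mathcal{H}$ is a nonzero Hilbert space, $I$ is the identity operator, $\mathcal{P}$ is the set of invertible positive semi-definite bounded operators on $\mathcal{H}$, and $A\ge B$ for self-adjoint $A,B$ means $A-B$ is positive semi-definite. $\Delta_n=\{(w_1,\dots,w_n)\in(0,1)^n:\sum_i w_i=1\}$ (for $n=1$ the weight is $1$). A real-valued function $g$ on $(0,\infty)$ is operator monotone if $B\le A$ implies $g(B)\le g(A)$ for all self-adjoint bounded operators $A,B$ on a Hilbert space with spectra in $(0,\infty)$ (for every Hilbert space). $\mathcal{L}$ denotes the set of all operator monotone functions $g$ on $(0,\infty)$ with $g(1)=0$, $g'(1)=1$. For $g\in\mathcal{L}$, $\omega=(w_1,\dots,w_n)\in\Delta_n$ and $\mathbb{A}\in\mathcal{P}^n$, $\sigma_g(\omega;\mathbb{A})$ denotes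 the solution $X\in\mathcal{P}$, which exists and is unique (a known theorem of Pálfia), of the generalized Karcher equation $$\sum_{i=1}^n w_i\,g(X^{-1/2}A_iX^{-1/2})=0 .$$ The representing function $f_\lambda$ of the $\lambda$-weighted operator mean $\sigma_g$ is defined by $f_\lambda(x)=\sigma_g((1-\lambda,\lambda);1,x)$, i.e. $f_\lambda(x)$ is the unique $y>0$ with $(1-\lambda)g(1/y)+\lambda g(x/y)=0$ (this also defines $f_0(x)=1$ and $f_1(x)=x$). *)

(* Defs.v *)
From HB Require Import structures.
From mathcomp Require Import all_boot all_order all_algebra.
From mathcomp Require Import sesquilinear complex.
From mathcomp Require Import all_classical all_reals all_analysis.

Set Implicit Arguments.
Unset Strict Implicit.
Unset Printing Implicit Defensive.

Import Order.TTheory GRing.Theory Num.Theory.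
Import numFieldNormedType.Exports.

Local Open Scope classical_set_scope.
Local Open Scope complex_scope.
Local Open Scope ring_scope.

(* Complex Hilbert spaces; [hdot] is linear in its first argument and
   conjugate-linear in the second. *)
Record hilbertType (R : realType) := Hilbert {
  hilbert_sort :> completeNormedModType R[i];
  hdot : {dot hilbert_sort for (@Num.conj R[i])};
  hilbert_normE : forall x : hilbert_sort, `|x| ^+ 2 = hdot x x
}.

Section Operators.
Context {R : realType} {H : hilbertType R}.
Implicit Types (A B X : H -> H) (f : R -> R).

Definition bounded_op A := linear A /\ continuous A.

Definition selfadjoint A :=
  bounded_op A /\ forall x y, hdot H (A x) y = hdot H x (A y).

(* In the order of R[i], [0 <= z] means that z is real and nonnegative. *)
Definition psd A := bounded_op A /\ forall x, 0 <= hdot H (A x) x.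

Definition invertible_op A :=
  exists B, [/\ bounded_op B, cancel A B & cancel B A].

(* The set P of the invertible positive semi-definite bounded operators. *)
Definition pos_invertible A := psd A /\ invertible_op A.

Definition op_le B A := psd (fun x => A x - B x).

Definition spectrum A : set R[i] :=
  [set z | ~ invertible_op (fun x => A x - z *: x)].

Definition positive_spectrum A :=
  forall z, spectrum A z -> exists2 t : R, 0 < t & z = t%:C.

Definition op_horner (p : {poly R}) A : H -> H :=
  fun x => \sum_(i < size p) (p`_i)%:C *: iter i A x.

(* Continuous functional calculus of a self-adjoint A: B = f(A) is the limit,
   in operator norm, of p(A) for real polynomials p converging to f uniformly
   on the spectrum of A. *)
Definition is_fcalc f A B := bounded_op B /\
  forall e : R, 0 < e -> exists p : {poly R},
    (forall t : R, spectrum A t%:C -> `|p.[t] - f t| <= e) /\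
    (forall x, `|op_horner p A x - B x| <= e%:C * `|x|).

(* f(A) depends only on the restriction of f to the spectrum of A and is
   meaningful as soon as that restriction is continuous (in particular for
   every f when H is finite-dimensional); it is the zero operator otherwise. *)
Definition fcalc f A : H -> H := xget (fun=> 0) [set B | is_fcalc f A B].

Definition op_pow A (r : R) : H -> H := fcalc (fun t => t `^ r) A.

(* [X] is sigma_g(w; A), the solution in P of the generalized Karcher
   equation. *)
Definition is_sigma (g : R -> R) (n : nat) (w : 'I_n -> R) (A : 'I_n -> H -> H)
    X :=
  pos_invertible X /\
  forall x, \sum_(i < n) (w i)%:C *:
    fcalc g (op_pow X (- 2^-1) \o A i \o op_pow X (- 2^-1)) x = 0.

End Operators.

(* No continuity is assumed: since H ranges over all Hilbert spaces, the
   finite-dimensional ones already force g to be continuous on ]0, +oo[, so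
   that [fcalc g] is then meaningful for every A considered here. *)
Definition operator_monotone (R : realType) (g : R -> R) :=
  forall (H : hilbertType R) (A B : H -> H),
    selfadjoint A -> selfadjoint B ->
    positive_spectrum A -> positive_spectrum B ->
    op_le B A -> op_le (fcalc g B) (fcalc g A).

(* The class L; the values of g outside ]0, +oo[ are irrelevant. *)
Definition classL (R : realType) (g : R -> R) :=
  [/\ operator_monotone g, g 1 = 0 & is_derive (1 : R) (1 : R) g 1].

(* The upper bound w_i < 1 is automatic for n >= 2, and leaving it out gives
   the convention that the weight is 1 for n = 1. *)
Definition weights (R : realType) (n : nat) (w : 'I_n -> R) :=
  (forall i, 0 < w i) /\ \sum_(i < n) w i = 1.

(* The representing function f_lambda: f_lambda(x) is the unique y > 0 with
   (1 - lambda) g(1 / y) + lambda g(x / y) = 0. *)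
Definition repr_fun (R : realType) (g : R -> R) (lambda x : R) : R :=
  xget 1 [set y : R | 0 < y /\
                      (1 - lambda) * g (1 / y) + lambda * g (x / y) = 0].

(* Main.v *)
From HB Require Import structures.
Require Import Defs.
From mathcomp Require Import all_boot all_order all_algebra.
From mathcomp Require Import sesquilinear complex.
From mathcomp Require Import all_classical all_reals all_analysis.
From mathcomp Require Import ring lra.
Set Implicit Arguments.
Unset Strict Implicit.
Unset Printing Implicit Defensive.
Import Order.TTheory GRing.Theory Num.Theory.
Import numFieldNormedType.Exports.
Local Open Scope classical_set_scope.
Local Open Scope complex_scope.
Local Open Scope ring_scope.

(** Let F(A, X) be the left-hand side sum_i w_i g(X^(-1/2) A_i X^(-1/2)) of the
    Karcher equation. Everything rests on two facts about supersolutions, that is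
    on invertible positive X with F(A, X) <= 0.

    Powers (karcher_pow). If X <= 1, F(A, X) <= 0 and p g(x^(1/p)) >= g(x), then
    F(A^p, X) <= 0 with the same X. For p in [1, 2] Hansen's inequality
    X^(-1/2) A^p X^(-1/2) <= (X^(-1/2) A X^(-1/2))^p (hansen_pow) and monotonicity
    bound F(A^p, X) by sum_i w_i g(B_i^p) <= p sum_i w_i g(B_i) = p F(A, X), where
    B_i = X^(-1/2) A_i X^(-1/2); larger p are reached by squaring. Hansen's
    inequality comes from the Loewner-Heinz inequality (loewner_heinz), proved by
    showing that the exponents q for which t^q is operator monotone are stable
    under midpoints and limits.

    Comparison (karcher_comparison). A supersolution X of the equation solved by Y
    satisfies Y <= X. This is Jensen's inequality for the contraction
    m^(-1/2) Y^(1/2) X^(-1/2), where m is the least number with Y <= m X: if m > 1,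
    it contradicts the minimality of m because g is strictly increasing. Together
    the two facts give (2) => (3).

    Jensen's inequality and the regularity of g come from one computation
    (compression). For an isometry V there is a symmetric involution U of a direct
    sum of Hilbert spaces such that U diag(1, T) U has V' T V as its upper left
    corner, V' being the adjoint of V; it lies below diag(V' T V + e, N) for large N.
    Applying g and reading the inequality at suitable vectors yields V' g(T) V <=
    g(V' T V + e). On operators with two eigenvalues the same inequality says that g
    is concave up to e, hence continuous (monotone_continuous), and at other vectors
    that g cannot become constant, hence is strictly increasing (monotone_strict).
    So no integral representation of operator monotone functions enters.

    For this the continuous functional calculus of a symmetric operator is built
    from polynomials: the infimum of the quadratic form is a spectral value
    (inf_form_spectrum), polynomials split over the complex numbers, so that a
    polynomial nonnegative on the spectrum gives a nonnegative operator
    (op_horner_ge0), and the Weierstrass theorem provides the approximations.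

    The other implications are scalar. (1) and (2) are related by the equation of
    f_lambda: (2) turns a solution for x into a subsolution for x^(1/p), and
    f_lambda(x) = 1 + lambda g(x) + o(lambda) gives the converse. For (3) => (2),
    apply (3) to two multiples a < 1 < b of the identity whose weighted mean is 1:
    g(b) g(a^p) <= g(a) g(b^p). Letting a or b tend to 1 and using g'(1) = 1 gives
    (2) at b^p or at a^p. *)

(** * The real inner product of a complex Hilbert space *)

Lemma Re_realM (R : realType) (c : R) (z : R[i]) :
  complex.Re (c%:C * z) = c * complex.Re z.
Proof. by case: z => a b; rewrite /GRing.mul /= mul0r subr0. Qed.

Section RealInner.
Context {R : realType} {H : hilbertType R}.
Implicit Types (x y z : H) (c : R).

(** Symmetry and positivity of a complex-linear operator can be read off the
    real part of the inner product, whose values are ordered reals: the whole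
    development uses this real form. *)
Definition rdot x y : R := complex.Re (hdot H x y).
Definition hnorm x : R := Num.sqrt (rdot x x).

Lemma hdotC x y : hdot H y x = Num.conj (hdot H x y).
Proof. by rewrite hermC expr0 mul1r. Qed.

Lemma rdotC x y : rdot x y = rdot y x.
Proof. by rewrite /rdot hdotC; case: (hdot H y x). Qed.

Lemma rdotDl x y z : rdot (x + y) z = rdot x z + rdot y z.
Proof. by rewrite /rdot linearDl raddfD. Qed.
Lemma rdotDr x y z : rdot z (x + y) = rdot z x + rdot z y.
Proof. by rewrite ![rdot z _]rdotC rdotDl. Qed.
Lemma rdotNl x z : rdot (- x) z = - rdot x z.
Proof. by rewrite /rdot linearNl raddfN. Qed.
Lemma rdotNr x z : rdot z (- x) = - rdot z x.
Proof. by rewrite ![rdot z _]rdotC rdotNl. Qed.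
Lemma rdotBl x y z : rdot (x - y) z = rdot x z - rdot y z.
Proof. by rewrite rdotDl rdotNl. Qed.
Lemma rdotBr x y z : rdot z (x - y) = rdot z x - rdot z y.
Proof. by rewrite rdotDr rdotNr. Qed.
Lemma rdotZl c x y : rdot (c%:C *: x) y = c * rdot x y.
Proof.
by rewrite /rdot linearZl_LR Re_realM.
Qed.
Lemma rdotZr c x y : rdot y (c%:C *: x) = c * rdot y x.
Proof. by rewrite rdotC rdotZl rdotC. Qed.
Lemma rdot0l x : rdot 0 x = 0.
Proof. by rewrite /rdot linear0l. Qed.
Lemma rdot0r x : rdot x 0 = 0.
Proof. by rewrite rdotC rdot0l. Qed.
Lemma rdot_sumr (I : Type) (r : seq I) (P : pred I) (F : I -> H) x :
  rdot x (\sum_(i <- r | P i) F i) = \sum_(i <- r | P i) rdot x (F i).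
Proof.
elim/big_ind2: _ => [|u a v b <- <-|//]; first exact: rdot0r.
by rewrite rdotDr.
Qed.

Lemma rdot_suml (I : Type) (r : seq I) (P : pred I) (F : I -> H) x :
  rdot (\sum_(i <- r | P i) F i) x = \sum_(i <- r | P i) rdot (F i) x.
Proof. by rewrite rdotC rdot_sumr; apply: eq_bigr => i _; rewrite rdotC. Qed.

Lemma hdot_xx x : hdot H x x = (rdot x x)%:C.
Proof.
have /eqP : Num.conj (hdot H x x) = hdot H x x by rewrite -hdotC.
rewrite /rdot; case: (hdot H x x) => a b /=.
rewrite eq_complex /= => /andP[_ /eqP]; rewrite /real_complex_def => h.
by congr Complex; lra.
Qed.

Lemma rdot_ge0 x : 0 <= rdot x x.
Proof.
have := dnorm_ge0 (hdot H) x.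
by rewrite hdot_xx (lecR 0).
Qed.

Lemma rdot_eq0 x : rdot x x = 0 -> x = 0.
Proof.
move=> h; apply/eqP; rewrite -(dnorm_eq0 (hdot H)).
by rewrite hdot_xx h.
Qed.

(** The real form loses nothing: the imaginary part of the inner product is the
    real form against a rotated vector. *)
Lemma hdotE x y : hdot H x y = (rdot x y)%:C + 'i%C * (rdot x ('i%C *: y))%:C.
Proof.
rewrite [LHS]complexE; congr (_ + _ * _%:C).
rewrite /rdot linearZr_LR /=.
by case: (hdot H x y) => a b; rewrite /GRing.mul /=; ring.
Qed.

Lemma hnorm_ge0 x : 0 <= hnorm x. Proof. exact: sqrtr_ge0. Qed.
Lemma hnorm_sqr x : hnorm x ^+ 2 = rdot x x.
Proof. by rewrite sqr_sqrtr // rdot_ge0. Qed.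
Lemma normhE x : `|x| = (hnorm x)%:C.
Proof.
apply/eqP; rewrite -(@eqrXn2 _ 2) ?normr_ge0 //; last by rewrite lecR hnorm_ge0.
by rewrite hilbert_normE hdot_xx -hnorm_sqr rmorphXn.
Qed.
Lemma hnorm0 : hnorm 0 = 0. Proof. by rewrite /hnorm rdot0l sqrtr0. Qed.
Lemma hnorm_eq0 x : hnorm x = 0 -> x = 0.
Proof. by move=> h; apply: rdot_eq0; rewrite -hnorm_sqr h expr0n. Qed.
Lemma hnormN x : hnorm (- x) = hnorm x.
Proof. by rewrite /hnorm rdotNl rdotNr opprK. Qed.
Lemma hnormB x y : hnorm (x - y) = hnorm (y - x).
Proof. by rewrite -hnormN opprB. Qed.
Lemma hnormZ (c : R[i]) x : (hnorm (c *: x))%:C = `|c| * (hnorm x)%:C.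
Proof. by rewrite -!normhE normrZ. Qed.
Lemma hnormZr c x : hnorm (c%:C *: x) = `|c| * hnorm x.
Proof.
rewrite /hnorm rdotZl rdotZr mulrA -expr2 sqrtrM ?sqr_ge0 //.
by rewrite sqrtr_sqr.
Qed.
Lemma hnormD x y : hnorm (x + y) <= hnorm x + hnorm y.
Proof.
have := ler_normD x y; rewrite !normhE.
by rewrite -rmorphD lecR.
Qed.
Lemma hnorm_gt0 x : x <> 0 -> 0 < hnorm x.
Proof.
by move=> x0; rewrite lt_neqAle hnorm_ge0 andbT; apply/eqP => /esym/hnorm_eq0.
Qed.
Lemma hnorm_le x y : (hnorm x <= hnorm y) = (rdot x x <= rdot y y).
Proof. by rewrite -!hnorm_sqr ler_sqr // nnegrE hnorm_ge0. Qed.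
Lemma hnorm_leM x y c : 0 <= c -> rdot x x <= c ^+ 2 * rdot y y -> hnorm x <= c * hnorm y.
Proof.
move=> c0; rewrite -!hnorm_sqr -exprMn ler_sqr // nnegrE ?hnorm_ge0 //.
by rewrite mulr_ge0 ?hnorm_ge0.
Qed.

(** Behind each Cauchy-Schwarz inequality below: t -> <A(x + t y), x + t y> is
    such a quadratic. *)
Lemma discr_le (a b c : R) :
  (forall t, 0 <= a + 2 * b * t + c * t ^+ 2) -> b ^+ 2 <= a * c.
Proof.
move=> h; have := h 0; rewrite mulr0 addr0 expr0n mulr0 addr0 => a0.
have [c0|c0|c0] := ltgtP c 0.
(* with c negative, t is chosen so large that c t^2 beats the other two terms *)
- have [t tM] : exists t : R, a + 2 * b * t + c * t ^+ 2 < 0.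
    exists ((2 * `|b| + a + 1) / - c + 1).
    set s := _ / _; have s0 : 0 <= s.
      by rewrite divr_ge0 ?oppr_ge0 ?(ltW c0)// !addr_ge0 ?mulr_ge0 ?normr_ge0.
    have cs : - c * s = 2 * `|b| + a + 1 by rewrite /s mulrC divfK // oppr_eq0 lt_eqF.
    have : b * (s + 1) <= `|b| * (s + 1) by rewrite ler_wpM2r ?ler_norm//; lra.
    have := mulr_ge0 (normr_ge0 b) s0.
    have := mulr_ge0 a0 s0.
    nra.
  by have := h t; rewrite leNgt tM.
- have := h (- b / c); rewrite -(@pmulr_lge0 _ c) //.
  rewrite !(mulrDl, mulrDr) => h1.
  have e : b / c * c = b by rewrite divfK ?gt_eqF.
  rewrite -subr_ge0; move: h1; congr (_ <= _).
  by field; rewrite gt_eqF.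
- have b0 : b = 0.
    apply/eqP; apply: contraT => b0.
    have := h (- (a + 1) / (2 * b)).
    rewrite c0 mul0r addr0.
    have -> : 2 * b * (- (a + 1) / (2 * b)) = - (a + 1).
      by rewrite mulrC divfK // mulf_neq0 // pnatr_eq0.
    by move=> ?; exfalso; lra.
  by rewrite b0 c0 expr0n mulr0.
Qed.

End RealInner.

(** * Bounded linear operators *)

Section BoundedOperators.
Context {R : realType}.
Implicit Types (H K L : hilbertType R).

(** Boundedness by an explicit constant for the real-valued norm; it agrees with
    continuity by bounded_opE. *)
Definition blin H K (A : H -> K) :=
  linear A /\ exists2 M : R, 0 <= M & forall x, hnorm (A x) <= M * hnorm x.

Section Linear.
Context {H K : hilbertType R} {A : H -> K} (bA : blin A).

Lemma blinP c x y : A (c *: x + y) = c *: A x + A y.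
Proof. by case: bA => lA _; rewrite lA. Qed.
Lemma blinD x y : A (x + y) = A x + A y.
Proof. by rewrite -[x in LHS](scale1r x) blinP scale1r. Qed.
Lemma blin0 : A 0 = 0.
Proof. by apply: (addrI (A 0)); rewrite -blinD !addr0. Qed.
Lemma blinZ c x : A (c *: x) = c *: A x.
Proof. by rewrite -[_ *: x]addr0 blinP blin0 addr0. Qed.
Lemma blinN x : A (- x) = - A x.
Proof. by rewrite -scaleN1r blinZ scaleN1r. Qed.
Lemma blinB x y : A (x - y) = A x - A y.
Proof. by rewrite blinD blinN. Qed.
Lemma blin_sum (I : Type) (r : seq I) (P : pred I) (F : I -> H) :
  A (\sum_(i <- r | P i) F i) = \sum_(i <- r | P i) A (F i).
Proof.
by elim/big_ind2: _ => [|u a v b <- <-|//]; [exact: blin0 | exact: blinD].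
Qed.
End Linear.

Lemma blin_comp H K L (A : K -> L) (B : H -> K) :
  blin A -> blin B -> blin (fun x => A (B x)).
Proof.
move=> bA bB; split=> [c x y|]; first by rewrite !(blinP bB, blinP bA).
case: bA bB => _ [M M0 hA] [_ [N N0 hB]]; exists (M * N); first exact: mulr_ge0.
by move=> x; rewrite (le_trans (hA _)) // -mulrA ler_wpM2l.
Qed.

Lemma blin_add H K (A B : H -> K) : blin A -> blin B -> blin (fun x => A x + B x).
Proof.
move=> bA bB; split=> [c x y|].
  by rewrite (blinP bB) (blinP bA) scalerDr addrACA.
case: bA bB => _ [M M0 hA] [_ [N N0 hB]]; exists (M + N); first exact: addr_ge0.
by move=> x; rewrite (le_trans (hnormD _ _)) // mulrDl lerD.
Qed.

Lemma blin_scale H K (c : R[i]) (A : H -> K) : blin A -> blin (fun x => c *: A x).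
Proof.
move=> bA; split=> [d x y|].
  by rewrite (blinP bA) scalerDr !scalerA mulrC.
have [M M0 hA] := bA.2; exists (Normc.normc c * M).
  by rewrite mulr_ge0 // -lecR; exact: (normr_ge0 c).
move=> x; rewrite -lecR hnormZ -mulrA rmorphM.
by rewrite ler_wpM2l // lecR.
Qed.

Lemma blin_id H : blin (fun x : H => x).
Proof. by split=> //; exists 1 => // x; rewrite mul1r. Qed.

Lemma blin_cst0 H K : blin (fun x : H => (0 : K)).
Proof.
split=> [c x y|]; first by rewrite scaler0 addr0.
by exists 0 => // x; rewrite hnorm0 mul0r.
Qed.

Lemma blin_scalar H (c : R[i]) : blin (fun x : H => c *: x).
Proof. exact: blin_scale (blin_id H). Qed.

Lemma blin_opp H K (A : H -> K) : blin A -> blin (fun x => - A x).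
Proof.
by move=> /(blin_scale (-1)); under eq_fun do rewrite scaleN1r.
Qed.

Lemma blin_sub H K (A B : H -> K) : blin A -> blin B -> blin (fun x => A x - B x).
Proof. by move=> bA bB; exact: blin_add (blin_opp bB). Qed.

Lemma blin_iter H (A : H -> H) n : blin A -> blin (iter n A).
Proof.
move=> bA; elim: n => [|n ih]; first exact: blin_id.
exact: (blin_comp bA ih).
Qed.

Lemma blin_bsum H K (I : Type) (r : seq I) (P : pred I) (F : I -> H -> K) :
  (forall i, blin (F i)) -> blin (fun x => \sum_(i <- r | P i) F i x).
Proof.
move=> bF; elim: r => [|i r ih].
  by under eq_fun do rewrite big_nil; exact: blin_cst0.
under eq_fun do rewrite big_cons.
by case: (P i) => //; exact: blin_add.
Qed.

(** Both directions are the classical fact that a linear map is continuous exactly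
    when it is bounded; complex bounds are turned into real ones on the way. *)
Lemma bounded_opE H (A : H -> H) : bounded_op A <-> blin A.
Proof.
have Re_pos (r : R[i]) : 0 < r -> r = (complex.Re r)%:C.
  by move=> r0; rewrite RRe_real // gtr0_real.
split=> [[lA cA]|[lA [M M0 hM]]]; split=> //.
- pose f : {linear H -> H} := HB.pack A (GRing.isLinear.Build _ _ _ _ A lA).
  have /linear_bounded_continuous/linear_boundedP/pinfty_ex_gt0 : continuous f by [].
  move=> [r r0 hr]; have rE := Re_pos _ r0.
  exists (complex.Re r) => [|x]; first by rewrite -lecR -rE ltW.
  by have := hr x; rewrite !normhE rE -rmorphM lecR.
- pose f : {linear H -> H} := HB.pack A (GRing.isLinear.Build _ _ _ _ A lA).
  have : continuous f; last by [].
  apply/linear_bounded_continuous/linear_boundedP.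
  near=> r => x.
  rewrite (@le_trans _ _ (M%:C * `|x|)) //.
    by rewrite /f /= !normhE -rmorphM lecR.
  rewrite ler_wpM2r //; near: r; apply: nbhs_pinfty_ge.
  by rewrite realE (lecR 0) M0.
Unshelve. all: by end_near. Qed.

(** Completeness with an explicit rate, which survives in the limit. It produces
    both the sums of Neumann series and the values of the functional calculus. *)
Lemma complete_lim H (u : nat -> H) (e : nat -> R) :
  (forall n k, hnorm (u n - u (n + k)%N) <= e n) -> e @ \oo --> 0 ->
  exists l, forall n, hnorm (u n - l) <= e n.
Proof.
move=> ue e0.
have e_ge0 n : 0 <= e n by rewrite (le_trans _ (ue n 0%N)) ?hnorm_ge0.
have small (d : R) : 0 < d -> exists N, e N < d.
  move=> d0; have /cvgrPdist_lt/(_ _ d0)[N _ hN] := e0.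
  by exists N; have := hN N (leqnn N); rewrite sub0r normrN ger0_norm.
have cu : cvgn u.
  apply/cauchy_cvgP; apply/cauchy_ballP => d d0.
  have dE : d = (complex.Re d)%:C by rewrite RRe_real // gtr0_real.
  have rd0 : 0 < complex.Re d by rewrite -ltcR -dE.
  have [N hN] := small (complex.Re d / 2) (divr_gt0 rd0 (ltr0Sn R 1)).
  near_simpl; exists ([set n | N <= n], [set n | N <= n])%N.
    by split; exists N.
  move=> [n m] [/= Nn Nm]; rewrite -ball_normE /ball_ /= normhE dE ltcR.
  have := ue N (n - N)%N; have := ue N (m - N)%N; rewrite !subnKC // => h1 h2.
  have := hnormD (u n - u N) (u N - u m); rewrite addrA subrK (hnormB (u n)).
  by move=> h3; apply: (le_lt_trans h3); lra.
exists (limn u) => n.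
rewrite leNgt; apply/negP => lt.
pose d := hnorm (u n - limn u) - e n.
have d0 : 0 < d by rewrite subr_gt0.
have /cvgrPdist_lt/(_ d%:C) : u @ \oo --> limn u by [].
rewrite (ltcR 0) => /(_ d0) [N _ hN].
have := hN (n + N)%N (leq_addl _ _); rewrite normhE ltcR.
have := ue n N; have := hnormD (u n - u (n + N)%N) (u (n + N)%N - limn u).
rewrite addrA subrK (hnormB (limn u)) /d; lra.
Unshelve. all: by end_near. Qed.

Lemma cvg_geom0 (q C : R) : 0 <= q < 1 -> (fun n => q ^+ n * C) @ \oo --> 0.
Proof.
move=> /andP[q0 q1]; rewrite -(mul0r C); apply: cvgMr_tmp.
by apply: cvg_expr; rewrite ger0_norm.
Qed.

Lemma le_of_cvg0 (a b : R) (u : nat -> R) :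
  (forall n, a <= b + u n) -> u @ \oo --> 0 -> a <= b.
Proof.
move=> h u0; rewrite leNgt; apply/negP => ba.
have d0 : 0 < a - b by rewrite subr_gt0.
have /cvgrPdist_lt/(_ _ d0) [N _ hN] := u0.
have := hN N (leqnn N); rewrite sub0r normrN => h1.
have := h N; have := ler_norm (u N); lra.
Qed.

(** The iterates of u -> S u + y from 0 are the partial sums of the Neumann series
    of y. They stay within |y| / (1 - q), and the distance of u_n to all later
    iterates is at most q^n times that bound, since S maps u_n - u_(n+k) to
    u_(n+1) - u_(n+1+k). *)
Lemma neumann H (S : H -> H) (q : R) : blin S -> 0 <= q < 1 ->
  (forall x, hnorm (S x) <= q * hnorm x) -> forall y, exists x, x - S x = y.
Proof.
move=> bS q01 hS y; have /andP[q0 q1] := q01.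
pose u n := iter n (fun x => S x + y) 0.
pose C := hnorm y / (1 - q).
have CE : q * C + hnorm y = C.
  by rewrite /C; field; rewrite subr_eq0 gt_eqF.
have uC n : hnorm (u n) <= C.
  elim: n => [|n ih] /=.
    by rewrite hnorm0 divr_ge0 ?hnorm_ge0 // subr_ge0 ltW.
  rewrite -CE (le_trans (hnormD _ _)) // lerD2r (le_trans (hS _)) //.
  by rewrite ler_wpM2l.
have ue n k : hnorm (u n - u (n + k)%N) <= q ^+ n * C.
  elim: n => [|n ih]; first by rewrite sub0r hnormN mul1r uC.
  rewrite addSn /= opprD addrACA subrr addr0 -(blinB bS).
  by rewrite (le_trans (hS _)) // exprS -mulrA ler_wpM2l.
have [l hl] := complete_lim ue (cvg_geom0 C q01).
exists l; apply/eqP; rewrite -subr_eq0; apply/eqP; apply: hnorm_eq0.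
apply/eqP; rewrite eq_le hnorm_ge0 andbT.
apply: (@le_of_cvg0 _ _ (fun n => q ^+ n * (2 * C))); last exact: cvg_geom0.
move=> n; rewrite add0r.
have -> : l - S l - y = (l - u n.+1) + S (u n - l).
  by rewrite /= (blinB bS) opprD !addrA [RHS](ACl (1*5*3*(2*4)))%AC /= addNr addr0.
rewrite (le_trans (hnormD _ _)) // hnormB.
have h1 := hl n.+1; have h2 := le_trans (hS _) (ler_wpM2l q0 (hl n)).
have C0 : 0 <= C := le_trans (hnorm_ge0 _) (uC 0%N).
have h3 : q * (q ^+ n * C) <= q ^+ n * C.
  apply: ler_piMl; last exact: ltW.
  by apply: mulr_ge0 => //; exact: exprn_ge0.
move: h1; rewrite exprS -mulrA; lra.
Qed.

(** The lower bound gives both injectivity and the bound on the inverse. *)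
Lemma invertible_of_bij H (T : H -> H) (c : R) : blin T -> 0 < c ->
  (forall x, c * hnorm x <= hnorm (T x)) -> (forall y, exists x, T x = y) ->
  invertible_op T.
Proof.
move=> bT c0 lb sT.
have Tinj : injective T.
  move=> x y /eqP; rewrite -subr_eq0 -(blinB bT) => /eqP Txy.
  apply/eqP; rewrite -subr_eq0; apply/eqP/hnorm_eq0/eqP.
  rewrite eq_le hnorm_ge0 andbT -(@pmulr_rle0 _ c) //.
  by rewrite (le_trans (lb _)) // Txy hnorm0.
have [B TB] := choice sT.
have BT : cancel T B by move=> x; apply: Tinj; rewrite TB.
exists B; split => //; apply/bounded_opE; split.
  by move=> a x y; apply: Tinj; rewrite (blinP bT) !TB.
exists c^-1; first by rewrite invr_ge0 ltW.
by move=> x; rewrite ler_pdivlMl // -{2}(TB x).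
Qed.

(** The spectrum lies in the disc of radius the norm: N - m is -m (1 - N / m) and
    the second factor is inverted by a Neumann series. *)
Lemma invertible_sub_scalar H (N : H -> H) (k m : R) : blin N -> 0 <= k < m ->
  (forall x, hnorm (N x) <= k * hnorm x) -> invertible_op (fun x => N x - m%:C *: x).
Proof.
move=> bN /andP[k0 km] hN; have m0 := le_lt_trans k0 km.
have bT := blin_sub bN (blin_scalar H m%:C).
apply: (invertible_of_bij (c := m - k)) => //; first by rewrite subr_gt0.
  move=> x; have := hnormD (m%:C *: x - N x) (N x).
  rewrite subrK hnormZr gtr0_norm // hnormB => h.
  have := hN x; lra.
have bS : blin (fun x => m^-1%:C *: N x) by exact: blin_scale.
have q01 : 0 <= k / m < 1.
  by rewrite divr_ge0 ?(ltW m0) //= ltr_pdivrMr // mul1r.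
have hS x : hnorm (m^-1%:C *: N x) <= k / m * hnorm x.
  rewrite hnormZr ger0_norm ?invr_ge0 ?(ltW m0) // mulrC mulrAC.
  by rewrite ler_wpM2r ?invr_ge0 ?(ltW m0).
move=> y; have [x hx] := neumann bS q01 hS (- m^-1%:C *: y).
exists x; apply: (scalerI (a := - m^-1%:C)).
  by rewrite oppr_eq0 fmorph_eq0 invr_eq0 gt_eqF.
rewrite -hx scalerBr scalerA scaleNr mulNr -rmorphM /= mulVf ?gt_eqF //.
by rewrite scaleN1r opprK addrC.
Qed.

End BoundedOperators.

(** * Symmetric operators and their spectrum *)

Section SymmetricOperators.
Context {R : realType}.
Implicit Types (H K L : hilbertType R).

Lemma rdot_ii H (x y : H) : rdot ('i%C *: x) ('i%C *: y) = rdot x y.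
Proof.
rewrite /rdot linearZr_LR linearZl_LR /=.
by case: (hdot H x y) => a b; rewrite /GRing.mul /=; ring.
Qed.

Lemma rdot_il H (x y : H) : rdot ('i%C *: x) y = - rdot x ('i%C *: y).
Proof.
by rewrite -[rdot x _]rdot_ii scalerA -expr2 sqr_i scaleN1r rdotNr opprK.
Qed.

Lemma cauchy_schwarz H (x y : H) : rdot x y <= hnorm x * hnorm y.
Proof.
apply: le_trans (ler_norm _) _.
rewrite -ler_sqr ?nnegrE ?mulr_ge0 ?hnorm_ge0 ?normr_ge0 //.
rewrite exprMn !hnorm_sqr real_normK ?num_real //; apply: discr_le => t.
have := rdot_ge0 (x + t%:C *: y).
rewrite rdotDl !rdotDr !rdotZl !rdotZr (rdotC y x); congr (_ <= _); ring.
Qed.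

Definition adj H K (A : H -> K) (B : K -> H) :=
  forall x y, rdot (A x) y = rdot x (B y).

Definition symop H (A : H -> H) := blin A /\ adj A A.

Lemma adj_sym H K (A : H -> K) (B : K -> H) : adj A B -> adj B A.
Proof. by move=> h x y; rewrite rdotC -h rdotC. Qed.

Lemma symop_id H : symop (fun x : H => x).
Proof. by split=> //; exact: blin_id. Qed.

Lemma symop_add H (A B : H -> H) : symop A -> symop B -> symop (fun x => A x + B x).
Proof.
move=> [bA sA] [bB sB]; split; first exact: blin_add.
by move=> x y; rewrite rdotDl rdotDr sA sB.
Qed.

Lemma symop_scale H (c : R) (A : H -> H) : symop A -> symop (fun x => c%:C *: A x).
Proof.
move=> [bA sA]; split; first exact: blin_scale.
by move=> x y; rewrite rdotZl rdotZr sA.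
Qed.

Lemma symop_scalar H (c : R) : symop (fun x : H => c%:C *: x).
Proof. exact: symop_scale (symop_id H). Qed.

Lemma symop_sub H (A B : H -> H) : symop A -> symop B -> symop (fun x => A x - B x).
Proof.
move=> [bA sA] [bB sB]; split; first exact: blin_sub.
by move=> x y; rewrite rdotBl rdotBr sA sB.
Qed.

Lemma symop_shift H (c : R) (A : H -> H) : symop A -> symop (fun x => A x - c%:C *: x).
Proof. by move=> sA; exact: symop_sub (symop_scalar H c). Qed.

Lemma symop_conj H K (C : K -> K) (V : H -> K) (W : K -> H) :
  symop C -> blin V -> blin W -> adj V W -> symop (fun x => W (C (V x))).
Proof.
move=> [bC sC] bV bW VW; split.
  exact: (blin_comp bW (blin_comp bC bV)).
by move=> x y; rewrite (adj_sym VW) sC VW.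
Qed.

Lemma symop_bsum H (I : Type) (r : seq I) (P : pred I) (F : I -> H -> H) :
  (forall i, symop (F i)) -> symop (fun x => \sum_(i <- r | P i) F i x).
Proof.
move=> sF; split; first by apply: blin_bsum => i; case: (sF i).
move=> x y; rewrite rdotC !rdot_sumr; apply: eq_bigr => i _.
by rewrite rdotC; case: (sF i) => _ ->.
Qed.

Lemma symop_iter H (A : H -> H) n : symop A -> symop (iter n A).
Proof.
move=> [bA sA]; split; first exact: blin_iter.
elim: n => // n ih x y; rewrite [iter n.+1 A x]iterS sA ih.
by rewrite -iterSr.
Qed.

(** A nonnegative form is in particular real; evaluating it at x + iy polarizes
    this into symmetry. *)
Lemma psdE H (A : H -> H) : psd A <-> symop A /\ forall x, 0 <= rdot (A x) x.
Proof.
split=> [[/bounded_opE bA pA]|[[bA sA] pA]].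
- have pos x : 0 <= rdot (A x) x.
    by have := pA x; rewrite lecE => /andP[_].
  have im0 x : rdot (A x) ('i%C *: x) = 0.
    have := pA x; rewrite lecE => /andP[/eqP + _].
    rewrite hdotE; set u := rdot _ _; set v := rdot _ _.
    by rewrite /GRing.mul /GRing.add /= => h; lra.
  split=> //; split=> // x y; rewrite (rdotC x).
  have := im0 (x + 'i%C *: y).
  rewrite (blinD bA) (blinZ bA) !scalerDr !scalerA -expr2 sqr_i scaleN1r.
  rewrite rdotDl !rdotDr rdot_ii im0 !rdotNr rdot_il im0; lra.
- split; first exact/bounded_opE.
  move=> x; rewrite hdotE.
  have -> : rdot (A x) ('i%C *: x) = 0.
    have : rdot (A x) ('i%C *: x) = - rdot (A x) ('i%C *: x).
      by rewrite {1}sA (blinZ bA) -rdot_il rdotC.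
    by move=> h; lra.
  by rewrite mulr0 addr0 (lecR 0).
Qed.

Lemma selfadjointE H (A : H -> H) : selfadjoint A <-> symop A.
Proof.
split=> [[/bounded_opE bA sA]|[bA sA]]; split=> //.
- by move=> x y; rewrite /rdot sA.
- exact/bounded_opE.
- move=> x y; rewrite !hdotE sA; congr (_ + _ * _%:C).
  by rewrite sA (blinZ bA).
Qed.

Lemma op_leE H (A B : H -> H) : symop A -> symop B ->
  op_le B A <-> forall x, rdot (B x) x <= rdot (A x) x.
Proof.
move=> sA sB; split=> [/psdE[_ h] x|h].
  by rewrite -subr_ge0 -rdotBl.
apply/psdE; split; first exact: symop_sub.
by move=> x; rewrite rdotBl subr_ge0.
Qed.

(** The form of a nonnegative operator is a semi-inner product. *)
Lemma gen_cauchy_schwarz H (A : H -> H) x y : symop A ->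
  (forall x, 0 <= rdot (A x) x) ->
  rdot (A x) y ^+ 2 <= rdot (A x) x * rdot (A y) y.
Proof.
move=> [bA sA] pA; apply: discr_le => t.
have := pA (x + t%:C *: y).
rewrite (blinD bA) (blinZ bA) rdotDl !rdotDr !rdotZl !rdotZr.
rewrite (sA y x) (rdotC y); congr (_ <= _); ring.
Qed.

(** The numerical radius of a symmetric operator bounds its norm: polarize
    4 <A x, y> and take y = A x / k. The strict bound k' makes the division
    possible when k = 0. *)
Lemma symop_norm_le H (A : H -> H) (k : R) : symop A -> 0 <= k ->
  (forall x, - k * rdot x x <= rdot (A x) x <= k * rdot x x) ->
  forall x, hnorm (A x) <= k * hnorm x.
Proof.
move=> [bA sA] k0 hA x.
suff main : forall k', k < k' -> hnorm (A x) <= k' * hnorm x.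
  rewrite leNgt; apply/negP => lt.
  have x0 : 0 < hnorm x.
    by apply: hnorm_gt0 => x0; move: lt; rewrite x0 (blin0 bA) hnorm0 mulr0 ltxx.
  have := main ((k + hnorm (A x) / hnorm x) / 2).
  rewrite midf_lt ?ltr_pdivlMr // => /(_ isT).
  rewrite mulrAC mulrDl divfK ?gt_eqF //; lra.
move=> k' kk'; have k'0 : 0 < k' := le_lt_trans k0 kk'.
apply: hnorm_leM; first exact: ltW.
have hA' z : - k' * rdot z z <= rdot (A z) z <= k' * rdot z z.
  have /andP[h1 h2] := hA z.
  by apply/andP; split; have := rdot_ge0 z; nra.
pose y := k'^-1%:C *: A x.
have /andP[_ h1] := hA' (x + y); have /andP[h2 _] := hA' (x - y).
move: h1 h2; rewrite (blinD bA) (blinB bA).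
rewrite !(rdotDl, rdotDr, rdotNl, rdotNr).
have -> : rdot (A x) y = k'^-1 * rdot (A x) (A x) by rewrite /y rdotZr.
have -> : rdot (A y) x = k'^-1 * rdot (A x) (A x).
  by rewrite sA /y rdotZl.
have -> : rdot y y = k'^-1 ^+ 2 * rdot (A x) (A x).
  by rewrite /y rdotZl rdotZr mulrA.
rewrite (rdotC y x).
set a := rdot (A x) x; set b := rdot (A y) y; set X := rdot x x.
set Y := rdot (A x) (A x); set Z := rdot x y => h1 h2.
have : k' * (k'^-1 * Y) <= k' * (k'^+2 * X * k'^-1).
  have e1 : k' * (k'^-1 ^+ 2 * Y) = k'^-1 * Y by field; rewrite gt_eqF.
  have e2 : k' ^+ 2 * X * k'^-1 = k' * X by field; rewrite gt_eqF.
  rewrite e2 ler_wpM2l ?(ltW k'0) //; lra.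
by rewrite mulVKf ?gt_eqF // [X in _ <= X]mulrC divfK ?gt_eqF.
Qed.

Lemma blin_form_le H (A : H -> H) : blin A ->
  exists2 M : R, 0 < M & forall x, - M * rdot x x <= rdot (A x) x <= M * rdot x x.
Proof.
move=> [lA [M M0 hM]]; exists (M + 1); first by lra.
move=> x; rewrite -hnorm_sqr.
have h1 := cauchy_schwarz (A x) x; have h2 := cauchy_schwarz (- A x) x.
rewrite hnormN rdotNl in h2; have h3 := hM x.
have h4 := ler_wpM2r (hnorm_ge0 x) h3; have := sqr_ge0 (hnorm x).
by move=> h5; apply/andP; split; rewrite expr2 in h5 *; lra.
Qed.

(** With T between c and M, the operator 1 - T / (M + c) has norm at most
    M / (M + c), which is less than 1: Neumann series again. *)
Lemma symop_ge_invertible H (T : H -> H) (c : R) : symop T -> 0 < c ->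
  (forall x, c * rdot x x <= rdot (T x) x) -> invertible_op T.
Proof.
move=> sT c0 hT; have [bT _] := sT.
have [M M0 hM] := blin_form_le bT.
apply: (invertible_of_bij bT c0) => [x|y].
  have [->|/eqP x0] := eqVneq x 0; first by rewrite hnorm0 mulr0 hnorm_ge0.
  rewrite -(ler_pM2r (hnorm_gt0 x0)) -mulrA -expr2 hnorm_sqr.
  exact: le_trans (cauchy_schwarz _ _).
pose k := M + c; have k0 : 0 < k by rewrite addr_gt0.
pose S x := x - k^-1%:C *: T x.
have sS : symop S by apply: symop_sub; [exact: symop_id|exact: symop_scale].
have q01 : 0 <= M / k < 1.
  by rewrite divr_ge0 ?ltW //= ltr_pdivrMr // mul1r /k; lra.
have hS x : hnorm (S x) <= M / k * hnorm x.
  apply: (symop_norm_le sS); first by case/andP: q01.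
  move=> {}x; rewrite rdotBl rdotZl -(ler_pM2l k0) -[X in _ && X](ler_pM2l k0).
  have e : k * (k^-1 * rdot (T x) x) = rdot (T x) x.
    by rewrite mulrA mulfV ?mul1r ?gt_eqF.
  have e2 : k * (M / k * rdot x x) = M * rdot x x by field; rewrite gt_eqF.
  rewrite mulNr mulrN mulrBr e e2 /k.
  have /andP[h1 h2] := hM x; have := hT x; have := rdot_ge0 x => h3 h4.
  by apply/andP; split; nra.
have [x hx] := neumann sS.1 q01 hS (k^-1%:C *: y).
exists x; apply: (scalerI (a := k^-1%:C)); first by rewrite fmorph_eq0 invr_eq0 gt_eqF.
by rewrite -hx /S opprB addrC subrK.
Qed.

(** Cauchy-Schwarz for the form of T with the vectors x and T x gives
    |T x|^2 <= M <T x, x>, and the inverse bounds |x| by |T x|. *)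
Lemma psd_invertible_ge H (T : H -> H) : symop T -> (forall x, 0 <= rdot (T x) x) ->
  invertible_op T -> exists2 c : R, 0 < c & forall x, c * rdot x x <= rdot (T x) x.
Proof.
move=> sT pT [B [/bounded_opE[_ [C C0 hB]] TB BT]].
have [M M0 hM] := blin_form_le sT.1.
have C1 : 0 < C + 1 by lra.
exists (M * (C + 1) ^+ 2)^-1; first by rewrite invr_gt0 mulr_gt0 // exprn_gt0.
move=> x; rewrite mulrC ler_pdivrMr ?mulr_gt0 ?exprn_gt0 //.
have h1 : rdot x x <= C ^+ 2 * rdot (T x) (T x).
  have := hB (T x); rewrite TB => h.
  by rewrite -!hnorm_sqr -exprMn lerXn2r ?nnegrE ?mulr_ge0 ?hnorm_ge0.
have h2 : rdot (T x) (T x) <= M * rdot (T x) x.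
  have h := gen_cauchy_schwarz x (T x) sT pT.
  have /andP[_ hMx] := hM (T x).
  have [z|nz] := eqVneq (rdot (T x) (T x)) 0.
    by rewrite z mulr_ge0 // ltW.
  have p : 0 < rdot (T x) (T x) by rewrite lt_neqAle eq_sym nz rdot_ge0.
  rewrite -(ler_pM2r p) -expr2 (le_trans h) //.
  by rewrite (mulrC M) -mulrA ler_wpM2l.
have h3 : C ^+ 2 <= (C + 1) ^+ 2 by rewrite lerXn2r ?nnegrE //; lra.
apply: le_trans h1 _; apply: (le_trans (ler_wpM2l (sqr_ge0 _) h2)).
rewrite (mulrCA (rdot (T x) x)) (mulrCA (C ^+ 2)).
apply: ler_wpM2l; first exact: ltW.
by rewrite mulrC ler_wpM2l.
Qed.

Lemma invertible_comp H (A B : H -> H) :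
  invertible_op A -> invertible_op B -> invertible_op (fun x => A (B x)).
Proof.
move=> [A' [/bounded_opE bA' AA' A'A]] [B' [/bounded_opE bB' BB' B'B]].
exists (fun x => B' (A' x)); split.
- by apply/bounded_opE; exact: blin_comp.
- by move=> x; rewrite AA' BB'.
- by move=> x; rewrite B'B A'A.
Qed.

Lemma invertible_scalar H (c : R[i]) : c != 0 ->
  invertible_op (fun x : H => c *: x).
Proof.
move=> c0; exists (fun x => c^-1 *: x); split.
- by apply/bounded_opE; exact: blin_scalar.
- by move=> x; rewrite scalerA mulVf ?scale1r.
- by move=> x; rewrite scalerA mulfV ?scale1r.
Qed.

(** With z = a + ib and D = A - a, the operator (D - ib)(D + ib) = D^2 + b^2 is
    invertible as soon as b is nonzero. *)
Lemma spectrum_real H (A : H -> H) (z : R[i]) : symop A -> spectrum A z ->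
  z = (complex.Re z)%:C.
Proof.
move=> sA; case: z => a b /= nz; suff -> : b = 0 by [].
apply/eqP; apply: contrapT => /negP b0; apply: nz.
pose D x := A x - a%:C *: x; have sD : symop D by exact: symop_shift.
have bD := sD.1.
pose ib : R[i] := 'i%C * b%:C.
have ibE (x : H) : ib *: x = 'i%C *: (b%:C *: x) by rewrite scalerA.
have ib2 : ib * ib = - (b ^+ 2)%:C.
  by rewrite /ib mulrACA -!expr2 sqr_i mulN1r rmorphXn.
have -> : (fun x => A x - Complex a b *: x) = (fun x => D x - ib *: x).
  apply: funext => x; rewrite /D -addrA -opprD -scalerDl; congr (_ - _ *: _).
  by rewrite /ib /GRing.add /GRing.mul /=; congr Complex; ring.
have bT : blin (fun x => D x - ib *: x) by exact: blin_sub bD (blin_scalar _ _).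
have cross x : rdot (D x) (ib *: x) = 0.
  have h : rdot (D x) ('i%C *: (b%:C *: x)) = - rdot (D x) ('i%C *: (b%:C *: x)).
    rewrite {1}sD.2 !(blinZ bD) (rdotC x) rdot_il.
    by rewrite [in RHS]scalerA mulrC -scalerA !rdotZl !rdotZr.
  by rewrite ibE; lra.
apply: (invertible_of_bij (c := `|b|) bT); first by rewrite normr_gt0.
  move=> x; rewrite -[X in X <= _]ger0_norm ?mulr_ge0 ?hnorm_ge0 //.
  rewrite -[X in _ <= X]mul1r; rewrite ger0_norm ?mulr_ge0 ?hnorm_ge0 //.
  rewrite mul1r -ler_sqr ?nnegrE ?mulr_ge0 ?hnorm_ge0 //.
  rewrite exprMn !hnorm_sqr real_normK ?num_real //.
  move: (D x) (cross x) => u ux.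
  rewrite rdotBl !rdotBr (rdotC (ib *: x) u) ux.
  by rewrite ibE rdot_ii rdotZl rdotZr; have := rdot_ge0 u; lra.
move=> y.
have sD2 : symop (fun x => D (D x) + (b ^+ 2)%:C *: x).
  apply: symop_add (symop_scalar H _); exact: (@symop_iter _ D 2).
have b2 : 0 < b ^+ 2 by rewrite lt_neqAle sqr_ge0 eq_sym expf_eq0 /= b0.
have [x|x [_ _ xK]] := symop_ge_invertible sD2 b2.
  by rewrite rdotDl rdotZl sD.2 lerDr; exact: rdot_ge0.
exists (D (x y) + ib *: x y).
rewrite (blinD bD) (blinZ bD) -[RHS](xK y) /=.
move: (x y) (D (x y)) (D (D (x y))) => u v w.
by rewrite scalerDr scalerA ib2 scaleNr addrKA opprK.
Qed.

(** Complex coefficients are what allows a polynomial to be split into factors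
    A - z. *)
Definition cev H (p : {poly R[i]}) (A : H -> H) (x : H) : H :=
  \sum_(i < size p) p`_i *: iter i A x.

Section Cev.
Context {H : hilbertType R} {A : H -> H} (bA : blin A).
Implicit Types p q : {poly R[i]}.

Lemma cev_wide n p x : (size p <= n)%N ->
  cev p A x = \sum_(i < n) p`_i *: iter i A x.
Proof.
move=> pn; rewrite /cev (big_ord_widen n (fun i => p`_i *: iter i A x) pn).
rewrite big_mkcond /=; apply: eq_bigr => i _; case: ltnP => // h.
by rewrite nth_default ?scale0r.
Qed.

Lemma cev_bop p : blin (cev p A).
Proof. by apply: blin_bsum => i; apply: blin_scale; exact: blin_iter. Qed.

Lemma cevD p q x : cev (p + q) A x = cev p A x + cev q A x.
Proof.
pose n := maxn (size p) (size q).
rewrite (cev_wide _ (size_polyD p q)) (cev_wide _ (leq_maxl _ _ : size p <= n)%N).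
rewrite (cev_wide _ (leq_maxr _ _ : size q <= n)%N) -big_split /=.
by apply: eq_bigr => i _; rewrite coefD scalerDl.
Qed.

Lemma cevZ c p x : cev (c *: p) A x = c *: cev p A x.
Proof.
rewrite (cev_wide _ (size_scale_leq _ _)) /cev scaler_sumr.
by apply: eq_bigr => i _; rewrite coefZ scalerA.
Qed.

Lemma cevC c x : cev c%:P A x = c *: x.
Proof.
by rewrite (cev_wide _ (size_polyC_leq1 c)) big_ord1 coefC.
Qed.

Lemma cevMX p x : cev (p * 'X) A x = cev p A (A x).
Proof.
have h : (size (p * 'X)%R <= (size p).+1)%N.
  by rewrite (leq_trans (size_polyMleq _ _)) // size_polyX addn2.
rewrite (cev_wide _ h) big_ord_recl coefMX scale0r add0r.
by apply: eq_bigr => i _; rewrite coefMX /= -iterS iterSr.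
Qed.

Lemma cevM p q x : cev (p * q) A x = cev p A (cev q A x).
Proof.
elim/poly_ind: q x => [|q c ih] x.
  by rewrite mulr0 -!polyC0 !cevC !scale0r (blin0 (cev_bop p)).
rewrite mulrDr cevD mulrA cevMX ih cevD cevMX (blinD (cev_bop p)).
by rewrite mulrC mul_polyC cevZ cevC (blinZ (cev_bop p)).
Qed.

(** The polynomial splits, and each factor A - z at a root z outside the spectrum
    is invertible. *)
Lemma cev_invertible p : p != 0 ->
  (forall z, root p z -> ~ spectrum A z) -> invertible_op (cev p A).
Proof.
move=> p0; have [r rE] := closed_field_poly_normal p.
have l0 : lead_coef p != 0 by rewrite lead_coef_eq0.
move=> hr.
have {}hr z : z \in r -> invertible_op (fun x => A x - z *: x).
  move=> zr; apply: contrapT; apply: hr.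
  by rewrite rE rootZ // root_prod_XsubC.
rewrite rE (funext (cevZ _ _)).
apply: (@invertible_comp H (fun x => _ *: x)); first exact: invertible_scalar.
elim: r hr {rE} => [|z r ih] hr.
  rewrite big_nil -polyC1 (funext (cevC _)).
  by apply: invertible_scalar; rewrite oner_eq0.
rewrite big_cons (funext (cevM _ _)).
apply: invertible_comp; last by apply: ih => w wr; apply: hr; rewrite inE wr orbT.
have -> : cev ('X - z%:P) A = (fun x => A x - z *: x).
  apply: funext => x; rewrite cevD -polyCN cevC scaleNr -[in LHS](mul1r 'X).
  by rewrite cevMX -polyC1 cevC scale1r.
by apply: hr; rewrite inE eqxx.
Qed.
End Cev.

Section Horner.
Context {H : hilbertType R} {A : H -> H} (sA : symop A).
Implicit Types p q : {poly R}.
Let bA := sA.1.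

Lemma op_hornerE p : op_horner p A = cev (map_poly (real_complex R) p) A.
Proof.
apply: funext => x; rewrite /cev size_map_poly.
by apply: eq_bigr => i _; rewrite coef_map.
Qed.

Lemma op_horner_symop p : symop (op_horner p A).
Proof. by apply: symop_bsum => i; apply: symop_scale; exact: symop_iter. Qed.

Lemma op_hornerD p q x : op_horner (p + q) A x = op_horner p A x + op_horner q A x.
Proof. by rewrite !op_hornerE rmorphD cevD. Qed.

Lemma op_hornerZ c p x : op_horner (c *: p) A x = c%:C *: op_horner p A x.
Proof. by rewrite !op_hornerE map_polyZ cevZ. Qed.

Lemma op_hornerC c x : op_horner c%:P A x = c%:C *: x.
Proof. by rewrite op_hornerE map_polyC cevC. Qed.

Lemma op_hornerM p q x : op_horner (p * q) A x = op_horner p A (op_horner q A x).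
Proof. by rewrite !op_hornerE rmorphM cevM. Qed.

Lemma op_hornerX x : op_horner 'X A x = A x.
Proof.
by rewrite op_hornerE map_polyX -[in LHS](mul1r 'X) cevMX -polyC1 cevC scale1r.
Qed.

Lemma op_hornerB p q x : op_horner (p - q) A x = op_horner p A x - op_horner q A x.
Proof. by rewrite op_hornerD -scaleN1r op_hornerZ rmorphN scaleN1r. Qed.
End Horner.

(** The infimum m of the quadratic form is a spectral value: were T - m invertible,
    it would be bounded below by some c > 0 and m + c would still be a lower
    bound. *)
Lemma inf_form_spectrum H (T : H -> H) (x0 : H) : symop T -> rdot (T x0) x0 < 0 ->
  exists m : R, [/\ m < 0, forall x, m * rdot x x <= rdot (T x) x &
    ~ invertible_op (fun x => T x - m%:C *: x)].
Proof.
move=> sT neg; have [M M0 hM] := blin_form_le sT.1.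
have x0p : 0 < rdot x0 x0.
  rewrite lt_neqAle rdot_ge0 andbT; apply/eqP => /esym/rdot_eq0 h.
  by move: neg; rewrite h rdot0r ltxx.
pose S : set R := [set m | forall x, m * rdot x x <= rdot (T x) x].
have ubS : ubound S (rdot (T x0) x0 / rdot x0 x0).
  by move=> m Sm; rewrite ler_pdivlMr.
have hS : has_sup S.
  split; last by exists (rdot (T x0) x0 / rdot x0 x0).
  by exists (- M) => x; have /andP[] := hM x.
have SS : S (sup S).
  move=> x; have [x0'|xn] := eqVneq (rdot x x) 0.
    by rewrite x0' mulr0 (rdot_eq0 x0') rdot0r.
  have xp : 0 < rdot x x by rewrite lt_neqAle eq_sym xn rdot_ge0.
  rewrite -ler_pdivlMr //; apply: sup_le_ub; first by case: hS.
  by move=> m Sm; rewrite ler_pdivlMr.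
exists (sup S); split => //.
  apply: (@le_lt_trans _ _ (rdot (T x0) x0 / rdot x0 x0)).
    by apply: sup_le_ub => //; case: hS.
  by rewrite ltr_pdivrMr // mul0r.
move=> inv.
have [] := psd_invertible_ge (symop_shift (sup S) sT) _ inv.
  by move=> x; rewrite rdotBl rdotZl subr_ge0; exact: SS.
move=> c c0 hc.
have Sc : S (sup S + c).
  by move=> x; have := hc x; rewrite rdotBl rdotZl mulrDl; lra.
have := sup_upper_bound hS Sc; lra.
Qed.

(** Spectral mapping, one-sided: if p(A) is not nonnegative, the infimum m < 0 of
    its form is a spectral value of p(A), so p - m has a root in the spectrum of A,
    which is real, and p takes there the value m. *)
Lemma op_horner_ge0 H (A : H -> H) (p : {poly R}) : symop A ->
  (forall t, spectrum A t%:C -> 0 <= p.[t]) ->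
  forall x, 0 <= rdot (op_horner p A x) x.
Proof.
move=> sA hp x; rewrite leNgt; apply/negP => neg.
have [m [m0 _]] := inf_form_spectrum (op_horner_symop sA p) neg.
have contra (t : R) : spectrum A t%:C -> p.[t] = m -> False.
  by move=> /hp; move=> + h; rewrite h leNgt m0.
pose q := p - m%:P.
have -> : (fun x => op_horner p A x - m%:C *: x) =
    cev (map_poly (real_complex R) q) A.
  apply: funext => y; rewrite -op_hornerE // op_hornerB //.
  by rewrite op_hornerC.
(* a constant p has no root to offer: use that the spectrum is not empty *)
have [q0 _|q0] := eqVneq q 0.
  have x0 : 0 < rdot x x.
    rewrite lt_neqAle rdot_ge0 andbT; apply/eqP => /esym/rdot_eq0 h.
    by move: neg; rewrite h rdot0r ltxx.
  have [M M0 hM] := blin_form_le sA.1.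
  have [|k [k0 _ nk]] := @inf_form_spectrum H _ x (symop_shift (M + 1) sA).
    rewrite rdotBl rdotZl; have /andP[_] := hM x; lra.
  apply: (contra (M + 1 + k)).
    rewrite /spectrum /=; suff <- : (fun y => A y - (M + 1)%:C *: y - k%:C *: y) =
      (fun y => A y - (M + 1 + k)%:C *: y) by [].
    by apply: funext => y; rewrite -addrA -opprD -scalerDl -rmorphD.
  have : q.[M + 1 + k] = 0 by rewrite q0 horner0.
  by rewrite hornerD hornerN hornerC; lra.
apply; apply: (cev_invertible sA.1); first by rewrite map_poly_eq0.
move=> z rz sz; have zE := spectrum_real sA sz.
move: rz sz; rewrite zE fmorph_root rootE => /eqP hz /contra; apply.
by move: hz; rewrite hornerD hornerN hornerC; lra.
Qed.

Lemma op_horner_norm H (A : H -> H) (p : {poly R}) (e : R) : symop A -> 0 <= e ->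
  (forall t, spectrum A t%:C -> `|p.[t]| <= e) ->
  forall x, hnorm (op_horner p A x) <= e * hnorm x.
Proof.
move=> sA e0 hp; apply: symop_norm_le => //; first exact: op_horner_symop.
move=> x.
have h1 := @op_horner_ge0 H A (p + e%:P) sA _ x.
have h2 := @op_horner_ge0 H A (e%:P - p) sA _ x.
rewrite op_hornerD // op_hornerC // rdotDl rdotZl in h1.
rewrite op_hornerB // op_hornerC // rdotBl rdotZl in h2.
have {}h1 : 0 <= rdot (op_horner p A x) x + e * rdot x x.
  by apply: h1 => t /hp; rewrite hornerD hornerC ler_norml; lra.
have {}h2 : 0 <= e * rdot x x - rdot (op_horner p A x) x.
  by apply: h2 => t /hp; rewrite hornerD hornerN hornerC ler_norml; lra.
apply/andP; split; lra.
Qed.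

End SymmetricOperators.

(** * Continuous functional calculus *)

Section FunctionalCalculus.
Context {R : realType}.
Implicit Types (H K : hilbertType R) (E : set R) (f h : R -> R) (p q : {poly R}).

Definition spec_in H (A : H -> H) E := forall t, spectrum A t%:C -> E t.

(** For f continuous on a segment E this is the Weierstrass theorem, and for any f
    on a finite E it is interpolation. The second case gives access to functions
    not yet known to be continuous. *)
Definition poly_approx E f := forall e : R, 0 < e ->
  exists p : {poly R}, forall t, E t -> `|p.[t] - f t| <= e.

Definition bounded_on E f := exists2 M : R, 0 <= M & forall t, E t -> `|f t| <= M.

(** The functions for which the calculus on E is multiplicative: approximating a
    product requires bounds on the factors. *)
Definition calcfun E f := poly_approx E f /\ bounded_on E f.

Lemma cvg_harmonicM (c : R) : (fun n => n.+1%:R^-1 * c) @ \oo --> (0 : R).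
Proof.
rewrite -(mul0r c); apply: cvgMr_tmp.
exact: (@cvg_harmonic R).
Qed.

(** Two polynomials close to f on the spectrum are close to each other there, so
    their values at A are close in norm: any approximation of f on a set E that
    contains the spectrum computes the same operator. *)
Lemma is_fcalc_bound H (A B : H -> H) E f p (e : R) :
  symop A -> spec_in A E -> is_fcalc f A B ->
  0 <= e -> (forall t, E t -> `|p.[t] - f t| <= e) ->
  forall x, hnorm (op_horner p A x - B x) <= e * hnorm x.
Proof.
move=> sA AE [_ hB] e0 pf x.
apply: (@le_of_cvg0 _ _ _ (fun n => n.+1%:R^-1 * (2 * hnorm x))); last exact: cvg_harmonicM.
move=> n; pose d : R := n.+1%:R^-1; have d0 : 0 < d by rewrite invr_gt0.
have [q [qf /(_ x)]] := hB d d0; rewrite !normhE -rmorphM lecR => qB.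
have := op_horner_norm (p := p - q) sA (addr_ge0 e0 (ltW d0)) _ x.
rewrite op_hornerB // => pq.
have {pq} : hnorm (op_horner p A x - op_horner q A x) <= (e + d) * hnorm x.
  apply: pq => t st; have := pf t (AE t st); have := qf t st.
  rewrite hornerD hornerN !ler_norml; lra.
have := hnormD (op_horner p A x - op_horner q A x) (op_horner q A x - B x).
by rewrite addrA subrK -/d; lra.
Qed.

(** The values at A of approximations at distance 1 / (n + 1) form a Cauchy
    sequence in norm; its pointwise limit is linear and bounded. *)
Lemma is_fcalc_ex H (A : H -> H) E f : symop A -> spec_in A E -> poly_approx E f ->
  exists B, is_fcalc f A B.
Proof.
move=> sA AE fE.
pose d n : R := n.+1%:R^-1.
have d0 n : 0 < d n by rewrite invr_gt0.
have [p hp] := choice (fun n => fE (d n) (d0 n)).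
have sp n := (op_horner_symop sA (p n)).1.
have pcauchy x n k :
    hnorm (op_horner (p n) A x - op_horner (p (n + k)%N) A x) <= d n * (2 * hnorm x).
  rewrite -op_hornerB // mulrCA mulrA; apply: (op_horner_norm sA).
    by rewrite mulr_ge0 // ltW.
  move=> t /AE Et; have := hp n t Et; have := hp (n + k)%N t Et.
  have : d (n + k)%N <= d n.
    by rewrite lef_pV2 ?posrE // ler_nat ltnS leq_addr.
  by rewrite hornerD hornerN !ler_norml; lra.
have lim x := complete_lim (pcauchy x) (cvg_harmonicM _).
have [B hB] := choice lim.
have bB : blin B.
  split.
    move=> c x y; apply/eqP; rewrite -subr_eq0; apply/eqP/hnorm_eq0/eqP.
    rewrite eq_le hnorm_ge0 andbT.
    apply: (@le_of_cvg0 _ _ _ (fun n => d n *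
       (2 * hnorm (c *: x + y) + (Normc.normc c * (2 * hnorm x) + 2 * hnorm y)))).
      move=> n; rewrite add0r !mulrDr.
      have h1 := hB (c *: x + y) n; have h2 := hB x n; have h3 := hB y n.
      have -> : B (c *: x + y) - (c *: B x + B y) =
        - (op_horner (p n) A (c *: x + y) - B (c *: x + y)) +
        (c *: (op_horner (p n) A x - B x) + (op_horner (p n) A y - B y)).
        rewrite (blinP (sp n)) scalerBr opprB [X in _ = _ + X]addrACA -opprD.
        by rewrite addrA subrK.
      rewrite (le_trans (hnormD _ _)) // hnormN lerD //.
      rewrite (le_trans (hnormD _ _)) // lerD //.
      rewrite -lecR hnormZ mulrCA rmorphM; apply: ler_wpM2l => //.
      by rewrite lecR.
    exact: cvg_harmonicM.
  have [_ [M M0 hM]] := sp 0%N.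
  exists (M + 2); first by lra.
  move=> x; have := hB x 0%N; rewrite /d invr1 mul1r hnormB => h1.
  have := hnormD (B x - op_horner (p 0%N) A x) (op_horner (p 0%N) A x).
  by rewrite subrK mulrDl; have := hM x; lra.
exists B; split; first exact/bounded_opE.
move=> e e0.
have [N hN] : exists N, 2 * d N <= e.
  have /cvgrPdist_lt/(_ e e0)[N _ hN] := cvg_harmonicM 2.
  exists N; have := hN N (leqnn N); rewrite sub0r normrN mulrC.
  by move/ltW/(le_trans (ler_norm _)).
exists (p N); split=> [t /AE Et|x].
  by have := hp N t Et; have := d0 N; lra.
rewrite !normhE -rmorphM lecR (le_trans (hB x N)) // mulrCA mulrA.
by rewrite ler_wpM2r ?hnorm_ge0.
Qed.

Section Rules.
Context {H : hilbertType R} {A : H -> H} {E : set R}.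
Hypotheses (sA : symop A) (AE : spec_in A E).

Lemma fcalcP f : poly_approx E f -> is_fcalc f A (fcalc f A).
Proof.
by move=> /(is_fcalc_ex sA AE) [B hB]; exact: (xgetI _ hB).
Qed.

Lemma fcalc_bound f p (e : R) : poly_approx E f -> 0 <= e ->
  (forall t, E t -> `|p.[t] - f t| <= e) ->
  forall x, hnorm (op_horner p A x - fcalc f A x) <= e * hnorm x.
Proof. by move=> /fcalcP fA; exact: is_fcalc_bound sA AE fA. Qed.

Lemma fcalc_bop f : poly_approx E f -> blin (fcalc f A).
Proof. by move=> /fcalcP[/bounded_opE]. Qed.

(** The way to compute f(A): an operator approached by p(A) along polynomials p
    approaching f is f(A). *)
Lemma fcalc_eq f B :
  (forall e : R, 0 < e -> exists p : {poly R},
    (forall t, E t -> `|p.[t] - f t| <= e) /\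
    (forall x, hnorm (op_horner p A x - B x) <= e * hnorm x)) ->
  fcalc f A = B.
Proof.
move=> hB; have fE : poly_approx E f by move=> e /hB[p []]; exists p.
apply: funext => x; apply/eqP; rewrite -subr_eq0; apply/eqP/hnorm_eq0/eqP.
rewrite eq_le hnorm_ge0 andbT.
apply: (@le_of_cvg0 _ _ _ (fun n => n.+1%:R^-1 * (2 * hnorm x))); last exact: cvg_harmonicM.
move=> n; rewrite add0r; pose d : R := n.+1%:R^-1.
have d0 : 0 < d by rewrite invr_gt0.
have [p [pf /(_ x) pB]] := hB d d0.
have pA := fcalc_bound fE (ltW d0) pf x.
have := hnormD (fcalc f A x - op_horner p A x) (op_horner p A x - B x).
by rewrite addrA subrK; rewrite hnormB in pA; rewrite -/d; lra.
Qed.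

Lemma fcalc_symop f : poly_approx E f -> symop (fcalc f A).
Proof.
move=> fE; split; first exact: fcalc_bop.
move=> x y.
have key u v : rdot (fcalc f A u) v - rdot u (fcalc f A v) <= 0.
  apply: (@le_of_cvg0 _ _ _ (fun n => n.+1%:R^-1 * (2 * (hnorm u * hnorm v))));
    last exact: cvg_harmonicM.
  move=> n; rewrite add0r; pose d : R := n.+1%:R^-1.
  have d0 : 0 < d by rewrite invr_gt0.
  have [p hp] := fE d d0.
  have h1 := fcalc_bound fE (ltW d0) hp u.
  have h2 := fcalc_bound fE (ltW d0) hp v.
  rewrite hnormB in h1.
  have c1 := cauchy_schwarz (fcalc f A u - op_horner p A u) v.
  have c2 := cauchy_schwarz u (op_horner p A v - fcalc f A v).
  have e1 := ler_wpM2r (hnorm_ge0 v) h1; have e2 := ler_wpM2l (hnorm_ge0 u) h2.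
  move: c1 c2; rewrite rdotBl rdotBr (op_horner_symop sA p).2 -/d; lra.
apply/eqP; rewrite eq_le -subr_le0 key /= -subr_le0.
by rewrite (rdotC x) (rdotC _ y) key.
Qed.

Lemma fcalc_ge0 f : poly_approx E f -> (forall t, E t -> 0 <= f t) ->
  forall x, 0 <= rdot (fcalc f A x) x.
Proof.
move=> fE f0 x; rewrite -oppr_le0.
apply: (@le_of_cvg0 _ _ _ (fun n => n.+1%:R^-1 * (2 * rdot x x))); last exact: cvg_harmonicM.
move=> n; rewrite add0r; pose d : R := n.+1%:R^-1.
have d0 : 0 < d by rewrite invr_gt0.
have [p hp] := fE d d0.
have h1 := fcalc_bound fE (ltW d0) hp x.
have := @op_horner_ge0 _ H A (p + d%:P) sA _ x.
rewrite op_hornerD // op_hornerC // rdotDl rdotZl => h2.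
have {}h2 : 0 <= rdot (op_horner p A x) x + d * rdot x x.
  apply: h2 => t /AE Et; have := hp t Et; have := f0 t Et.
  by rewrite hornerD hornerC ler_norml; lra.
have c1 := cauchy_schwarz (op_horner p A x - fcalc f A x) x.
have e1 := ler_wpM2r (hnorm_ge0 x) h1.
by move: c1 e1; rewrite rdotBl -mulrA -expr2 hnorm_sqr -/d; lra.
Qed.

Lemma fcalc_ext f h : poly_approx E f -> (forall t, E t -> f t = h t) ->
  fcalc f A = fcalc h A.
Proof.
move=> fE fh; symmetry; apply: fcalc_eq => e e0.
have [p hp] := fE e e0; exists p; split=> [t Et|].
  by rewrite -fh // hp.
exact: fcalc_bound (ltW e0) hp.
Qed.

Lemma fcalc_poly p : fcalc (fun t => p.[t]) A = op_horner p A.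
Proof.
apply: fcalc_eq => e e0; exists p; split=> [t _|x].
  by rewrite subrr normr0 ltW.
by rewrite subrr hnorm0 mulr_ge0 ?hnorm_ge0 // ltW.
Qed.

Lemma fcalc_cst (c : R) : fcalc (fun=> c) A = (fun x => c%:C *: x).
Proof.
have -> : (fun=> c) = (fun t => (c%:P).[t]) by apply: funext => t; rewrite hornerC.
by rewrite fcalc_poly; apply: funext => x; rewrite op_hornerC.
Qed.

Lemma fcalc_id : fcalc (fun t => t) A = A.
Proof.
have -> : (fun t : R => t) = (fun t => 'X.[t]) by apply: funext => t; rewrite hornerX.
by rewrite fcalc_poly; apply: funext => x; rewrite op_hornerX.
Qed.

Lemma poly_approxD f h : poly_approx E f -> poly_approx E h -> poly_approx E (fun t => f t + h t).
Proof.
move=> fE hE e e0; have e2 : 0 < e / 2 by rewrite divr_gt0.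
have [p hp] := fE _ e2; have [q hq] := hE _ e2.
exists (p + q) => t Et; have := hp t Et; have := hq t Et.
by rewrite hornerD !ler_norml; lra.
Qed.

Lemma poly_approxZ (c : R) f : poly_approx E f -> poly_approx E (fun t => c * f t).
Proof.
move=> fE e e0.
have c1 : 0 < `|c| + 1 by rewrite ltr_wpDl.
have [p hp] := fE _ (divr_gt0 e0 c1).
exists (c *: p) => t Et; have := hp t Et.
rewrite hornerZ -mulrBr normrM => /(ler_wpM2l (normr_ge0 c)) /le_trans; apply.
rewrite mulrA ler_pdivrMr // mulrC ler_wpM2l ?(ltW e0) //; lra.
Qed.

Lemma poly_approx_cst (c : R) : poly_approx E (fun=> c).
Proof. by move=> e e0; exists c%:P => t _; rewrite hornerC subrr normr0 ltW. Qed.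

Lemma poly_approx_id : poly_approx E (fun t => t).
Proof. by move=> e e0; exists 'X => t _; rewrite hornerX subrr normr0 ltW. Qed.

Lemma fcalcD f h : poly_approx E f -> poly_approx E h ->
  fcalc (fun t => f t + h t) A = (fun x => fcalc f A x + fcalc h A x).
Proof.
move=> fE hE; apply: fcalc_eq => e e0; have e2 : 0 < e / 2 by rewrite divr_gt0.
have [p hp] := fE _ e2; have [q hq] := hE _ e2.
exists (p + q); split=> [t Et|x].
  by have := hp t Et; have := hq t Et; rewrite hornerD !ler_norml; lra.
have h1 := fcalc_bound fE (ltW e2) hp x.
have h2 := fcalc_bound hE (ltW e2) hq x.
by rewrite op_hornerD // opprD addrACA (le_trans (hnormD _ _)) //; lra.
Qed.

Lemma fcalcZ (c : R) f : poly_approx E f ->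
  fcalc (fun t => c * f t) A = (fun x => c%:C *: fcalc f A x).
Proof.
move=> fE; apply: fcalc_eq => e e0.
have c1 : 0 < `|c| + 1 by rewrite ltr_wpDl.
have ec := divr_gt0 e0 c1.
have cec : `|c| * (e / (`|c| + 1)) <= e.
  by rewrite mulrA ler_pdivrMr // mulrC ler_wpM2l ?(ltW e0) //; lra.
have [p hp] := fE _ ec.
exists (c *: p); split=> [t Et|x].
  rewrite hornerZ -mulrBr normrM (le_trans _ cec) // ler_wpM2l //.
  exact: hp.
rewrite op_hornerZ // -scalerBr hnormZr.
rewrite (le_trans (ler_wpM2l (normr_ge0 c) (fcalc_bound fE (ltW ec) hp x))) //.
by rewrite mulrA ler_wpM2r ?hnorm_ge0.
Qed.

Lemma fcalc_le f h : poly_approx E f -> poly_approx E h -> (forall t, E t -> f t <= h t) ->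
  forall x, rdot (fcalc f A x) x <= rdot (fcalc h A x) x.
Proof.
move=> fE hE fh x; have fE' := poly_approxZ (-1) fE.
have := @fcalc_ge0 _ (poly_approxD hE fE') _ x.
rewrite (fcalcD hE fE') (fcalcZ _ fE) rdotDl rdotZl mulN1r subr_ge0; apply.
by move=> t Et; rewrite mulN1r subr_ge0 fh.
Qed.

Lemma fcalc_ge (c : R) f : poly_approx E f -> (forall t, E t -> c <= f t) ->
  forall x, c * rdot x x <= rdot (fcalc f A x) x.
Proof.
move=> fE cf x; have := @fcalc_le _ _ (poly_approx_cst c) fE cf x.
by rewrite fcalc_cst rdotZl.
Qed.

Lemma fcalc_le_cst (c : R) f : poly_approx E f -> (forall t, E t -> f t <= c) ->
  forall x, rdot (fcalc f A x) x <= c * rdot x x.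
Proof.
move=> fE cf x; have := @fcalc_le _ _ fE (poly_approx_cst c) cf x.
by rewrite fcalc_cst rdotZl.
Qed.

Lemma fcalc_norm (c : R) f : poly_approx E f -> 0 <= c -> (forall t, E t -> `|f t| <= c) ->
  forall x, hnorm (fcalc f A x) <= c * hnorm x.
Proof.
move=> fE c0 fc; apply: symop_norm_le => //; first exact: fcalc_symop.
move=> x; rewrite fcalc_ge //= ?fcalc_le_cst // => t /fc; rewrite ler_norml.
  by case/andP.
by case/andP.
Qed.

(** One accuracy d for both factors that gives accuracy e for the product; the
    same d is used for functions and for operators. *)
Lemma mul_close (M N e : R) : 0 <= M -> 0 <= N -> 0 < e ->
  exists d : R, [/\ 0 < d, d <= 1, d * (M + N + 1) <= e &
    forall a b c c' : R, `|a - c| <= d -> `|b - c'| <= d -> `|c| <= M -> `|c'| <= N ->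
      `|a * b - c * c'| <= e].
Proof.
move=> M0 N0 e0; pose d := Num.min 1 (e / (M + N + 1)).
have s0 : 0 < M + N + 1 by lra.
have d0 : 0 < d by rewrite lt_min ltr01 divr_gt0.
have d1 : d <= 1 by rewrite ge_min lexx.
have ds : d * (M + N + 1) <= e by rewrite -ler_pdivlMr // ge_min lexx orbT.
exists d; split=> // a b c c' ac bc cM cN.
have -> : a * b - c * c' = (a - c) * (b - c') + (a - c) * c' + c * (b - c') by ring.
rewrite (le_trans (ler_normD _ _)) // (le_trans (lerD (ler_normD _ _) (lexx _))) //.
rewrite !normrM.
have h1 : `|a - c| * `|b - c'| <= d * 1 by rewrite ler_pM // (le_trans bc).
have h2 : `|a - c| * `|c'| <= d * N by rewrite ler_pM.
have h3 : `|c| * `|b - c'| <= M * d by rewrite ler_pM.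
lra.
Qed.

Lemma calcfunM f h : calcfun E f -> calcfun E h -> calcfun E (fun t => f t * h t).
Proof.
move=> [fE [M M0 fM]] [hE [N N0 hN]]; split; last first.
  exists (M * N) => [|t Et]; first exact: mulr_ge0.
  by rewrite normrM ler_pM ?fM ?hN.
move=> e e0; have [d [d0 _ _ close]] := mul_close M0 N0 e0.
have [p hp] := fE _ d0; have [q hq] := hE _ d0.
exists (p * q) => t Et; rewrite hornerM.
by apply: close; [exact: hp|exact: hq|exact: fM|exact: hN].
Qed.

Lemma calcfunD f h : calcfun E f -> calcfun E h -> calcfun E (fun t => f t + h t).
Proof.
move=> [fE [M M0 fM]] [hE [N N0 hN]]; split; first exact: poly_approxD.
exists (M + N) => [|t Et]; first exact: addr_ge0.
by rewrite (le_trans (ler_normD _ _)) // lerD ?fM ?hN.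
Qed.

Lemma calcfun_cst (c : R) : calcfun E (fun=> c).
Proof. by split; [exact: poly_approx_cst | exists `|c|]. Qed.

Lemma fcalcM f h : calcfun E f -> calcfun E h ->
  fcalc (fun t => f t * h t) A = (fun x => fcalc f A (fcalc h A x)).
Proof.
move=> [fE [M M0 fM]] [hE [N N0 hN]]; apply: fcalc_eq => e e0.
have [d [d0 d1 ds close]] := mul_close M0 N0 e0.
have [p hp] := fE _ d0; have [q hq] := hE _ d0.
exists (p * q); split=> [t Et|x].
  rewrite hornerM.
  by apply: close; [exact: hp|exact: hq|exact: fM|exact: hN].
rewrite op_hornerM //.
set v := op_horner q A x; set w := fcalc h A x.
have -> : op_horner p A v - fcalc f A w =
    (op_horner p A v - fcalc f A v) + fcalc f A (v - w).
  by rewrite (blinB (fcalc_bop fE)) addrA subrK.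
have h1 := fcalc_bound fE (ltW d0) hp v.
have h2 := fcalc_bound hE (ltW d0) hq x; rewrite -/v -/w in h2.
have h3 := fcalc_norm fE M0 fM (v - w).
have h4 := fcalc_norm hE N0 hN x; rewrite -/w in h4.
have h5 : hnorm v <= (N + d) * hnorm x.
  by have := hnormD (v - w) w; rewrite subrK mulrDl; lra.
have h6 := ler_wpM2l (ltW d0) h5; have h7 := ler_wpM2l M0 h2.
have h8 := ler_wpM2r (hnorm_ge0 x) ds.
have h9 : d * (d * hnorm x) <= 1 * (d * hnorm x).
  by rewrite ler_wpM2r // mulr_ge0 ?hnorm_ge0 // ltW.
rewrite (le_trans (hnormD _ _)) //; lra.
Qed.

Lemma calcfun_poly_comp f q : calcfun E f -> calcfun E (fun t => q.[f t]).
Proof.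
move=> fE; elim/poly_ind: q => [|q c ih].
  by under eq_fun do rewrite horner0; exact: calcfun_cst.
under eq_fun do rewrite hornerMXaddC.
exact: calcfunD (calcfunM ih fE) (calcfun_cst c).
Qed.

(** Multiplicativity makes f -> f(A) a morphism, so it commutes with polynomials;
    fcalc_comp then follows by approximating the outer function. *)
Lemma fcalc_poly_comp f q : calcfun E f ->
  fcalc (fun t => q.[f t]) A = op_horner q (fcalc f A).
Proof.
move=> fE; have sf := fcalc_symop fE.1.
elim/poly_ind: q => [|q c ih].
  under eq_fun do rewrite horner0.
  rewrite fcalc_cst; apply: funext => x.
  by rewrite -polyC0 op_hornerC.
under eq_fun do rewrite hornerMXaddC.
have qE := calcfun_poly_comp q fE.
rewrite (fcalcD (calcfunM qE fE).1 (poly_approx_cst c)) (fcalcM qE fE) ih fcalc_cst.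
by apply: funext => x; rewrite op_hornerD // op_hornerM // op_hornerX // op_hornerC.
Qed.

Lemma calcfun_comp (E' : set R) f h : calcfun E f -> calcfun E' h ->
  (forall t, E t -> E' (f t)) -> calcfun E (fun t => h (f t)).
Proof.
move=> fE [hE' [M M0 hM]] EE'; split; last first.
  by exists M => // t /EE'; exact: hM.
move=> e e0; have e2 : 0 < e / 2 by rewrite divr_gt0.
have [q hq] := hE' _ e2; have [p hp] := (calcfun_poly_comp q fE).1 _ e2.
exists p => t Et; have := hp t Et; have := hq _ (EE' t Et).
by rewrite !ler_norml; lra.
Qed.

End Rules.

Lemma fcalc_comp H (A : H -> H) (E E' : set R) f h :
  symop A -> spec_in A E -> calcfun E f -> calcfun E' h ->
  (forall t, E t -> E' (f t)) -> spec_in (fcalc f A) E' ->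
  fcalc h (fcalc f A) = fcalc (fun t => h (f t)) A.
Proof.
move=> sA AE fE hE' EE' fAE'; have sf := fcalc_symop sA AE fE.1.
have hf := calcfun_comp fE hE' EE'.
apply: (fcalc_eq sf fAE') => e e0.
have [q hq] := hE'.1 e e0; exists q; split=> // x.
have qf := calcfun_poly_comp q fE.
rewrite -(fcalc_poly_comp sA AE q fE).
have hqf : poly_approx E (fun t => q.[f t] + -1 * h (f t)).
  exact: poly_approxD qf.1 (poly_approxZ _ hf.1).
have := fcalc_norm sA AE hqf (ltW e0) _ x.
rewrite (fcalcD sA AE qf.1 (poly_approxZ _ hf.1)) (fcalcZ sA AE _ hf.1).
rewrite rmorphN scaleN1r; apply => t /EE' Et.
by rewrite mulN1r; exact: hq.
Qed.

(** A relation A T = T A' passes to polynomials, then to limits. This one rule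
    covers unitary conjugation, direct sums, and T' f(T T') = f(T' T) T'. *)
Lemma fcalc_intertwine H K (A : K -> K) (A' : H -> H) (T : H -> K) E f :
  symop A -> symop A' -> spec_in A E -> spec_in A' E -> poly_approx E f -> blin T ->
  (forall x, A (T x) = T (A' x)) ->
  forall x, fcalc f A (T x) = T (fcalc f A' x).
Proof.
move=> sA sA' AE A'E fE bT AT x.
have itE n y : iter n A (T y) = T (iter n A' y).
  by elim: n => //= n ->; rewrite AT.
have pT p y : op_horner p A (T y) = T (op_horner p A' y).
  rewrite /op_horner (blin_sum bT); apply: eq_bigr => i _.
  by rewrite itE (blinZ bT).
have [_ [M M0 hM]] := bT.
apply/eqP; rewrite -subr_eq0; apply/eqP/hnorm_eq0/eqP.
rewrite eq_le hnorm_ge0 andbT.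
apply: (@le_of_cvg0 _ _ _ (fun n => n.+1%:R^-1 * (hnorm (T x) + M * hnorm x)));
  last exact: cvg_harmonicM.
move=> n; rewrite add0r; pose d : R := n.+1%:R^-1.
have d0 : 0 < d by rewrite invr_gt0.
have [p hp] := fE d d0.
have h1 := fcalc_bound sA AE fE (ltW d0) hp (T x).
have h2 := fcalc_bound sA' A'E fE (ltW d0) hp x.
have h3 := le_trans (hM _) (ler_wpM2l M0 h2); rewrite (blinB bT) -pT in h3.
have := hnormD (fcalc f A (T x) - op_horner p A (T x))
            (op_horner p A (T x) - T (fcalc f A' x)).
by rewrite addrA subrK; rewrite hnormB in h1; rewrite -/d; lra.
Qed.

(** * Operators with form bounds *)

Definition seg (a b : R) : set R := [set t | a <= t <= b].

Definition form_bounds H (a b : R) (A : H -> H) :=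
  symop A /\ forall x, a * rdot x x <= rdot (A x) x <= b * rdot x x.

(** Outside the form bounds the operator, or its opposite, is bounded below. *)
Lemma form_bounds_spec H a b (A : H -> H) : form_bounds a b A -> spec_in A (seg a b).
Proof.
move=> [sA hA] t nt; apply/andP; split; rewrite leNgt; apply/negP => lt; apply: nt.
  apply: (symop_ge_invertible (c := a - t) (symop_shift t sA)); first by rewrite subr_gt0.
  by move=> x; have /andP[h _] := hA x; rewrite rdotBl rdotZl mulrBl lerB.
have sB : symop (fun x => t%:C *: x - A x) by exact: symop_sub (symop_scalar H t) sA.
have : invertible_op (fun x => t%:C *: x - A x).
  apply: (symop_ge_invertible (c := t - b) sB); first by rewrite subr_gt0.
  by move=> x; have /andP[_ h] := hA x; rewrite rdotBl rdotZl mulrBl lerB.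
move=> /(invertible_comp (@invertible_scalar _ H (-1) _)); rewrite oppr_eq0 oner_eq0.
move=> /(_ isT); congr invertible_op.
by apply: funext => x; rewrite scaleN1r opprB.
Qed.

Lemma form_bounds_ex H (A : H -> H) (a : R) : symop A ->
  (forall x, a * rdot x x <= rdot (A x) x) -> exists2 b, a < b & form_bounds a b A.
Proof.
move=> sA hA; have [M M0 hM] := blin_form_le sA.1.
exists (M + `|a| + 1); first by have := ler_norm a; lra.
split=> // x; rewrite hA /=; have /andP[_] := hM x.
by have := rdot_ge0 x; have := normr_ge0 a; nra.
Qed.

Lemma form_bounds_weak H a b a' b' (A : H -> H) :
  form_bounds a b A -> a' <= a -> b <= b' -> form_bounds a' b' A.
Proof.
move=> [sA hA] aa bb; split=> // x; have /andP[h1 h2] := hA x.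
by have h0 := rdot_ge0 x; apply/andP; split; nra.
Qed.

Lemma form_bounds_fcalc H (A : H -> H) E f (c d : R) :
  symop A -> spec_in A E -> poly_approx E f ->
  (forall t, E t -> c <= f t <= d) -> form_bounds c d (fcalc f A).
Proof.
move=> sA AE fE cd; split; first exact: (fcalc_symop sA AE fE).
move=> x; apply/andP; split.
  by apply: (fcalc_ge sA AE fE) => t /cd/andP[].
by apply: (fcalc_le_cst sA AE fE) => t /cd/andP[].
Qed.

Lemma pos_invertibleP H (A : H -> H) :
  pos_invertible A <-> exists a b, [/\ 0 < a, a < b & form_bounds a b A].
Proof.
split=> [[/psdE[sA pA] iA]|[a [b [a0 ab [sA hA]]]]].
  have [a a0 ha] := psd_invertible_ge sA pA iA.
  by have [b ab hb] := form_bounds_ex sA ha; exists a, b.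
split.
  apply/psdE; split=> // x; have /andP[+ _] := hA x; apply: le_trans.
  by rewrite mulr_ge0 ?rdot_ge0 // ltW.
by apply: (symop_ge_invertible sA a0) => x; case/andP: (hA x).
Qed.

Lemma form_bounds_common H K (A : H -> H) (B : K -> K) :
  pos_invertible A -> pos_invertible B ->
  exists a b, [/\ 0 < a, a < b, form_bounds a b A & form_bounds a b B].
Proof.
move=> /pos_invertibleP[a [b [a0 ab hA]]] /pos_invertibleP[c [d [c0 cd hB]]].
exists (Num.min a c), (Num.max b d); split.
- by rewrite lt_min a0.
- by rewrite gt_min !lt_max ab.
- by apply: form_bounds_weak hA _ _; rewrite ?ge_min ?le_max lexx.
- by apply: form_bounds_weak hB _ _; rewrite ?ge_min ?le_max lexx orbT.
Qed.

Lemma form_bounds_positive_spectrum H a b (A : H -> H) : 0 < a -> form_bounds a b A ->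
  positive_spectrum A.
Proof.
move=> a0 hA z sz; have zE := spectrum_real hA.1 sz.
exists (complex.Re z) => //; rewrite zE in sz.
by have /andP[h _] := form_bounds_spec hA sz; exact: lt_le_trans h.
Qed.

End FunctionalCalculus.

(** * Weierstrass approximation *)

Section Weierstrass.
Context {R : realType}.
Implicit Types (f : R -> R).

(** Bernstein polynomials through the recursion that conditions a binomial
    variable on one of its trials. *)
Fixpoint bernstein (n : nat) (phi : nat -> R) : {poly R} :=
  if n is m.+1 then (1 - 'X) * bernstein m phi + 'X * bernstein m (phi \o S)
  else (phi 0%N)%:P.

(** The Chebyshev bound: a quadratic error bound is propagated by the recursion,
    because (n x - c)^2 + n x (1 - x), the second moment about c of the number of
    successes in n trials, satisfies that recursion exactly. *)
Lemma bernstein_close n (phi : nat -> R) (v e C c x : R) : 0 <= x <= 1 ->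
  (forall k, `|phi k - v| <= e + C * (k%:R - c) ^+ 2) ->
  `|(bernstein n phi).[x] - v| <=
    e + C * ((n%:R * x - c) ^+ 2 + n%:R * x * (1 - x)).
Proof.
move=> /andP[x0 x1]; elim: n phi c => [|n ih] phi c hphi.
  have := hphi 0%N; rewrite /= hornerC; congr (_ <= _); ring.
rewrite /= hornerD !hornerM hornerD hornerN hornerX hornerC.
have h1 := ih phi c hphi.
have h2 : `|(bernstein n (phi \o S)).[x] - v| <=
    e + C * ((n%:R * x - (c - 1)) ^+ 2 + n%:R * x * (1 - x)).
  apply: ih => k; have := hphi k.+1; rewrite /= -natr1.
  by have -> : k%:R + 1 - c = k%:R - (c - 1) by ring.
set u := (bernstein n phi).[x] in h1 *; set w := (bernstein n _).[x] in h2 *.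
have -> : (1 - x) * u + x * w - v = (1 - x) * (u - v) + x * (w - v) by ring.
have x1' : 0 <= 1 - x by rewrite subr_ge0.
rewrite (le_trans (ler_normD _ _)) // !normrM (ger0_norm x0) (ger0_norm x1').
have := lerD (ler_wpM2l x1' h1) (ler_wpM2l x0 h2).
move/le_trans; apply; rewrite le_eqVlt; apply/orP; left; apply/eqP.
rewrite -natr1; ring.
Qed.

(** Continuity is assumed at the points of the segment in the whole line, so s may
    leave the segment. *)
Lemma unif_cont f (a b e : R) : (forall t, seg a b t -> {for t, continuous f}) ->
  0 < e -> exists2 d : R, 0 < d & forall s t, seg a b t -> `|s - t| < d ->
    `|f s - f t| < e.
Proof.
move=> cf e0.
have /compact_near_coveringP/(_ R (0^'+)
  (fun d t => forall s, `|s - t| < d -> `|f s - f t| < e) _) := @segment_compact R a b.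
have -> : [set` `[a, b]] = seg a b.
  by apply/seteqP; split=> t; rewrite /= in_itv.
case.
  move=> /= t tab; have e2 : 0 < e / 2 by rewrite divr_gt0.
  have /cvgrPdist_lt/(_ _ e2)/nbhs_ballP[r /= r0 hr] := cf t tab.
  have r2 : 0 < r / 2 by rewrite divr_gt0.
  near=> t' d => /= s sd.
  have tt : `|t - t'| < r / 2.
    by near: t'; exact: (nbhsx_ballx t _ r2).
  have dr : d < r / 2.
    by near: d; apply: nbhs_right_lt.
  have h1 : `|f t - f t'| < e / 2.
    by apply: hr; rewrite /ball /= (lt_le_trans tt) // ler_pdivrMr //; lra.
  have h2 : `|f t - f s| < e / 2.
    apply: hr; rewrite /ball /=.
    by move: tt sd; rewrite !ltr_norml; lra.
  by move: h1 h2; rewrite !ltr_norml; lra.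
move=> d /= d0 hd.
exists (d / 2); first by rewrite divr_gt0.
move=> s t tab; apply: (hd (d / 2)) => //=.
  by rewrite sub0r normrN gtr0_norm ?divr_gt0 // ltr_pdivrMr //; lra.
by rewrite divr_gt0.
Unshelve. all: by end_near. Qed.

(** Uniform continuity and boundedness of f give |f s - f t| <= e / 2 + K' (s - t)^2,
    the hypothesis of bernstein_close after rescaling the segment to [0, 1]; the
    remaining error K / n is small by the choice of n. *)
Lemma calcfun_seg f (a b : R) : (forall t, seg a b t -> {for t, continuous f}) ->
  calcfun (seg a b) f.
Proof.
move=> cf.
have [ba|ab|->] := ltgtP b a.
- have no t : ~ seg a b t by move=> /andP[h1 h2]; lra.
  by split; [move=> e e0; exists 0 => t /no | exists 0 => // t /no].
- have cw : {within `[a, b], continuous f}.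
    by apply: continuous_in_subspaceT => t; rewrite inE /= in_itv /= => /cf.
  have [M M0 hM] : exists2 M : R, 0 < M & forall t, seg a b t -> `|f t| <= M.
    have [c _ hc] := EVT_max (ltW ab) cw; have [d _ hd] := EVT_min (ltW ab) cw.
    exists (`|f c| + `|f d| + 1).
      by rewrite ltr_wpDl // addr_ge0.
    move=> t tab; have := hc t tab; have := hd t tab.
    have := ler_norm (f c); have := ler_norm (- f d); rewrite normrN => *.
    have := normr_ge0 (f c); have := normr_ge0 (f d) => *.
    rewrite ler_norml; apply/andP; split; lra.
  split; last by exists M; [exact: ltW | exact: hM].
  move=> e e0; have e2 : 0 < e / 2 by rewrite divr_gt0.
  have [d d0 hd] := unif_cont cf e2.
  pose L := b - a; have L0 : 0 < L by rewrite subr_gt0.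
  pose K := 2 * M * L ^+ 2 / d ^+ 2.
  have K0 : 0 < K by rewrite divr_gt0 ?exprn_gt0 // !mulr_gt0 ?exprn_gt0.
  pose n := (Num.truncn (2 * K / e)).+1.
  have n0 : 0 < n%:R :> R by rewrite ltr0n.
  have nK : K / n%:R <= e / 2.
    have := truncnS_gt (2 * K / e); rewrite -/n ltr_pdivrMr // => h.
    rewrite ler_pdivrMr // mulrAC ler_pdivlMr //; lra.
  pose phi k := f (a + L * Num.min (k%:R / n%:R) 1).
  pose aff : {poly R} := L^-1 *: ('X - a%:P).
  exists (bernstein n phi \Po aff) => t tab.
  pose x := (t - a) / L.
  rewrite horner_comp /aff hornerZ hornerXsubC (mulrC _ (t - a)) -/x; have /andP[ta tb] := tab.
  have x01 : 0 <= x <= 1.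
    apply/andP; rewrite /x; split; first by rewrite divr_ge0 ?subr_ge0 // ltW.
    by rewrite ler_pdivrMr // mul1r /L lerB.
  have tE : t = a + L * x by rewrite /x mulrC divfK ?gt_eqF // addrC subrK.
  (* k / n is cut off at 1 because the moment recursion ranges over all k *)
  have key k : `|phi k - f t| <= e / 2 + (K / n%:R ^+ 2) * (k%:R - n%:R * x) ^+ 2.
    rewrite /phi; set m := Num.min _ _; pose s := a + L * m.
    have m01 : 0 <= m <= 1.
      by rewrite le_min ge_min lexx orbT ler01 !andbT divr_ge0.
    have sab : seg a b s.
      have /andP[m0 m1] := m01; apply/andP; rewrite /s; split.
        by rewrite lerDl mulr_ge0 // ltW.
      have := ler_wpM2l (ltW L0) m1; rewrite /L; lra.
    have -> : K / n%:R ^+ 2 * (k%:R - n%:R * x) ^+ 2 = K * (k%:R / n%:R - x) ^+ 2.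
      by field; rewrite gt_eqF.
    have mx : (m - x) ^+ 2 <= (k%:R / n%:R - x) ^+ 2.
      rewrite /m minEle; case: ifP => // /negbT; rewrite -ltNge => kn.
      by case/andP: x01 => _ x1; rewrite lerXn2r ?nnegrE ?subr_ge0 //; lra.
    have [lt|ge] := ltP `|s - t| d.
      have := hd s t tab lt => /ltW /le_trans; apply.
      by rewrite lerDl mulr_ge0 ?sqr_ge0 // ltW.
    rewrite (le_trans (ler_normB _ _)) //.
    have h1 := hM s sab; have h2 := hM t tab.
    have h3 : d ^+ 2 <= L ^+ 2 * (m - x) ^+ 2.
      have -> : L ^+ 2 * (m - x) ^+ 2 = `|s - t| ^+ 2.
        by rewrite real_normK ?num_real // {1}tE /s; ring.
      by rewrite lerXn2r ?nnegrE // ltW.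
    have h4 : 2 * M <= K * (m - x) ^+ 2.
      have M2 : 0 <= 2 * M by rewrite mulr_ge0 // ltW.
      have h := ler_wpM2l M2 h3.
      rewrite /K (mulrAC _ (d ^+ 2)^-1) ler_pdivlMr ?exprn_gt0 //.
      by rewrite -[X in _ <= X]mulrA.
    have h5 := ler_wpM2l (ltW K0) mx; lra.
  have := bernstein_close n x01 key; move/le_trans; apply.
  rewrite subrr expr0n add0r.
  have -> : K / n%:R ^+ 2 * (n%:R * x * (1 - x)) = (K / n%:R) * (x * (1 - x)).
    by field; rewrite gt_eqF.
  rewrite [X in _ <= X]splitr lerD2l (le_trans _ nK) //.
  have Kn0 : 0 <= K / n%:R by apply: divr_ge0; exact: ltW.
  apply: ler_piMr => //.
  by case/andP: x01 => x0 x1; nra.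
- split; last by exists `|f a| => // t /andP[h1 h2]; rewrite (@le_anti _ _ t a) ?h1 ?h2.
  move=> e e0; exists (f a)%:P => t /andP[h1 h2].
  by rewrite hornerC (@le_anti _ _ t a) ?h1 ?h2 // subrr normr0 ltW.
Qed.

End Weierstrass.

(** * Hilbert direct sums *)

Section DirectSum.
Context {R : realType} (H K : hilbertType R).

(** The product already carries the maximum norm, which is not Hilbertian: a fresh
    name receives the Euclidean one. *)
Definition dsum : Type := (H * K)%type.

HB.instance Definition _ := GRing.Lmodule.copy dsum (H * K)%type.

Implicit Types u v w : dsum.

Definition ddot u v : R[i] := hdot H u.1 v.1 + hdot K u.2 v.2.

Lemma ddot_bilinear :
  bilinear_for *%R (Num.conj \; *%R) ddot.
Proof.
split=> [v|u] c x y; rewrite /ddot /=.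
  by rewrite !linearPl /=; rewrite mulrDr addrACA.
by rewrite !linearPr /=; rewrite mulrDr addrACA.
Qed.

HB.instance Definition _ :=
  bilinear_isBilinear.Build R[i] dsum dsum R[i] _ _ ddot ddot_bilinear.

Lemma ddot_hermitian u v : ddot u v = (-1) ^+ false * Num.conj (ddot v u).
Proof. by rewrite /ddot rmorphD mulrDr -!hermC. Qed.

HB.instance Definition _ :=
  isHermitianSesquilinear.Build R[i] dsum false Num.conj ddot ddot_hermitian.

Lemma ddot_gt0 u : u != 0 -> 0 < ddot u u.
Proof.
case: u => x y; rewrite /ddot /= => xy0.
have [x0|x0] := eqVneq x 0.
  have y0 : y != 0 by apply: contraNneq xy0 => ->; rewrite x0.
  by rewrite ltr_wpDl ?dnorm_ge0 ?neq0_dnorm_gt0.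
by rewrite ltr_pwDl ?dnorm_ge0 ?neq0_dnorm_gt0.
Qed.

HB.instance Definition _ := isDotProduct.Build R[i] dsum ddot ddot_gt0.

Definition sumnorm u : R := Num.sqrt (rdot u.1 u.1 + rdot u.2 u.2).

Lemma sumnorm_sqr u : sumnorm u ^+ 2 = rdot u.1 u.1 + rdot u.2 u.2.
Proof. by rewrite sqr_sqrtr // addr_ge0 ?rdot_ge0. Qed.

Lemma sumnorm_ge0 u : 0 <= sumnorm u. Proof. exact: sqrtr_ge0. Qed.

Lemma sumnormD u v : sumnorm (u + v) <= sumnorm u + sumnorm v.
Proof.
rewrite -ler_sqr ?nnegrE ?addr_ge0 ?sumnorm_ge0 // sqrrD !sumnorm_sqr /=.
rewrite !rdotDl !rdotDr (rdotC v.1) (rdotC v.2).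
suff : rdot u.1 v.1 + rdot u.2 v.2 <= sumnorm u * sumnorm v by lra.
rewrite (le_trans (ler_norm _)) // -ler_sqr ?nnegrE ?mulr_ge0 ?sumnorm_ge0 //.
rewrite exprMn !sumnorm_sqr real_normK ?num_real //; apply: discr_le => t.
have := addr_ge0 (rdot_ge0 (u.1 + t%:C *: v.1)) (rdot_ge0 (u.2 + t%:C *: v.2)).
rewrite !rdotDl !rdotDr !rdotZl !rdotZr (rdotC v.1) (rdotC v.2).
by congr (_ <= _); ring.
Qed.

Definition dsum_norm u : R[i] := (sumnorm u)%:C.

Lemma dsum_normD u v : dsum_norm (u + v) <= dsum_norm u + dsum_norm v.
Proof. by rewrite -rmorphD lecR sumnormD. Qed.

Lemma dsum_norm_sqr u : dsum_norm u ^+ 2 = ddot u u.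
Proof.
by rewrite /ddot !hdot_xx -rmorphXn sumnorm_sqr rmorphD.
Qed.

Lemma dsum_normZ (c : R[i]) u : dsum_norm (c *: u) = `|c| * dsum_norm u.
Proof.
apply/eqP; rewrite -(@eqrXn2 _ 2) ?mulr_ge0 //; last 2 first.
- by rewrite lecR sumnorm_ge0.
- by rewrite lecR sumnorm_ge0.
rewrite exprMn !dsum_norm_sqr; apply/eqP.
rewrite /ddot /= !(linearZl_LR, linearZr_LR) /=.
by rewrite normCK mulrDr; congr (_ + _); rewrite -mulrA mulrCA.
Qed.

Lemma dsum_norm_eq0 u : dsum_norm u = 0 -> u = 0.
Proof.
move=> h; apply/eqP; apply: contraT => /ddot_gt0.
by rewrite -dsum_norm_sqr h expr0n ltxx.
Qed.

HB.instance Definition _ :=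
  Lmodule_isNormed.Build R[i] dsum dsum_normD dsum_normZ dsum_norm_eq0.

Lemma dsum_norm_def u : `|u| = dsum_norm u. Proof. by []. Qed.

Lemma hnorm_fst u : `|u.1| <= `|u|.
Proof.
rewrite dsum_norm_def normhE lecR ler_sqrt ?addr_ge0 ?rdot_ge0 //.
by rewrite lerDl rdot_ge0.
Qed.

Lemma hnorm_snd u : `|u.2| <= `|u|.
Proof.
rewrite dsum_norm_def normhE lecR ler_sqrt ?addr_ge0 ?rdot_ge0 //.
by rewrite lerDr rdot_ge0.
Qed.

Lemma dsum_norm_le u : `|u| <= `|u.1| + `|u.2|.
Proof.
rewrite dsum_norm_def !normhE -rmorphD lecR -ler_sqr ?nnegrE ?addr_ge0 ?hnorm_ge0 ?sumnorm_ge0 //.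
rewrite sumnorm_sqr sqrrD !hnorm_sqr.
have : 0 <= hnorm u.1 * hnorm u.2 by rewrite mulr_ge0 ?hnorm_ge0.
by lra.
Qed.

(** The projections are contractions, so they send Cauchy filters to Cauchy
    filters, and the Euclidean norm is at most the sum of the two norms. *)
Lemma dsum_complete (F : set_system dsum) : ProperFilter F -> cauchy F -> cvg F.
Proof.
move=> FF /cauchy_ballP cF.
have proj (L : hilbertType R) (pi : dsum -> L) :
    (forall u v, pi (u - v) = pi u - pi v) -> (forall u, `|pi u| <= `|u|) ->
    cauchy (pi @ F).
  move=> piB pi_le; apply/cauchy_ballP => e e0; have := cF e e0.
  rewrite !near_simpl => -[[P Q] [/= FP FQ] PQ].
  exists ([set x | exists2 u, P u & pi u = x], [set x | exists2 u, Q u & pi u = x]).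
    by split; [apply: filterS FP | apply: filterS FQ] => u ?; exists u.
  move=> [x y] [/= [u Pu <-] [v Qv <-]].
  have := PQ (u, v) (conj Pu Qv); rewrite -!ball_normE /= -piB.
  exact: le_lt_trans (pi_le _).
have c1 : cauchy ((fun u : dsum => u.1) @ F) by exact: proj hnorm_fst.
have c2 : cauchy ((fun u : dsum => u.2) @ F) by exact: proj hnorm_snd.
have /cvg_ex[/= l1 /cvgrPdist_lt h1] : cvg ((fun u : dsum => u.1) @ F).
  exact: cauchy_cvg.
have /cvg_ex[/= l2 /cvgrPdist_lt h2] : cvg ((fun u : dsum => u.2) @ F).
  exact: cauchy_cvg.
apply/cvg_ex; exists ((l1, l2) : dsum); apply/cvgrPdist_lt => e e0.
have e2 : 0 < e / 2 by rewrite divr_gt0.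
near=> u.
rewrite (le_lt_trans (dsum_norm_le _)) // (splitr e) ltrD //=.
  by near: u; exact: h1.
by near: u; exact: h2.
Unshelve. all: by end_near. Qed.

HB.instance Definition _ := Uniform_isComplete.Build dsum dsum_complete.

Lemma dsum_normE u : `|u| ^+ 2 = ddot u u. Proof. exact: dsum_norm_sqr. Qed.

Definition hsum : hilbertType R := @Hilbert R dsum ddot dsum_normE.

End DirectSum.

(** * Operators on direct sums *)

Section DirectSumOperators.
Context {R : realType}.
Implicit Types (H K L : hilbertType R).

Lemma rdot_hsum H K (u v : hsum H K) :
  rdot u v = rdot u.1 v.1 + rdot u.2 v.2.
Proof. by rewrite /rdot raddfD. Qed.

Lemma hnorm_hsum_le H K (u : hsum H K) : hnorm u <= hnorm u.1 + hnorm u.2.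
Proof.
by have := dsum_norm_le u; rewrite (normhE (u : hsum H K)) !normhE -rmorphD lecR.
Qed.

Definition hpair H K L (A : L -> H) (B : L -> K) (x : L) : hsum H K := (A x, B x).

Lemma blin_pair H K L (A : L -> H) (B : L -> K) :
  blin A -> blin B -> blin (hpair A B).
Proof.
move=> bA bB; split=> [c x y|].
  by rewrite /hpair (blinP bA) (blinP bB).
case: bA bB => _ [M M0 hA] [_ [N N0 hB]]; exists (M + N); first exact: addr_ge0.
by move=> x; apply: (le_trans (hnorm_hsum_le _)); rewrite mulrDl;
  apply: lerD; [exact: hA|exact: hB].
Qed.

Lemma blin_fst H K : blin (fun u : hsum H K => u.1).
Proof.
split=> //; exists 1 => // u; rewrite mul1r /hnorm ler_sqrt ?rdot_ge0 // rdot_hsum lerDl.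
exact: rdot_ge0.
Qed.

Lemma blin_snd H K : blin (fun u : hsum H K => u.2).
Proof.
split=> //; exists 1 => // u; rewrite mul1r /hnorm ler_sqrt ?rdot_ge0 // rdot_hsum lerDr.
exact: rdot_ge0.
Qed.

Definition diag_op H K (A : H -> H) (B : K -> K) (u : hsum H K) : hsum H K :=
  (A u.1, B u.2).

Lemma symop_diag H K (A : H -> H) (B : K -> K) : symop A -> symop B -> symop (diag_op A B).
Proof.
move=> [bA sA] [bB sB]; split.
  exact: blin_pair (blin_comp bA (blin_fst _ _)) (blin_comp bB (blin_snd _ _)).
by move=> u v; rewrite !rdot_hsum /= sA sB.
Qed.

Lemma spec_in_diag H K (A : H -> H) (B : K -> K) E :
  spec_in A E -> spec_in B E -> spec_in (diag_op A B) E.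
Proof.
move=> AE BE t st; apply: contrapT => nEt; apply: st.
have [A' [/bounded_opE bA' AA' A'A]] : invertible_op (fun x => A x - t%:C *: x).
  by apply: contrapT => /AE.
have [B' [/bounded_opE bB' BB' B'B]] : invertible_op (fun x => B x - t%:C *: x).
  by apply: contrapT => /BE.
exists (diag_op A' B'); split.
- apply/bounded_opE.
  exact: blin_pair (blin_comp bA' (blin_fst _ _)) (blin_comp bB' (blin_snd _ _)).
- by move=> [x y]; rewrite /diag_op /= AA' BB'.
- by move=> [x y]; rewrite /diag_op; congr pair; [exact: A'A|exact: B'B].
Qed.

(** The two inclusions intertwine A and B with their direct sum. *)
Lemma fcalc_diag H K (A : H -> H) (B : K -> K) E f : symop A -> symop B ->
  spec_in A E -> spec_in B E -> poly_approx E f ->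
  fcalc f (diag_op A B) = diag_op (fcalc f A) (fcalc f B).
Proof.
move=> sA sB AE BE fE; have sD := symop_diag sA sB; have DE := spec_in_diag AE BE.
have b1 : blin (hpair (fun x : H => x) (fun x => (0 : K))).
  exact: blin_pair (blin_id _) (blin_cst0 _ _).
have b2 : blin (hpair (fun x => (0 : H)) (fun x : K => x)).
  exact: blin_pair (blin_cst0 _ _) (blin_id _).
have h1 := fcalc_intertwine sD sA DE AE fE b1 _.
have h2 := fcalc_intertwine sD sB DE BE fE b2 _.
apply: funext => -[x y].
have -> : ((x, y) : hsum H K) = (hpair (fun x : H => x) (fun x => (0 : K)) x : hsum H K) +
     (hpair (fun x => (0 : H)) (fun x : K => x) y).
  by change ((x, y) = (x + 0, 0 + y)); rewrite addr0 add0r.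
rewrite (blinD (fcalc_bop sD DE fE)) h1 ?h2; last 2 first.
- by move=> z; rewrite /diag_op /hpair /= (blin0 sA.1).
- by move=> z; rewrite /diag_op /hpair /= (blin0 sB.1).
change ((fcalc f A x + 0, 0 + fcalc f B y) = (fcalc f A (x + 0), fcalc f B (0 + y))).
by rewrite !addr0 !add0r.
Qed.

Lemma spec_in_scalar H (c : R) (E : set R) : E c -> spec_in (fun x : H => c%:C *: x) E.
Proof.
move=> Ec t st; have [->//|tc] := eqVneq t c; exfalso; apply: st.
have -> : (fun x : H => c%:C *: x - t%:C *: x) = (fun x => (c - t)%:C *: x).
  by apply: funext => x; rewrite -scalerBl -rmorphB.
by apply: invertible_scalar; rewrite fmorph_eq0 subr_eq0 eq_sym.
Qed.

Lemma fcalc_scalar H (c : R) f :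
  fcalc f (fun x : H => c%:C *: x) = (fun x => (f c)%:C *: x).
Proof.
have sE : spec_in (fun x : H => c%:C *: x) [set c] by exact: spec_in_scalar.
rewrite -(fcalc_cst (symop_scalar H c) sE (f c)).
symmetry; apply: (fcalc_ext (symop_scalar H c) sE) => [|t ->//].
exact: poly_approx_cst.
Qed.

Lemma spec_in_conj H (A U : H -> H) E : blin U -> cancel U U ->
  spec_in A E -> spec_in (fun x => U (A (U x))) E.
Proof.
move=> bU UU AE t st; apply: AE => inv; apply: st.
have iU : invertible_op U by exists U; split=> //; apply/bounded_opE.
have := invertible_comp iU (invertible_comp inv iU).
congr invertible_op; apply: funext => x.
by rewrite (blinB bU) (blinZ bU) UU.
Qed.

Lemma op_monotone_form (g : R -> R) H (A B : H -> H) a b c d E :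
  operator_monotone g -> 0 < a -> form_bounds a b A -> 0 < c -> form_bounds c d B ->
  spec_in A E -> spec_in B E -> poly_approx E g ->
  (forall x, rdot (B x) x <= rdot (A x) x) ->
  forall x, rdot (fcalc g B x) x <= rdot (fcalc g A x) x.
Proof.
move=> mg a0 hA c0 hB AE BE gE BA.
have [sA _] := hA; have [sB _] := hB.
apply/(op_leE (fcalc_symop sA AE gE) (fcalc_symop sB BE gE)).
apply: mg; [exact/selfadjointE|exact/selfadjointE|..].
- exact: form_bounds_positive_spectrum hA.
- exact: form_bounds_positive_spectrum hB.
- exact/op_leE.
Qed.

End DirectSumOperators.

(** * Operator monotone functions and compressions *)

(** Let V be an isometry with adjoint W and Q = 1 - V W. On the direct sum of H and
    K the matrix U = (0, W; V, Q) is a symmetric involution, and the upper left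
    corner of U diag(1, T) U is W T V. So U diag(1, T) U <= diag(W T V + e, N) for
    large N. The function g passes through U and through the diagonals; both
    sides are then evaluated at U (0, y). *)
Section Block.
Context {R : realType} {H K : hilbertType R} {g : R -> R}.
Hypothesis mg : operator_monotone g.
Variables (V : H -> K) (W : K -> H) (T : K -> K) (t1 t2 e N : R) (E : set R).
Hypotheses (bV : blin V) (bW : blin W) (VW : adj V W) (WV : cancel V W).
Hypotheses (t10 : 0 < t1) (t20 : 0 <= t2) (hT : form_bounds t1 t2 T) (e0 : 0 < e).
Hypothesis (hN : 1 + t2 ^+ 2 / e + t2 <= N).

Let C x := W (T (V x)) + e%:C *: x.
Hypotheses (TE : spec_in T E) (CE : spec_in C E) (E1 : E 1) (EN : E N).
Hypothesis gE : poly_approx E g.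

Let Q y := y - V (W y).
Let U (u : hsum H K) : hsum H K := (W u.2, V u.1 + Q u.2).

Let bQ : blin Q. Proof. exact: blin_sub (blin_id _) (blin_comp bV bW). Qed.

Let WQ y : W (Q y) = 0. Proof. by rewrite (blinB bW) WV subrr. Qed.

Let bU : blin U.
Proof.
apply: blin_pair; first exact: blin_comp bW (blin_snd _ _).
apply: blin_add; first exact: blin_comp bV (blin_fst _ _).
exact: blin_comp bQ (blin_snd _ _).
Qed.

Let UU : cancel U U.
Proof.
move=> [x y]; rewrite /U /= (blinD bW) WV WQ addr0; congr pair.
rewrite (blinD bQ) /Q WV subrr add0r (blinB bW) WV subrr (blin0 bV) subr0.
by rewrite addrC subrK.
Qed.

Let norm_V x : rdot (V x) (V x) = rdot x x. Proof. by rewrite VW WV. Qed.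

Let norm_Q y : rdot (Q y) (Q y) = rdot y y - rdot (W y) (W y).
Proof.
rewrite rdotBl !rdotBr norm_V (VW (W y) y) (rdotC y) (VW (W y) y); ring.
Qed.

Let adjU : adj U U.
Proof.
move=> u v; rewrite !rdot_hsum /= rdotDl rdotDr (adj_sym VW) VW.
have -> : rdot (Q u.2) v.2 = rdot u.2 (Q v.2); last by ring.
by rewrite rdotBl rdotBr VW (adj_sym VW).
Qed.

Let normU u : rdot (U u) (U u) = rdot u u. Proof. by rewrite adjU UU. Qed.

(** At y = V x the last term vanishes and this is Jensen's inequality for g; other
    vectors y show that g is not constant. *)
Lemma compression y : rdot (fcalc g T y) y <=
  rdot (fcalc g C (W y)) (W y) + g N * rdot (Q y) (Q y).
Proof.
have [sT fT] := hT.
have sC : symop C by apply: symop_add (symop_scalar H e); exact: symop_conj sT bV bW VW.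
have C_ge x : t1 * rdot x x <= rdot (C x) x.
  rewrite rdotDl rdotZl (adj_sym VW) -[X in t1 * X]norm_V.
  have /andP[h _] := fT (V x); have := mulr_ge0 (ltW e0) (rdot_ge0 x); lra.
have N1 : 1 <= N.
  have h : 0 <= t2 ^+ 2 / e by rewrite divr_ge0 ?sqr_ge0 // ltW.
  by move: hN t20; lra.
pose one := (fun x : H => 1%:C *: x); pose bigN := (fun y : K => N%:C *: y).
pose D := diag_op one T; pose B := diag_op C bigN.
have sone : symop one := symop_scalar H 1; have sN : symop bigN := symop_scalar K N.
have sD : symop D := symop_diag sone sT; have sB : symop B := symop_diag sC sN.
have sA : symop (fun u => U (D (U u))) := symop_conj sD bU bU adjU.
have oneE : spec_in one E by exact: spec_in_scalar.
have NE : spec_in bigN E by exact: spec_in_scalar.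
have DE := spec_in_diag oneE TE; have BE := spec_in_diag CE NE.
have AE := spec_in_conj bU UU DE.
pose a := Num.min 1 t1; have a0 : 0 < a by rewrite lt_min ltr01.
have a1 : a <= 1 by rewrite ge_min lexx.
have at1 : a <= t1 by rewrite ge_min lexx orbT.
have D_ge u : a * rdot u u <= rdot (D u) u.
  rewrite !rdot_hsum /= mulrDr; apply: lerD.
    by rewrite rdotZl ler_wpM2r ?rdot_ge0.
  by have /andP[h _] := fT u.2; rewrite (le_trans _ h) // ler_wpM2r ?rdot_ge0.
have A_ge u : a * rdot u u <= rdot (U (D (U u))) u.
  by rewrite adjU -{1 2}(UU u) normU D_ge.
have B_ge u : a * rdot u u <= rdot (B u) u.
  rewrite !rdot_hsum /= mulrDr; apply: lerD.
    by rewrite (le_trans _ (C_ge _)) // ler_wpM2r ?rdot_ge0.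
  by rewrite rdotZl ler_wpM2r ?rdot_ge0 // (le_trans a1).
have [b _ hA] := form_bounds_ex sA A_ge; have [b' _ hB] := form_bounds_ex sB B_ge.
(* Young's inequality absorbs the off-diagonal blocks: this is where the
   lower bound on N comes from. *)
have AB u : rdot (U (D (U u))) u <= rdot (B u) u.
  rewrite adjU !rdot_hsum /= !rdotZl mul1r rdotDl rdotZl (adj_sym VW (T (V u.1))).
  move: (V u.1) (norm_V u.1) (Q u.2) (norm_Q u.2) => p pp q nq.
  rewrite (blinD sT.1) rdotDl !rdotDr (sT.2 q p) (rdotC q).
  have := rdot_ge0 (e%:C *: p - T q).
  rewrite rdotBl !rdotBr !rdotZl !rdotZr (rdotC (T q)) -sT.2 pp.
  have Tq : rdot (T q) (T q) <= t2 ^+ 2 * rdot q q.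
    have h : hnorm (T q) <= t2 * hnorm q.
      apply: (symop_norm_le sT t20) => z; have /andP[h1 ->] := fT z; rewrite andbT.
      apply: le_trans h1; rewrite mulNr (@le_trans _ _ 0) //.
        by rewrite oppr_le0 mulr_ge0 ?rdot_ge0.
      by rewrite mulr_ge0 ?rdot_ge0 // ltW.
    by rewrite -!hnorm_sqr -exprMn lerXn2r ?nnegrE ?mulr_ge0 ?hnorm_ge0.
  have qq : rdot q q <= rdot u.2 u.2 by rewrite nq gerBl rdot_ge0.
  have WW : rdot (W u.2) (W u.2) <= rdot u.2 u.2.
    by rewrite -subr_ge0 -nq rdot_ge0.
  have /andP[_ Tqq] := fT q.
  have h1 : t2 * rdot q q <= t2 * rdot u.2 u.2 by rewrite ler_wpM2l.
  have h2 : t2 ^+ 2 * rdot q q <= t2 ^+ 2 * rdot u.2 u.2 by rewrite ler_wpM2l ?sqr_ge0.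
  have h3 := ler_wpM2r (rdot_ge0 u.2) hN.
  set s := rdot (T p) q => h4.
  have h5 : 2 * s <= e * rdot u.1 u.1 + t2 ^+ 2 / e * rdot u.2 u.2.
    rewrite -(ler_pM2l e0) mulrDr mulrA.
    have -> : e * (t2 ^+ 2 / e * rdot u.2 u.2) = t2 ^+ 2 * rdot u.2 u.2.
      by field; rewrite gt_eqF.
    lra.
  lra.
have := op_monotone_form mg a0 hB a0 hA BE AE gE AB.
move=> /(_ (U (0, y))).
have -> : fcalc g (fun u => U (D (U u))) (U (0, y)) = U (fcalc g D (0, y)).
  by apply: (fcalc_intertwine sA sD AE DE gE bU) => u; rewrite UU.
rewrite adjU UU (fcalc_diag sone sT oneE TE gE) (fcalc_diag sC sN CE NE gE).
rewrite !rdot_hsum /= rdot0r add0r (blin0 bV) add0r.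
by rewrite /bigN fcalc_scalar rdotZl.
Qed.

End Block.

(** * Regularity of operator monotone functions *)

Section Regularity.
Context {R : realType}.

Lemma interpolation (s : seq R) (f : R -> R) :
  exists p : {poly R}, forall t, t \in s -> p.[t] = f t.
Proof.
elim: s => [|a s [p hp]]; first by exists 0.
have [as_|as_] := boolP (a \in s).
  by exists p => t; rewrite inE => /orP[/eqP->|]; exact: hp.
pose q : {poly R} := \prod_(b <- s) ('X - b%:P).
have qa : q.[a] != 0 by rewrite -rootE root_prod_XsubC.
exists (p + ((f a - p.[a]) / q.[a]) *: q) => t; rewrite inE hornerD hornerZ.
have [->|ta] := eqVneq t a; first by rewrite divfK // addrC subrK.
move=> /= ts; have /rootP -> : root q t by rewrite root_prod_XsubC.
by rewrite mulr0 addr0 hp.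
Qed.

Lemma poly_approx_seq (s : seq R) (f : R -> R) : poly_approx [set t | t \in s] f.
Proof.
move=> e e0; have [p hp] := interpolation s f; exists p => t /hp ->.
by rewrite subrr normr0 ltW.
Qed.

(** Each use of g'(1) = 1 below compares two quantities that agree at 1. *)
Lemma is_derive_cross (f : R -> R) (x d : R) : is_derive x 1 f d -> 0 < d ->
  exists2 r : R, 0 < r & forall h, 0 < h < r -> f (x - h) < f x < f (x + h).
Proof.
move=> [df dfE] d0.
have /cvgrPdist_lt/(_ _ d0) : (fun h : R => h^-1 *: (f (h *: 1 + x) - f x)) @ 0^' --> d.
  by rewrite -dfE; exact: df.
move=> /nbhs_ballP[r /= r0 hr]; exists r => // h /andP[h0 hlt].
have key (s : R) : s != 0 -> `|s| < r -> 0 < s^-1 * (f (x + s) - f x).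
  move=> s0 sr; have := hr s; rewrite /ball /= sub0r normrN => /(_ sr s0).
  rewrite /GRing.scale /= mulr1 (addrC s) ltr_norml; lra.
apply/andP; split.
- have := key (- h); rewrite oppr_eq0 gt_eqF // normrN gtr0_norm // => /(_ isT hlt).
  by rewrite invrN mulNr oppr_gt0 pmulr_rlt0 ?invr_gt0 // subr_lt0.
- have := key h; rewrite gt_eqF // gtr0_norm // => /(_ isT hlt).
  by rewrite pmulr_rgt0 ?invr_gt0 // subr_gt0.
Qed.

Context {H : hilbertType R}.
Hypothesis H_neq0 : exists x : H, x != 0.
Variable g : R -> R.
Hypothesis mg : operator_monotone g.

(** A nonzero vector is what recovers scalars from forms. *)
Lemma scalar_form_le (a b : R) :
  (forall x : H, a * rdot x x <= b * rdot x x) -> a <= b.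
Proof.
have [x x0] := H_neq0; move=> /(_ x); rewrite ler_pM2r //.
rewrite lt_neqAle rdot_ge0 andbT; apply: contraNneq x0 => /esym/rdot_eq0 ->.
by [].
Qed.

Lemma form_bounds_scalar (K : hilbertType R) (c : R) : form_bounds c c (fun x : K => c%:C *: x).
Proof. by split; [exact: symop_scalar|move=> x; rewrite rdotZl !lexx]. Qed.

Lemma monotone_nondecreasing (a b : R) : 0 < a -> a <= b -> g a <= g b.
Proof.
move=> a0 ab; have b0 := lt_le_trans a0 ab.
have aE : spec_in (fun x : H => a%:C *: x) [set t | t \in [:: a; b]].
  by apply: spec_in_scalar; rewrite /= inE eqxx.
have bE : spec_in (fun x : H => b%:C *: x) [set t | t \in [:: a; b]].
  by apply: spec_in_scalar; rewrite /= !inE eqxx orbT.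
apply: scalar_form_le => x.
have := op_monotone_form mg b0 (form_bounds_scalar H b) a0 (form_bounds_scalar H a) bE aE
  (poly_approx_seq _ g) _ x.
rewrite !fcalc_scalar !rdotZl; apply => y.
by rewrite !rdotZl ler_wpM2r ?rdot_ge0.
Qed.

(** Compress diag(c, d) along the isometry (sqrt (1 - th), sqrt th). The vector
    V x gives the first inequality, concavity up to e; the vector (0, x) gives
    the second. No continuity of g is available yet, so the calculus runs on the
    finite set of the eigenvalues involved. *)
Lemma two_point (c d th e : R) : 0 < c -> 0 < d -> 0 <= th <= 1 -> 0 < e ->
  exists N0 : R, forall N, N0 <= N ->
   (1 - th) * g c + th * g d <= g ((1 - th) * c + th * d + e) /\
   g d <= th * g ((1 - th) * c + th * d + e) + (1 - th) * g N.
Proof.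
move=> c0 d0 /andP[th0 th1] e0.
pose k := Num.sqrt (1 - th); pose l := Num.sqrt th.
have k2 : k * k = 1 - th by rewrite -expr2 sqr_sqrtr // subr_ge0.
have l2 : l * l = th by rewrite -expr2 sqr_sqrtr.
pose m := (1 - th) * c + th * d + e.
pose V := hpair (fun x : H => k%:C *: x) (fun x => l%:C *: x).
pose W (y : hsum H H) := k%:C *: y.1 + l%:C *: y.2.
pose T := diag_op (fun x : H => c%:C *: x) (fun x : H => d%:C *: x).
have bV : blin V by apply: blin_pair; exact: blin_scalar.
have bW : blin W.
  by apply: blin_add; apply: blin_scale; [exact: blin_fst|exact: blin_snd].
have VW : adj V W.
  by move=> x y; rewrite rdot_hsum /= rdotDr !rdotZl !rdotZr.
have WV : cancel V W.
  move=> x; rewrite /W /V /= !scalerA -!rmorphM -scalerDl -rmorphD k2 l2.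
  by rewrite subrK scale1r.
pose t1 := Num.min c d; pose t2 := Num.max c d.
have t10 : 0 < t1 by rewrite lt_min c0.
have t20 : 0 <= t2 by rewrite le_max (ltW c0).
have hT : form_bounds t1 t2 T.
  split; first by apply: symop_diag; exact: symop_scalar.
  move=> u; rewrite !rdot_hsum /= !rdotZl !mulrDr.
  by apply/andP; split; apply: lerD; rewrite ler_wpM2r ?rdot_ge0 // ?ge_min ?le_max lexx ?orbT.
exists (1 + t2 ^+ 2 / e + t2) => N hN.
pose s := [:: 1; c; d; m; N].
have CE : (fun x => W (T (V x)) + e%:C *: x) = (fun x => m%:C *: x).
  apply: funext => x; rewrite /W /T /V /= !scalerA -!rmorphM -!scalerDl -!rmorphD.
  by congr (_%:C *: _); rewrite /m -k2 -l2; ring.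
have sE t : t \in s -> [set t | t \in s] t by [].
have TE : spec_in T [set t | t \in s].
  by apply: spec_in_diag; apply: spec_in_scalar; apply: sE; rewrite !inE eqxx ?orbT.
have := compression mg bV bW VW WV t10 t20 hT e0 hN TE _ _ _ (poly_approx_seq s g).
rewrite CE fcalc_scalar.
rewrite (fcalc_diag (symop_scalar H c) (symop_scalar H d) (E := [set t | t \in s])); last 3 first.
- by apply: spec_in_scalar; apply: sE; rewrite !inE eqxx ?orbT.
- by apply: spec_in_scalar; apply: sE; rewrite !inE eqxx ?orbT.
- exact: poly_approx_seq.
rewrite !fcalc_scalar => comp.
have {}comp y : rdot (diag_op (fun x : H => (g c)%:C *: x) (fun x : H => (g d)%:C *: x) y) y
  <= g m * rdot (W y) (W y) + g N * rdot (y - V (W y)) (y - V (W y)).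
  rewrite -rdotZl; apply: comp.
  - by apply: spec_in_scalar; apply: sE; rewrite !inE eqxx ?orbT.
  - by apply: sE; rewrite !inE eqxx.
  - by apply: sE; rewrite !inE eqxx ?orbT.
split; apply: scalar_form_le => x.
- have := comp (V x); rewrite WV subrr rdot0l mulr0 addr0.
  rewrite rdot_hsum /= !rdotZl !rdotZr !(mulrCA (g _)) !mulrA k2 l2.
  by rewrite -mulrDl.
- have := comp ((0, x) : hsum H H).
  rewrite rdot_hsum /= rdot0r add0r rdotZl.
  have -> : W (0, x) = l%:C *: x by rewrite /W /= scaler0 add0r.
  have -> : rdot ((0, x) - V (l%:C *: x) : hsum H H) ((0, x) - V (l%:C *: x)) =
      (1 - th) * rdot x x.
    rewrite rdot_hsum /= sub0r rdotNl rdotNr opprK rdotBl !rdotBr !rdotZl !rdotZr.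
    transitivity (((k * k) * (l * l) + (1 - l * l) ^+ 2) * rdot x x); first by ring.
    by rewrite k2 l2; ring.
  rewrite rdotZl rdotZr (mulrA l) l2 /m => h; apply: le_trans h _.
  by rewrite le_eqVlt; apply/orP; left; apply/eqP; ring.
Qed.

(** Concavity, applied to x as a point between c and y up to e = y - x, bounds the
    increment of g on [x, y] by a slope. *)
Lemma chord (c x y : R) : 0 < c -> x < y -> c < x - (y - x) ->
  g y - g x <= 2 * (y - x) / (y - c) * (g y - g c).
Proof.
move=> c0 xy cx.
have yc : 0 < y - c by lra.
pose th := 2 * (y - x) / (y - c).
have th01 : 0 <= th <= 1.
  apply/andP; rewrite /th; split; first by rewrite divr_ge0 // ?mulr_ge0; lra.
  by rewrite ler_pdivrMr // mul1r; lra.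
have th01' : 0 <= 1 - th <= 1 by case/andP: th01; lra.
have e0 : 0 < y - x by lra.
have y0 : 0 < y by lra.
have [N0 /(_ N0 (lexx _)) [h _]] := two_point c0 y0 th01' e0.
have E : (1 - (1 - th)) * c + (1 - th) * y + (y - x) = x.
  have : th * (y - c) = 2 * (y - x) by rewrite /th divfK // gt_eqF.
  lra.
rewrite E in h; rewrite -/th; lra.
Qed.

(** The slope bound with c = t / 4 is uniform near t. *)
Lemma monotone_continuous (t : R) : 0 < t -> {for t, continuous g}.
Proof.
move=> t0; apply/cvgrPdist_lt => e e0.
pose D := g (2 * t) - g (t / 4).
have t40 : 0 < t / 4 by rewrite divr_gt0.
have D0 : 0 <= D by rewrite subr_ge0 monotone_nondecreasing //; lra.
pose r := Num.min (t / 8) (e * (t / 8) / (D + 1)).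
have r0 : 0 < r by rewrite lt_min !divr_gt0 ?mulr_gt0 ?divr_gt0 //; lra.
have key x y : t / 2 < x -> x < y -> y < 2 * t -> y - x < r -> 0 <= g y - g x < e.
  move=> tx xy yt yx.
  rewrite subr_ge0 monotone_nondecreasing /=; [|lra|lra].
  have yr : y - x < t / 8 by rewrite (lt_le_trans yx) // ge_min lexx.
  have ye : (y - x) * (D + 1) < e * (t / 8).
    rewrite -ltr_pdivlMr; last lra.
    by rewrite (lt_le_trans yx) // ge_min lexx orbT.
  have c1 : t / 4 < x - (y - x) by lra.
  apply: (le_lt_trans (chord t40 xy c1)).
  have yD : g y - g (t / 4) <= D by rewrite lerD2r monotone_nondecreasing //; lra.
  have yc : 0 < y - t / 4 by lra.
  rewrite mulrAC ltr_pdivrMr //.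
  have h1 : 2 * (y - x) * (g y - g (t / 4)) <= 2 * (y - x) * D.
    by rewrite ler_wpM2l //; lra.
  have h2 : e * (t / 4) <= e * (y - t / 4) by rewrite ler_wpM2l //; lra.
  lra.
apply/nbhs_ballP; exists r => //= s; rewrite /ball /= => ts.
have r8 : r <= t / 8 by rewrite ge_min lexx.
move: ts; rewrite ltr_norml => /andP[ts1 ts2].
have [st|st|->] := ltgtP s t; last by rewrite subrr normr0.
- by have /andP[h1 h2] := key s t ltac:(lra) st ltac:(lra) ltac:(lra); rewrite ger0_norm.
- have /andP[h1 h2] := key t s ltac:(lra) st ltac:(lra) ltac:(lra).
  by rewrite distrC ger0_norm.
Qed.

(** If g took the value M at x < y, concavity would force g = M beyond y. The second
    inequality of two_point with d = y then gives M <= th g(m) + (1 - th) M, that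
    is g(m) >= M, at points m as close to 0 as desired. So g would be constant,
    which g'(1) = 1 excludes. *)
Lemma monotone_strict : is_derive (1 : R) 1 g 1 ->
  forall x y : R, 0 < x -> x < y -> g x < g y.
Proof.
move=> dg x y x0 xy.
have le_g := monotone_nondecreasing.
rewrite lt_neqAle (le_g _ _ x0 (ltW xy)) andbT; apply/eqP => gxy.
have y0 := lt_trans x0 xy.
(* g stays at its value past y, by concavity *)
have right z : y <= z -> g z = g y.
  rewrite le_eqVlt => /orP[/eqP->//|yz].
  apply: le_anti; rewrite (le_g y z) ?(ltW yz) // andbT.
  pose e := (y - x) / 2; have e0 : 0 < e by rewrite /e; lra.
  have zx : 0 < z - x by lra.
  pose th := (y - e - x) / (z - x).
  have thE : th * (z - x) = y - e - x by rewrite /th divfK // gt_eqF.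
  have th0 : 0 < th by rewrite /th divr_gt0 // /e; lra.
  have th1 : 0 <= th <= 1.
    by rewrite (ltW th0) /= /th ler_pdivrMr // mul1r /e; lra.
  have z0 : 0 < z by lra.
  have [N0 /(_ N0 (lexx _)) [h _]] := two_point x0 z0 th1 e0.
  have E : (1 - th) * x + th * z + e = y by lra.
  rewrite E gxy in h.
  by rewrite -(ler_pM2l th0); lra.
(* and then everywhere: the weight th of y is chosen small *)
have left b : 0 < b -> g y <= g b.
  move=> b0; have b4 : 0 < b / 4 by rewrite divr_gt0.
  pose th := Num.min (2^-1) (b / 4 / y).
  have th0 : 0 < th by rewrite lt_min invr_gt0 ltr0n /= divr_gt0.
  have th1 : th <= 2^-1 by rewrite ge_min lexx.
  have thy : th * y <= b / 4 by rewrite -ler_pdivlMr // ge_min lexx orbT.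
  have th01 : 0 <= th <= 1 by rewrite (ltW th0) /=; lra.
  have [N0 hN] := two_point b4 y0 th01 b4.
  have [] := hN (Num.max N0 y); first by rewrite le_max lexx.
  move=> _; rewrite (right (Num.max N0 y)) ?le_max ?lexx ?orbT // => h.
  set m := (1 - th) * _ + _ + _ in h.
  have {}h : g y <= g m by rewrite -(ler_pM2l th0); lra.
  apply: le_trans h _; apply: le_g; rewrite /m.
    by have := mulr_gt0 th0 y0; have : 0 <= (1 - th) * (b / 4) by [rewrite mulr_ge0; lra]; lra.
  have : 0 <= th * (b / 4) by rewrite mulr_ge0 ?ltW.
  lra.
have [r r0 /(_ (Num.min (r / 2) (2^-1)))] := is_derive_cross dg ltr01.
set h := Num.min _ _.
have h0 : 0 < h by rewrite lt_min divr_gt0 //= invr_gt0.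
have hr : h < r by rewrite (@le_lt_trans _ _ (r / 2)) ?ge_min ?lexx //; lra.
have h1 : h <= 2^-1 by rewrite ge_min lexx orbT.
rewrite h0 hr => /(_ isT) /andP[_].
have const z : 0 < z -> g z = g y.
  move=> z0; apply: le_anti; rewrite left // andbT.
  by have [/right ->//|/ltW zy] := leP y z; exact: le_g.
by rewrite !const ?ltxx //; lra.
Qed.

End Regularity.

(** * Functions of invertible positive operators *)

Section PositiveOperators.
Context {R : realType}.

(** Continuity at each positive point, in the line: then a function of an
    invertible positive operator is governed by any segment of positive numbers
    that contains the spectrum. *)
Definition cont_pos (f : R -> R) := forall t : R, 0 < t -> {for t, continuous f}.

Lemma cont_pos_pow (r : R) : cont_pos (fun t => t `^ r).
Proof.
move=> t t0; apply: differentiable_continuous; apply/derivable1_diffP.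
by apply: derivable_powR; rewrite in_itv /= t0.
Qed.
Arguments cont_pos_pow : clear implicits.

Lemma powRD_gt0 (t r s : R) : 0 < t -> t `^ (r + s) = t `^ r * t `^ s.
Proof. by move=> t0; rewrite powRD // (gt_eqF t0) implybT. Qed.

Lemma cont_pos_comp (f h : R -> R) : cont_pos f -> cont_pos h ->
  (forall t, 0 < t -> 0 < f t) -> cont_pos (fun t => h (f t)).
Proof.
move=> cf ch f0 t t0; apply: (@continuous_comp _ _ _ f h); first exact: cf.
by apply: ch; exact: f0.
Qed.

Lemma calcfun_cont_pos (a b : R) (f : R -> R) : 0 < a -> cont_pos f -> calcfun (seg a b) f.
Proof.
move=> a0 cf; apply: calcfun_seg => t /andP[at_ _].
by apply: cf; exact: lt_le_trans at_.
Qed.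

Lemma range_seg (a b : R) (f : R -> R) : 0 < a -> a < b -> cont_pos f ->
  (forall t, 0 < t -> 0 < f t) ->
  exists a' b', [/\ 0 < a', a' < b' & forall t, seg a b t -> seg a' b' (f t)].
Proof.
move=> a0 ab cf f0.
have cw : {within `[a, b], continuous f}.
  apply: continuous_in_subspaceT => t; rewrite inE /= in_itv /= => /andP[at_ _].
  by apply: cf; exact: lt_le_trans at_.
have [c _ hc] := EVT_max (ltW ab) cw; have [d dab hd] := EVT_min (ltW ab) cw.
exists (f d), (f c + 1); split.
- by apply: f0; move: dab; rewrite in_itv /= => /andP[ad _]; exact: lt_le_trans ad.
- by have := hd c; have := hc d dab; lra.
- move=> t tab; apply/andP; split; first exact: hd.
  by rewrite (le_trans (hc t tab)) // lerDl.
Qed.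

Context {H : hilbertType R}.
Implicit Types (A B C X : H -> H).

Lemma pos_symop A : pos_invertible A -> symop A.
Proof. by move=> [/psdE[]]. Qed.

Lemma pos_fcalc_le A f h : pos_invertible A -> cont_pos f -> cont_pos h ->
  (forall t, 0 < t -> f t <= h t) ->
  forall x, rdot (fcalc f A x) x <= rdot (fcalc h A x) x.
Proof.
move=> /pos_invertibleP[a [b [a0 ab hA]]] cf ch fh.
apply: (fcalc_le hA.1 (form_bounds_spec hA) (calcfun_cont_pos b a0 cf).1
  (calcfun_cont_pos b a0 ch).1).
by move=> t /andP[at_ _]; apply: fh; exact: lt_le_trans at_.
Qed.

Lemma pos_fcalc_pos A f : pos_invertible A -> cont_pos f ->
  (forall t, 0 < t -> 0 < f t) -> pos_invertible (fcalc f A).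
Proof.
move=> /pos_invertibleP[a [b [a0 ab hA]]] cf f0.
have [a' [b' [a'0 ab' hf]]] := range_seg a0 ab cf f0.
apply/pos_invertibleP; exists a', b'; split=> //.
exact: (form_bounds_fcalc hA.1 (form_bounds_spec hA) (calcfun_cont_pos b a0 cf).1 hf).
Qed.

Lemma pos_fcalc_comp A f h : pos_invertible A -> cont_pos f ->
  (forall t, 0 < t -> 0 < f t) -> cont_pos h ->
  fcalc h (fcalc f A) = fcalc (fun t => h (f t)) A.
Proof.
move=> /pos_invertibleP[a [b [a0 ab hA]]] cf f0 ch.
have [a' [b' [a'0 ab' hf]]] := range_seg a0 ab cf f0.
apply: (fcalc_comp hA.1 (form_bounds_spec hA) (calcfun_cont_pos b a0 cf)
  (calcfun_cont_pos b' a'0 ch) hf).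
exact: (form_bounds_spec (form_bounds_fcalc hA.1 (form_bounds_spec hA)
  (calcfun_cont_pos b a0 cf).1 hf)).
Qed.

Lemma pos_fcalcM A f h : pos_invertible A -> cont_pos f -> cont_pos h ->
  fcalc (fun t => f t * h t) A = (fun x => fcalc f A (fcalc h A x)).
Proof.
move=> /pos_invertibleP[a [b [a0 ab hA]]] cf ch.
exact: (fcalcM hA.1 (form_bounds_spec hA) (calcfun_cont_pos b a0 cf) (calcfun_cont_pos b a0 ch)).
Qed.

Lemma pos_fcalcZ A (c : R) f : pos_invertible A -> cont_pos f ->
  fcalc (fun t => c * f t) A = (fun x => c%:C *: fcalc f A x).
Proof.
move=> /pos_invertibleP[a [b [a0 ab hA]]] cf.
exact: (fcalcZ hA.1 (form_bounds_spec hA) _ (calcfun_cont_pos b a0 cf).1).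
Qed.

Lemma pos_fcalc_ext A f h : pos_invertible A -> cont_pos f ->
  (forall t, 0 < t -> f t = h t) -> fcalc f A = fcalc h A.
Proof.
move=> /pos_invertibleP[a [b [a0 ab hA]]] cf fh.
apply: (fcalc_ext hA.1 (form_bounds_spec hA) (calcfun_cont_pos b a0 cf).1).
by move=> t /andP[at_ _]; apply: fh; exact: lt_le_trans at_.
Qed.

Lemma pos_monotone (g : R -> R) A B : operator_monotone g -> cont_pos g ->
  pos_invertible A -> pos_invertible B ->
  (forall x, rdot (A x) x <= rdot (B x) x) ->
  forall x, rdot (fcalc g A x) x <= rdot (fcalc g B x) x.
Proof.
move=> mg cg pA pB; have [a [b [a0 _ hA hB]]] := form_bounds_common pA pB.
exact: (op_monotone_form mg a0 hB a0 hA (form_bounds_spec hB) (form_bounds_spec hA)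
  (calcfun_cont_pos _ a0 cg).1).
Qed.

(** * Powers *)

Lemma pos_pow A r : pos_invertible A -> pos_invertible (op_pow A r).
Proof.
move=> pA; apply: pos_fcalc_pos => //; first exact: cont_pos_pow.
by move=> t t0; rewrite powR_gt0.
Qed.

Lemma pow_symop A r : pos_invertible A -> symop (op_pow A r).
Proof. by move=> /(pos_pow r)/pos_symop. Qed.

Lemma powD A r s x : pos_invertible A ->
  op_pow A r (op_pow A s x) = op_pow A (r + s) x.
Proof.
move=> pA; rewrite /op_pow.
have := pos_fcalcM pA (cont_pos_pow r) (cont_pos_pow s) => /(congr1 (fun F => F x)) <-.
congr (_ x); apply: (pos_fcalc_ext pA) => [t t0|t t0].
  by apply: cvgM; apply: cont_pos_pow.
by rewrite powRD_gt0.
Qed.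

Lemma pow1 A : pos_invertible A -> op_pow A 1 = A.
Proof.
move=> pA; rewrite -[RHS](fcalc_id (pos_symop pA) (E := setT) (fun _ _ => I)).
apply: (pos_fcalc_ext pA) => [|t t0]; first exact: cont_pos_pow.
by rewrite powRr1 // ltW.
Qed.

Lemma pow0 A : pos_invertible A -> op_pow A 0 = id.
Proof.
move=> pA; have := fcalc_cst (pos_symop pA) (E := setT) (fun _ _ => I) 1.
have -> : (fun x : H => 1%:C *: x) = id by apply: funext => x; rewrite scale1r.
move=> <-; apply: (pos_fcalc_ext pA) => [|t t0]; first exact: cont_pos_pow.
by rewrite powRr0.
Qed.

Lemma powNK A r x : pos_invertible A -> op_pow A r (op_pow A (- r) x) = x.
Proof. by move=> pA; rewrite powD // subrr pow0. Qed.

Lemma powKN A r x : pos_invertible A -> op_pow A (- r) (op_pow A r x) = x.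
Proof. by move=> pA; rewrite powD // addNr pow0. Qed.

Lemma powM A r s : pos_invertible A -> op_pow (op_pow A r) s = op_pow A (r * s).
Proof.
move=> pA; rewrite /op_pow (pos_fcalc_comp pA (cont_pos_pow r) _ (cont_pos_pow s)).
  by congr (fcalc _ A); apply: funext => t; rewrite powRrM.
by move=> t t0; rewrite powR_gt0.
Qed.

Lemma pow_half A r x y : pos_invertible A ->
  rdot (op_pow A (r / 2) x) (op_pow A (r / 2) y) = rdot (op_pow A r x) y.
Proof. by move=> pA; rewrite -(pow_symop _ pA).2 powD // -splitr. Qed.

Lemma pos_conj A S : pos_invertible A -> pos_invertible S ->
  pos_invertible (fun x => S (A (S x))).
Proof.
move=> [/psdE[sA pA] iA] [/psdE[sS pS] iS]; split.
  apply/psdE; split; first exact: symop_conj sA sS.1 sS.1 sS.2.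
  by move=> x; rewrite sS.2 pA.
exact: invertible_comp iS (invertible_comp iA iS).
Qed.

(** |S' x|^2 = <S S' x, x> <= |S' x| |x|. *)
Lemma adj_contraction (S S' : H -> H) : adj S S' ->
  (forall x, hnorm (S x) <= hnorm x) -> forall x, hnorm (S' x) <= hnorm x.
Proof.
move=> SS' cS x; have [->|/eqP nz] := eqVneq (S' x) 0; first by rewrite hnorm0 hnorm_ge0.
rewrite -(ler_pM2l (hnorm_gt0 nz)) -expr2 hnorm_sqr -SS'.
by apply: (le_trans (cauchy_schwarz _ _)); rewrite ler_wpM2r ?hnorm_ge0.
Qed.

(** * The Loewner-Heinz inequality *)

(** The exponents q for which t^q is operator monotone; to be shown to contain
    [0, 1]. *)
Definition pow_monotone (q : R) := forall A B, pos_invertible A -> pos_invertible B ->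
  (forall x, rdot (A x) x <= rdot (B x) x) ->
  forall x, rdot (op_pow A q x) x <= rdot (op_pow B q x) x.

(** The operator B^(-s/2) A^s B^(-s/2), s = (q + r) / 2, is similar to the product
    of the contractions B^(-q/2) A^(q/2) and A^(r/2) B^(-r/2). Hence it has no
    spectrum above 1, and being symmetric it is at most 1. *)
Lemma pow_monotone_midpoint q r : pow_monotone q -> pow_monotone r -> pow_monotone ((q + r) / 2).
Proof.
move=> hq hr A B pA pB AB; set s := (q + r) / 2.
have contr (u : R) : pow_monotone u ->
    forall x, hnorm (op_pow A (u / 2) (op_pow B (- (u / 2)) x)) <= hnorm x.
  move=> hu x; rewrite hnorm_le pow_half // (le_trans (hu _ _ pA pB AB _)) //.
  by rewrite -pow_half // powNK.
pose N x := op_pow B (- (q / 2)) (op_pow A (q / 2) (op_pow A (r / 2) (op_pow B (- (r / 2)) x))).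
have bN : blin N.
  have bp (Z : H -> H) (u : R) : pos_invertible Z -> blin (op_pow Z u) by move=> /(pow_symop u)[].
  exact: (blin_comp (bp _ _ pB) (blin_comp (bp _ _ pA) (blin_comp (bp _ _ pA) (bp _ _ pB)))).
have cN x : hnorm (N x) <= 1 * hnorm x.
  rewrite mul1r (le_trans _ (contr r hr x)) //.
  apply: (@adj_contraction (fun x => op_pow A (q / 2) (op_pow B (- (q / 2)) x))
    (fun x => op_pow B (- (q / 2)) (op_pow A (q / 2) x))).
    by move=> u v; rewrite (pow_symop _ pA).2 (pow_symop _ pB).2.
  exact: contr.
pose M x := op_pow B (- (s / 2)) (op_pow A s (op_pow B (- (s / 2)) x)).
have sM : symop M.
  have [b1 b2] := pow_symop (- (s / 2)) pB.
  exact: (symop_conj (pow_symop s pA) b1 b1 b2).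
have M1 x : rdot (M x) x <= rdot x x.
  rewrite leNgt; apply/negP => lt.
  have [|m [m0 _ ninv]] := @inf_form_spectrum _ H _ x (symop_sub (symop_id H) sM).
    by rewrite rdotBl subr_lt0.
  apply: ninv.
  have iN : invertible_op (fun x => N x - (1 - m)%:C *: x).
    by apply: (invertible_sub_scalar bN (k := 1)) => //; rewrite ler01 /=; lra.
  (* M = B^d N B^(-d) *)
  pose d := (q - r) / 4.
  have iB u : invertible_op (op_pow B u) by case: (pos_pow u pB).
  have iN1 := @invertible_scalar R H (-1).
  have := invertible_comp (iN1 _) (invertible_comp (iB d) (invertible_comp iN (iB (- d)))).
  rewrite oppr_eq0 oner_eq0 => /(_ isT); congr invertible_op; apply: funext => y.
  have bB := (pow_symop d pB).1.
  rewrite (blinB bB) (blinZ bB) powNK // scaleN1r opprB rmorphB scalerBl scale1r.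
  rewrite addrAC; congr (_ - _ - _).
  rewrite /N /M !powD //.
  have -> : d + - (q / 2) = - (s / 2) by rewrite /d /s; field.
  have -> : - (r / 2) + - d = - (s / 2) by rewrite /d /s; field.
  by have -> : q / 2 + r / 2 = s by rewrite /s; field.
move=> x; have := M1 (op_pow B (s / 2) x).
by rewrite /M (pow_symop _ pB).2 !powKN // pow_half.
Qed.

Lemma pow_monotone0 : pow_monotone 0.
Proof. by move=> A B pA pB _ x; rewrite !pow0. Qed.

Lemma pow_monotone1 : pow_monotone 1.
Proof. by move=> A B pA pB AB x; rewrite !pow1. Qed.

(** Bisection between the exponents 0 and 1. *)
Lemma pow_monotone_dense (q : R) (n : nat) : 0 <= q <= 1 ->
  exists u v, [/\ pow_monotone u, pow_monotone v, u <= q <= v & v - u = 2^-1 ^+ n].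
Proof.
move=> q01; elim: n => [|n [u [v [hu hv /andP[uq qv] uv]]]].
  by exists 0, 1; split; [exact: pow_monotone0|exact: pow_monotone1| |rewrite subr0].
have hm := pow_monotone_midpoint hu hv; set m := (u + v) / 2 in hm.
have [qm|mq] := leP q m.
  by exists u, m; split=> //; [rewrite uq | rewrite exprS -uv /m; field].
by exists m, v; split=> //; [rewrite (ltW mq) | rewrite exprS -uv /m; field].
Qed.

Lemma powR_to1 (c e : R) : 0 < c -> 0 < e ->
  exists2 d : R, 0 < d & forall h, `|h| < d -> c `^ h < 1 + e.
Proof.
move=> c0 e0.
have ce : {for 0, continuous (fun h : R => expR (h * ln c))}.
  apply: continuous_comp; last exact: continuous_expR.
  by apply: cvgMr_tmp; exact: cvg_id.
have /cvgrPdist_lt/(_ _ e0)/nbhs_ballP[d /= d0 hd] := ce.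
exists d => // h hd'; have := hd h; rewrite /ball /= sub0r normrN => /(_ hd').
rewrite mul0r expR0 ltr_norml /powR gt_eqF //; lra.
Qed.

(** Take an exponent v = q + h of the dense set, h >= 0. With a <= A and B <= d,
    A^q <= a^(-h) A^v <= a^(-h) B^v <= (d / a)^h B^q, and (d / a)^h tends to 1. *)
Lemma loewner_heinz q : 0 <= q <= 1 -> pow_monotone q.
Proof.
move=> q01 A B pA pB AB x.
have [a [b [a0 ab hA]]] := (pos_invertibleP A).1 pA.
have [c [d [c0 cd hB]]] := (pos_invertibleP B).1 pB.
have B0 : 0 <= rdot (op_pow B q x) x.
  by have [/psdE[_]] := pos_pow q pB.
apply/ler_addgt0Pr => e e0.
pose e' := e / (rdot (op_pow B q x) x + 1).
have e'0 : 0 < e' by rewrite divr_gt0 // ltr_wpDl.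
have da : 0 < d / a by rewrite divr_gt0 //; lra.
have [r r0 hr] := powR_to1 da e'0.
have [n nr] : exists n, 2^-1 ^+ n < r.
  have : (fun n => 2^-1 ^+ n * 1 : R) @ \oo --> 0.
    by apply: cvg_geom0; lra.
  move=> /cvgrPdist_lt/(_ r r0)[n _ hr']; exists n.
  by have := hr' n (leqnn n); rewrite sub0r normrN mulr1; apply: le_lt_trans; exact: ler_norm.
have [u [v [_ hv /andP[uq qv] uv]]] := pow_monotone_dense n q01.
have h0 : 0 <= v - q by lra.
have hlt : `|v - q| < r by rewrite ger0_norm //; lra.
have := hr _ hlt; set h := v - q in h0 *; move=> hda.
have aE : a `^ (- h) * a `^ h = 1.
  by rewrite -powRD_gt0 // addNr powRr0.
have hA1 : rdot (op_pow A q x) x <= a `^ (- h) * rdot (op_pow A v x) x.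
  have -> : a `^ (- h) * rdot (op_pow A v x) x =
      rdot (fcalc (fun t => a `^ (- h) * t `^ v) A x) x.
    by rewrite (pos_fcalcZ _ pA (cont_pos_pow v)) rdotZl.
  apply: (fcalc_le hA.1 (form_bounds_spec hA) (calcfun_cont_pos b a0 (cont_pos_pow q)).1).
    exact: poly_approxZ (calcfun_cont_pos b a0 (cont_pos_pow v)).1.
  move=> t /andP[at_ _]; have t0 := lt_le_trans a0 at_.
  have -> : v = q + h by rewrite /h addrC subrK.
  rewrite powRD_gt0 // mulrCA ler_peMr ?powR_ge0 //.
  by rewrite -aE ler_wpM2l ?powR_ge0 // ge0_ler_powR ?nnegrE // ltW.
have hB1 : rdot (op_pow B v x) x <= d `^ h * rdot (op_pow B q x) x.
  have -> : d `^ h * rdot (op_pow B q x) x =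
      rdot (fcalc (fun t => d `^ h * t `^ q) B x) x.
    by rewrite (pos_fcalcZ _ pB (cont_pos_pow q)) rdotZl.
  apply: (fcalc_le hB.1 (form_bounds_spec hB) (calcfun_cont_pos d c0 (cont_pos_pow v)).1).
    exact: poly_approxZ (calcfun_cont_pos d c0 (cont_pos_pow q)).1.
  move=> t /andP[ct td]; have t0 := lt_le_trans c0 ct.
  have -> : v = q + h by rewrite /h addrC subrK.
  rewrite powRD_gt0 // mulrC ler_wpM2r ?powR_ge0 //.
  by rewrite ge0_ler_powR ?nnegrE ?(ltW t0) // (le_trans (ltW t0)).
apply: (le_trans hA1).
apply: (le_trans (ler_wpM2l (powR_ge0 _ _) (hv _ _ pA pB AB x))).
apply: (le_trans (ler_wpM2l (powR_ge0 _ _) hB1)).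
have -> : a `^ (- h) * (d `^ h * rdot (op_pow B q x) x) =
    (d / a) `^ h * rdot (op_pow B q x) x.
  rewrite powRM ?invr_ge0; [|lra|lra].
  have -> : a^-1 `^ h = a `^ (- h) by rewrite -powR_inv1 ?ltW // -powRrM mulN1r.
  by ring.
have h1 := ler_wpM2r B0 (ltW hda).
have h2 : e' * rdot (op_pow B q x) x <= e.
  rewrite /e' mulrAC ler_pdivrMr; [|lra].
  by rewrite ler_wpM2l ?(ltW e0) // lerDl.
lra.
Qed.

(** Hansen's inequality for t^p, written for the congruence by X^(-1/2), X <= 1. With
    B = X^(-1/2) A X^(-1/2), T = B^(1/2) X^(1/2) and T' its adjoint, A = T' T, so
    A^p = T' (T T')^(p-1) T; moreover T T' = B^(1/2) X B^(1/2) <= B, and the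
    Loewner-Heinz inequality applies to the exponent p - 1. *)
Lemma hansen_pow (A X : H -> H) (p : R) : pos_invertible A -> pos_invertible X ->
  (forall x, rdot (X x) x <= rdot x x) -> 1 <= p <= 2 ->
  let Xh := op_pow X (- 2^-1) in
  forall x, rdot (Xh (op_pow A p (Xh x))) x <=
    rdot (op_pow (fun y => Xh (A (Xh y))) p x) x.
Proof.
move=> pA pX X1 /andP[p1 p2] Xh x.
have half : 2^-1 + 2^-1 = 1 :> R by field.
pose S := op_pow X 2^-1.
have SX y : S (Xh y) = y by exact: powNK.
have XS y : Xh (S y) = y by exact: powKN.
have sS : symop S := pow_symop _ pX; have sXh : symop Xh := pow_symop _ pX.
pose B y := Xh (A (Xh y)).
have pB : pos_invertible B by apply: pos_conj; [|exact: pos_pow].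
pose Bh := op_pow B (2^-1); have sBh : symop Bh := pow_symop _ pB.
have BhBh y : Bh (Bh y) = B y.
  by rewrite /Bh powD // half pow1.
have SS y : S (S y) = X y.
  by rewrite /S powD // half pow1.
pose T y := Bh (S y); pose T' y := S (Bh y).
have bT' : blin T' := blin_comp sS.1 sBh.1.
have AE y : A y = T' (T y) by rewrite /T /T' BhBh /B SX XS.
pose C y := T (T' y).
have CE y : C y = Bh (X (Bh y)) by rewrite /C /T /T' SS.
have pC : pos_invertible C.
  by rewrite (funext CE); apply: pos_conj pX (pos_pow _ pB).
have CB y : rdot (C y) y <= rdot (B y) y.
  by rewrite CE sBh.2 (le_trans (X1 _)) // -sBh.2 BhBh.
have [a [b [a0 _ hA hC]]] := form_bounds_common pA pC.
pose q := p - 1.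
have AqT' y : op_pow A q (T' y) = T' (op_pow C q y).
  apply: (fcalc_intertwine hA.1 hC.1 (form_bounds_spec hA) (form_bounds_spec hC)
    (calcfun_cont_pos _ a0 (cont_pos_pow q)).1 bT') => z.
  by rewrite AE.
have -> : op_pow A p (Xh x) = T' (op_pow C q (T (Xh x))).
  have A1 : op_pow A 1 (Xh x) = A (Xh x) by rewrite pow1.
  by rewrite -AqT' -AE -A1 powD // /q subrK.
rewrite /T' XS sBh.2 /T SX.
have q01 : 0 <= q <= 1 by rewrite /q; lra.
apply: (le_trans (loewner_heinz q01 pC pB CB _)).
rewrite -sBh.2 /Bh !powD //.
by have -> : 2^-1 + q + 2^-1 = p by rewrite /q; field.
Qed.

End PositiveOperators.
Arguments cont_pos_pow {R} r [t] _.

(** * Jensen's inequality for compressions *)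

Section Jensen.
Context {R : realType}.
Implicit Types (H K : hilbertType R).

Lemma pos_scalar H (c : R) : 0 < c -> pos_invertible (fun x : H => c%:C *: x).
Proof.
move=> c0; apply/pos_invertibleP; exists c, (c + 1); split=> //; first by lra.
by apply: form_bounds_weak (form_bounds_scalar H c) _ _; lra.
Qed.

Lemma pos_diag H K (A : H -> H) (B : K -> K) :
  pos_invertible A -> pos_invertible B -> pos_invertible (diag_op A B).
Proof.
move=> pA pB; have [a [b [a0 ab hA hB]]] := form_bounds_common pA pB.
apply/pos_invertibleP; exists a, b; split=> //.
split; first exact: symop_diag hA.1 hB.1.
move=> u; rewrite !rdot_hsum /= !mulrDr.
have /andP[h1 h2] := hA.2 u.1; have /andP[h3 h4] := hB.2 u.2.
by rewrite !lerD.
Qed.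

Lemma pos_fcalc_diag H K (A : H -> H) (B : K -> K) f : cont_pos f ->
  pos_invertible A -> pos_invertible B ->
  fcalc f (diag_op A B) = diag_op (fcalc f A) (fcalc f B).
Proof.
move=> cf pA pB; have [a [b [a0 _ hA hB]]] := form_bounds_common pA pB.
exact: (fcalc_diag hA.1 hB.1 (form_bounds_spec hA) (form_bounds_spec hB)
  (calcfun_cont_pos _ a0 cf).1).
Qed.

(** The summand e leaves room for the off-diagonal blocks in the compression
    argument. *)
Lemma jensen_isometry H K (g : R -> R) (V : H -> K) (W : K -> H) (T : K -> K) (e : R) :
  operator_monotone g -> cont_pos g -> blin V -> blin W -> adj V W -> cancel V W ->
  pos_invertible T -> 0 < e ->
  let C := fun x => W (T (V x)) + e%:C *: x in
  pos_invertible C /\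
  forall x, rdot (fcalc g T (V x)) (V x) <= rdot (fcalc g C x) x.
Proof.
move=> mg cg bV bW VW WV /pos_invertibleP[t1 [t2 [t10 t12 hT]]] e0 C.
have [sT fT] := hT.
have sC : symop C by apply: symop_add (symop_scalar H e); exact: (symop_conj sT bV bW VW).
have norm_V x : rdot (V x) (V x) = rdot x x by rewrite VW WV.
have C_ge x : t1 * rdot x x <= rdot (C x) x.
  rewrite rdotDl rdotZl (adj_sym VW) -[X in t1 * X]norm_V.
  have /andP[h _] := fT (V x); have := mulr_ge0 (ltW e0) (rdot_ge0 x); lra.
have [u t1u hC] := form_bounds_ex sC C_ge.
have t20 : 0 <= t2 by lra.
split; first by apply/pos_invertibleP; exists t1, u.
move=> x.
pose N := 1 + t2 ^+ 2 / e + t2.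
have N1 : 1 <= N.
  by have := divr_ge0 (sqr_ge0 t2) (ltW e0); rewrite /N; lra.
pose lo := Num.min t1 1; pose hi := Num.max t2 (Num.max u N).
have lo0 : 0 < lo by rewrite lt_min t10 ltr01.
have lo1 : lo <= 1 by rewrite ge_min lexx orbT.
have hT' : form_bounds lo hi T by apply: form_bounds_weak hT _ _; rewrite ?ge_min ?le_max lexx.
have hC' : form_bounds lo hi C.
  by apply: form_bounds_weak hC _ _; rewrite ?ge_min ?le_max lexx ?orbT.
have N_hi : N <= hi by rewrite !le_max lexx !orbT.
have EN : seg lo hi N by apply/andP; split=> //; exact: le_trans lo1 N1.
have gE := (calcfun_cont_pos hi lo0 cg).1.
have := compression mg bV bW VW WV t10 t20 hT e0 (lexx N) (form_bounds_spec hT')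
  (form_bounds_spec hC') _ EN gE (V x).
rewrite WV subrr rdot0l mulr0 addr0; apply.
by apply/andP; split=> //; exact: le_trans N1 N_hi.
Qed.

(** Jensen's inequality for a contraction S: the defect 1 - S' S is filled with the
    scalar s, through the isometry x -> (S x, (1 - S' S)^(1/2) x) and the operator
    diag(C, s). The scalar s and the e of jensen_isometry, taken equal to s, are
    both absorbed in the term 2 s. *)
Lemma jensen_contraction H (g : R -> R) (S S' C : H -> H) (s : R) :
  operator_monotone g -> cont_pos g -> (forall a b, 0 < a -> a <= b -> g a <= g b) ->
  blin S -> blin S' -> adj S S' -> (forall x, rdot (S x) (S x) <= rdot x x) ->
  pos_invertible C -> 0 < s -> forall B, pos_invertible B ->
  (forall x, rdot (C (S x)) (S x) + 2 * s * rdot x x <= rdot (B x) x) ->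
  forall x, rdot (fcalc g C (S x)) (S x) + g s * (rdot x x - rdot (S x) (S x)) <=
    rdot (fcalc g B x) x.
Proof.
move=> mg cg ndg bS bS' SS' cS pC s0 B pB hB x.
pose J y := y - S' (S y).
have sJ : symop J by apply: symop_sub (symop_id H) _; exact: (symop_conj (symop_id H) bS bS' SS').
have JE y : rdot (J y) y = rdot y y - rdot (S y) (S y).
  by rewrite rdotBl (adj_sym SS').
have hJ : form_bounds 0 1 J.
  split=> // y; rewrite JE mul0r mul1r; have := cS y; have := rdot_ge0 (S y) => *.
  by apply/andP; split; lra.
have csq : calcfun (seg 0 1) (Num.sqrt : R -> R).
  by apply: calcfun_seg => t _; exact: sqrt_continuous.
pose L := fcalc (Num.sqrt : R -> R) J.
have sL : symop L := fcalc_symop sJ (form_bounds_spec hJ) csq.1.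
have LL y : L (L y) = J y.
  have <- : fcalc (fun t => Num.sqrt t * Num.sqrt t) J y = L (L y).
    by rewrite (fcalcM sJ (form_bounds_spec hJ) csq csq).
  rewrite -[in RHS](fcalc_id sJ (form_bounds_spec hJ)); congr (_ y).
  apply: (fcalc_ext sJ (form_bounds_spec hJ) (calcfunM csq csq).1) => t /andP[t0 _].
  by rewrite -expr2 sqr_sqrtr.
pose V := hpair S L; pose W (y : hsum H H) := S' y.1 + L y.2.
have bV : blin V := blin_pair bS sL.1.
have bW : blin W.
  exact: blin_add (blin_comp bS' (blin_fst _ _)) (blin_comp sL.1 (blin_snd _ _)).
have VW : adj V W by move=> y z; rewrite rdot_hsum /= rdotDr SS' sL.2.
have WV : cancel V W by move=> y; rewrite /W /V /= LL /J addrC subrK.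
have pT := pos_diag pC (pos_scalar H s0).
have [pC' /(_ x)] := jensen_isometry mg cg bV bW VW WV pT s0.
rewrite pos_fcalc_diag //; last exact: pos_scalar.
rewrite fcalc_scalar rdot_hsum /= rdotZl -sL.2 LL JE => /le_trans; apply.
apply: (pos_monotone mg cg pC' pB) => y.
apply: le_trans (hB y).
rewrite /W /V /= (blinZ sL.1) LL !rdotDl !rdotZl JE (adj_sym SS').
have := mulr_ge0 (ltW s0) (rdot_ge0 (S y)); lra.
Qed.

End Jensen.

(** * The Karcher equation *)

Section Karcher.
Context {R : realType} {H : hilbertType R} {g : R -> R}.
Hypotheses (mg : operator_monotone g) (cg : cont_pos g).
Hypothesis strict_g : forall a b : R, 0 < a -> a < b -> g a < g b.
Implicit Types (A B X Y : H -> H).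

Let nd_g a b : 0 < a -> a <= b -> g a <= g b.
Proof.
by move=> a0; rewrite le_eqVlt => /orP[/eqP->//|/(strict_g a0)/ltW].
Qed.

Definition congr_by X A : H -> H := op_pow X (- 2^-1) \o A \o op_pow X (- 2^-1).

Lemma pos_congr_by X A : pos_invertible X -> pos_invertible A ->
  pos_invertible (congr_by X A).
Proof. by move=> pX pA; apply: pos_conj => //; exact: pos_pow. Qed.

Definition karcher (n : nat) (w : 'I_n -> R) (A : 'I_n -> H -> H) X x : R :=
  \sum_(i < n) w i * rdot (fcalc g (congr_by X (A i)) x) x.

Section Powers.
Hypothesis g_pow : forall p x : R, 1 <= p -> 0 < x -> g x <= p * g (x `^ p^-1).

Lemma g_powR p t : 1 <= p -> 0 < t -> g (t `^ p) <= p * g t.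
Proof.
move=> p1 t0; have p0 : p != 0 by rewrite gt_eqF //; lra.
by have := g_pow p1 (powR_gt0 p t0); rewrite -powRrM mulfV // powRr1 // ltW.
Qed.

(** X^(-1/2) A^p X^(-1/2) <= (X^(-1/2) A X^(-1/2))^p, then g is operator monotone and
    g(t^p) <= p g(t). *)
Lemma fcalc_congr_pow X A p : pos_invertible X ->
  (forall x, rdot (X x) x <= rdot x x) -> pos_invertible A -> 1 <= p <= 2 ->
  forall x, rdot (fcalc g (congr_by X (op_pow A p)) x) x <=
            p * rdot (fcalc g (congr_by X A) x) x.
Proof.
move=> pX X1 pA p12 x; have /andP[p1 p2] := p12.
have pB := pos_congr_by pX pA.
have le1 := pos_monotone mg cg (pos_congr_by pX (pos_pow p pA)) (pos_pow p pB)
  (hansen_pow pA pX X1 p12) x.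
apply: (le_trans le1); rewrite -rdotZl -/(congr_by X A).
have pow0 t : 0 < t -> 0 < t `^ p by move=> t0; rewrite powR_gt0.
rewrite /op_pow (pos_fcalc_comp pB (cont_pos_pow p) pow0 cg).
have -> : p%:C *: fcalc g (congr_by X A) x = fcalc (fun t => p * g t) (congr_by X A) x.
  by rewrite (pos_fcalcZ _ pB cg).
apply: (pos_fcalc_le pB) => [| |t t0]; last exact: g_powR.
- exact: cont_pos_comp (cont_pos_pow p) cg pow0.
- by move=> t t0; apply: cvgMl_tmp; exact: cg.
Qed.

(** The same X stays a supersolution when A is replaced by A^p: this is what lets
    exponents be composed without solving the intermediate equations. *)
Lemma karcher_pow_step (n : nat) (w : 'I_n -> R) (A : 'I_n -> H -> H) X p :
  (forall i, 0 < w i) -> (forall i, pos_invertible (A i)) -> pos_invertible X ->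
  (forall x, rdot (X x) x <= rdot x x) -> 1 <= p <= 2 ->
  (forall x, karcher w A X x <= 0) ->
  forall x, karcher w (fun i => op_pow (A i) p) X x <= 0.
Proof.
move=> w0 pA pX X1 p12 hX x.
apply: (@le_trans _ _ (p * karcher w A X x)); last first.
  by rewrite pmulr_rle0 //; have /andP[] := p12; lra.
rewrite /karcher mulr_sumr; apply: ler_sum => i _.
rewrite mulrCA ler_wpM2l //; first exact: ltW.
exact: fcalc_congr_pow.
Qed.

(** Exponents above 2 are reached by repeated squaring. *)
Lemma karcher_pow (n : nat) (w : 'I_n -> R) X p :
  (forall i, 0 < w i) -> pos_invertible X ->
  (forall x, rdot (X x) x <= rdot x x) -> 1 <= p ->
  forall A : 'I_n -> H -> H, (forall i, pos_invertible (A i)) ->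
  (forall x, karcher w A X x <= 0) ->
  forall x, karcher w (fun i => op_pow (A i) p) X x <= 0.
Proof.
move=> w0 pX X1 p1.
have [k hk] : exists k, p <= 2 ^+ k.
  exists (Num.truncn p).+1; apply: ltW; apply: (lt_trans (truncnS_gt p)).
  by rewrite -natrX ltr_nat ltn_expl.
elim: k p p1 hk => [|k ih] p p1 hk A pA hX.
  have -> : p = 1 by apply/eqP; rewrite eq_le p1 andbT -(expr0 2).
  have -> // : (fun i => op_pow (A i) 1) = A by apply: funext => i; rewrite pow1.
have [p2|p2] := leP p 2.
  by apply: karcher_pow_step => //; rewrite p1.
have p21 : 1 <= p / 2 by rewrite ler_pdivlMr // mul1r ltW.
have p2k : p / 2 <= 2 ^+ k by rewrite ler_pdivrMr // mulrC -exprS.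
have pA2 i : pos_invertible (op_pow (A i) (p / 2)) by exact: pos_pow.
have h2 : 1 <= (2 : R) <= 2 by rewrite lexx andbT ler1n.
have := karcher_pow_step w0 pA2 pX X1 h2 (ih _ p21 p2k A pA hX).
have -> // : (fun i => op_pow (op_pow (A i) (p / 2)) 2) = (fun i => op_pow (A i) p).
by apply: funext => i; rewrite powM // divfK.
Qed.
End Powers.

(** For small s the map t -> t / m + 2 s stays at a distance below t on [a, b], so
    strict monotonicity and compactness give a uniform drop d of g. *)
Lemma uniform_drop (a b m : R) : 0 < a -> a < b -> 1 < m ->
  exists s d : R, [/\ 0 < s, 0 < d &
    forall t, seg a b t -> g (m^-1 * t + 2 * s) <= g t - d].
Proof.
move=> a0 ab m1; have m0 : 0 < m by lra.
have mi : m^-1 < 1 by rewrite invf_lt1.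
have mi0 : 0 < m^-1 by rewrite invr_gt0.
pose s := a * (1 - m^-1) / 4.
have s0 : 0 < s by rewrite divr_gt0 ?mulr_gt0 ?subr_gt0.
have s4 : 4 * s = a * (1 - m^-1) by rewrite /s mulrC divfK.
have s2a : 2 * s < a by have := mulr_gt0 a0 mi0; lra.
pose k t := g t - g (t - 2 * s).
have ck : {within `[a, b], continuous k}.
  apply: continuous_in_subspaceT => t; rewrite inE /= in_itv /= => /andP[at_ _].
  apply: cvgB; first by apply: cg; exact: lt_le_trans at_.
  apply: (@continuous_comp _ _ _ (fun t => t - 2 * s) g); last by apply: cg; lra.
  by apply: cvgB; [exact: cvg_id|exact: cvg_cst].
have [c cab hc] := EVT_min (ltW ab) ck.
have c_a : a <= c by move: cab; rewrite in_itv /= => /andP[].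
exists s, (k c); split=> //.
  by rewrite subr_gt0; apply: strict_g; lra.
move=> t tab; have /andP[at_ tb] := tab.
have := hc t tab; rewrite /k => kt.
suff : g (m^-1 * t + 2 * s) <= g (t - 2 * s) by lra.
apply: nd_g; first by have := mulr_gt0 mi0 (lt_le_trans a0 at_); lra.
have : a * (1 - m^-1) <= t * (1 - m^-1) by rewrite ler_wpM2r // subr_ge0 ltW.
lra.
Qed.

Lemma common_bounds (n : nat) (D : 'I_n -> H -> H) :
  (forall i, pos_invertible (D i)) ->
  exists a b : R, [/\ 0 < a, a < b & forall i, form_bounds a b (D i)].
Proof.
move=> pD.
have /choice[a ha] : forall i, exists a, exists b, [/\ 0 < a, a < b & form_bounds a b (D i)].
  by move=> i; apply/pos_invertibleP.
have [b hb] := choice ha.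
exists (\big[Num.min/1]_i a i), (\big[Num.max/2]_i b i); split.
- by apply: lt_bigmin => // i _; case: (hb i).
- apply: (@le_lt_trans _ _ 1); first exact: bigmin_le_id.
  by apply: (@lt_le_trans _ _ 2); [lra | exact: bigmax_ge_id].
- move=> i; have [_ _ h] := hb i.
  by apply: form_bounds_weak h _ _; [exact: bigmin_le | exact: le_bigmax].
Qed.

(** A supersolution X dominates a subsolution Y. Suppose that the supremum m of the
    form of Z = X^(-1/2) Y X^(-1/2) exceeds 1. Then S = m^(-1/2) Y^(1/2) X^(-1/2) is a
    contraction with S' S = Z / m and S' C_i S = D_i / m, where C_i and D_i are the
    congruences of A_i by Y and X. Summing Jensen's inequality for S and the C_i,
    and using the uniform drop of g from D_i to D_i / m + 2 s,
      g(s) (1 - Z / m) <= sum_i w_i g(D_i) - d <= - d.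
    So 1 - Z / m is bounded below by a positive constant, although m is a spectral
    value of Z. *)
Lemma karcher_comparison (n : nat) (w : 'I_n -> R) (A : 'I_n -> H -> H) X Y :
  weights w -> (forall i, pos_invertible (A i)) ->
  pos_invertible X -> pos_invertible Y ->
  (forall x, karcher w A X x <= 0) ->
  (forall x, 0 <= karcher w A Y x) ->
  forall x, rdot (Y x) x <= rdot (X x) x.
Proof.
move=> [w0 w1] pA pX pY hX hY.
pose Rx := op_pow X (- 2^-1); pose Sx := op_pow X 2^-1.
pose Ry := op_pow Y (- 2^-1); pose Sy := op_pow Y 2^-1.
have sRx : symop Rx := pow_symop _ pX; have sSx : symop Sx := pow_symop _ pX.
have sRy : symop Ry := pow_symop _ pY; have sSy : symop Sy := pow_symop _ pY.
have half : 2^-1 + 2^-1 = 1 :> R by field.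
have SySy y : Sy (Sy y) = Y y by rewrite /Sy powD // half pow1.
have SxSx y : Sx (Sx y) = X y by rewrite /Sx powD // half pow1.
pose Z y := Rx (Y (Rx y)).
have pZ : pos_invertible Z by apply: pos_conj => //; exact: pos_pow.
suff Z1 : forall x, rdot (Z x) x <= rdot x x.
  move=> x; have := Z1 (Sx x).
  by rewrite /Z sRx.2 /Rx /Sx powKN // -(pow_symop _ pX).2 -/Sx SxSx.
move=> x0; rewrite leNgt; apply/negP => lt.
have sZ := pos_symop pZ.
have [|m' [m'0 lb ninv]] := @inf_form_spectrum _ H _ x0 (symop_sub (symop_id H) sZ).
  by rewrite rdotBl subr_lt0.
pose m := 1 - m'; have m1 : 1 < m by rewrite /m; lra.
have m0 : 0 < m by lra.
have Zm x : rdot (Z x) x <= m * rdot x x.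
  by have := lb x; rewrite rdotBl /m; lra.
pose D i := congr_by X (A i); pose C i := congr_by Y (A i).
have pD i : pos_invertible (D i) by exact: pos_congr_by.
have pC i : pos_invertible (C i) by exact: pos_congr_by.
have [a [b [a0 ab hD]]] := common_bounds pD.
have [s [d [s0 d0 drop]]] := uniform_drop a0 ab m1.
pose k := (Num.sqrt m)^-1.
have kk : k * k = m^-1 by rewrite -invfM -expr2 sqr_sqrtr // ltW.
pose S x := k%:C *: Sy (Rx x); pose S' x := k%:C *: Rx (Sy x).
have bS : blin S by apply: blin_scale; exact: blin_comp sSy.1 sRx.1.
have bS' : blin S' by apply: blin_scale; exact: blin_comp sRx.1 sSy.1.
have SS' : adj S S'.
  by move=> x y; rewrite rdotZl rdotZr sSy.2 sRx.2.
have SSE x : rdot (S x) (S x) = m^-1 * rdot (Z x) x.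
  by rewrite rdotZl rdotZr mulrA kk -sSy.2 SySy sRx.2.
have cS x : rdot (S x) (S x) <= rdot x x.
  by rewrite SSE ler_pdivrMl.
have h_pos t : 0 < t -> 0 < m^-1 * t + 2 * s.
  by move=> t0; rewrite addr_gt0 ?mulr_gt0 ?invr_gt0.
have ch : cont_pos (fun t : R => m^-1 * t + 2 * s).
  move=> t t0; apply: cvgD; last exact: cvg_cst.
  by apply: cvgMl_tmp; exact: cvg_id.
have DSC i x : rdot (C i (S x)) (S x) = m^-1 * rdot (D i x) x.
  rewrite rdotZr /S (blinZ (pos_symop (pC i)).1) rdotZl mulrA kk; congr (_ * _).
  rewrite /C /D /congr_by /= sRy.2 sRx.2.
  by rewrite /Ry /Sy powKN.
pose B i := fcalc (fun t => m^-1 * t + 2 * s) (D i).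
have pB i : pos_invertible (B i) by exact: pos_fcalc_pos.
have gB i x : rdot (fcalc g (B i) x) x <= rdot (fcalc g (D i) x) x - d * rdot x x.
  have cD := form_bounds_spec (hD i); have sD := pos_symop (pD i).
  have gE := (calcfun_cont_pos b a0 cg).1.
  rewrite /B (pos_fcalc_comp (pD i) ch h_pos cg).
  have -> : rdot (fcalc g (D i) x) x - d * rdot x x =
      rdot (fcalc (fun t => g t + - d) (D i) x) x.
    rewrite (fcalcD sD cD gE (poly_approx_cst _)) rdotDl (fcalc_cst sD cD) rdotZl.
    by rewrite mulNr.
  apply: (fcalc_le sD cD _ (poly_approxD gE (poly_approx_cst _))) => [|t tab]; last exact: drop.
  exact: (calcfun_cont_pos b a0 (cont_pos_comp ch cg h_pos)).1.
have BE i x : rdot (B i x) x = m^-1 * rdot (D i x) x + 2 * s * rdot x x.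
  have cD := form_bounds_spec (hD i); have sD := pos_symop (pD i).
  rewrite /B (fcalcD sD cD (poly_approxZ _ poly_approx_id) (poly_approx_cst _)) rdotDl.
  by rewrite (fcalcZ sD cD _ poly_approx_id) (fcalc_id sD cD) (fcalc_cst sD cD) !rdotZl.
have jensen i x : rdot (fcalc g (C i) (S x)) (S x) +
    g s * (rdot x x - m^-1 * rdot (Z x) x) <= rdot (fcalc g (D i) x) x - d * rdot x x.
  rewrite -SSE; apply: le_trans (gB i x).
  apply: (jensen_contraction mg cg nd_g bS bS' SS' cS (pC i) s0 (pB i)) => y.
  by rewrite DSC BE.
have total x : g s * (rdot x x - m^-1 * rdot (Z x) x) <= - d * rdot x x.
  have sum_cst (c : R) : c = \sum_(i < n) w i * c by rewrite -mulr_suml w1 mul1r.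
  have := hX x; have := hY (S x); rewrite /karcher => h1 h2.
  rewrite (sum_cst (g s * _)) (sum_cst (- d * _)).
  have : \sum_(i < n) w i * (rdot (fcalc g (C i) (S x)) (S x) +
      g s * (rdot x x - m^-1 * rdot (Z x) x)) <=
    \sum_(i < n) w i * (rdot (fcalc g (D i) x) x - d * rdot x x).
    by apply: ler_sum => i _; rewrite ler_wpM2l ?jensen // ltW.
  under eq_bigr do rewrite mulrDr.
  under [X in _ <= X -> _]eq_bigr do rewrite -mulNr mulrDr.
  by rewrite !big_split /=; lra.
pose M := `|g s| + 1; have M0 : 0 < M by rewrite ltr_wpDl.
apply: ninv.
have sT : symop (fun x => x - Z x - m'%:C *: x) := symop_shift m' (symop_sub (symop_id H) sZ).
apply: (symop_ge_invertible (c := m * d / M) sT); first by rewrite divr_gt0 ?mulr_gt0.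
move=> x; rewrite !rdotBl rdotZl.
set z := rdot (Z x) x; set r := rdot x x.
have J0 : 0 <= r - m^-1 * z by rewrite subr_ge0 ler_pdivrMl ?Zm.
have h1 : d * r <= M * (r - m^-1 * z).
  have := total x; rewrite -/z -/r.
  have := ler_wpM2r J0 (ler_norm (- g s)); rewrite normrN /M; lra.
have -> : r - z - m' * r = m * (r - m^-1 * z).
  by rewrite mulrBr mulrA mulfV ?gt_eqF // mul1r /m; ring.
by rewrite mulrAC ler_pdivrMr // -!mulrA ler_pM2l // (mulrC _ M).
Qed.

End Karcher.

(** * Scalar weighted means *)

Section ScalarMeans.
Context {R : realType} {g : R -> R}.
Hypotheses (cg : cont_pos g) (g1 : g 1 = 0).
Hypothesis strict_g : forall a b : R, 0 < a -> a < b -> g a < g b.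

(** Vanishes exactly when y is the lam-weighted mean of u and v. *)
Definition mean_eq (lam u v y : R) := (1 - lam) * g (u / y) + lam * g (v / y).

Lemma mean_eq_decr (lam u v y z : R) : 0 <= lam <= 1 -> 0 < u -> 0 < v -> 0 < y -> y < z ->
  mean_eq lam u v z < mean_eq lam u v y.
Proof.
move=> /andP[l0 l1] u0 v0 y0 yz; have z0 := lt_trans y0 yz.
have drop (t : R) : 0 < t -> g (t / z) < g (t / y).
  move=> t0; apply: strict_g; first by rewrite divr_gt0.
  by rewrite ltr_pM2l // ltf_pV2.
have [->|ln0] := eqVneq lam 0.
  by rewrite /mean_eq !mul0r !addr0 subr0 !mul1r drop.
rewrite /mean_eq; apply: ler_ltD.
  by rewrite ler_wpM2l ?subr_ge0 // ltW // drop.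
by rewrite ltr_pM2l ?drop // lt_neqAle eq_sym ln0.
Qed.

Lemma mean_eq_ex (lam u v : R) : 0 <= lam <= 1 -> 0 < u -> 0 < v ->
  exists2 y, 0 < y & mean_eq lam u v y = 0.
Proof.
move=> l01 u0 v0; have /andP[l0 l1] := l01.
pose a := Num.min u v; pose b := Num.max u v.
have a0 : 0 < a by rewrite lt_min u0.
have ab : a <= b by rewrite ge_min !le_max lexx.
have nd s t : 0 < s -> s <= t -> g s <= g t.
  by move=> s0; rewrite le_eqVlt => /orP[/eqP->//|/(strict_g s0)/ltW].
have b0 := lt_le_trans a0 ab.
have c_in : {within `[a, b], continuous (mean_eq lam u v)}.
  apply: continuous_in_subspaceT => t; rewrite inE /= in_itv /= => /andP[at_ _].
  have t0 := lt_le_trans a0 at_.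
  have cdiv (s : R) : 0 < s -> {for t, continuous (fun z : R => g (s / z))}.
    move=> s0; apply: (@continuous_comp _ _ _ (fun z : R => s / z) g).
      by apply: cvgMl_tmp; apply: cvgV; [rewrite gt_eqF|exact: cvg_id].
    by apply: cg; rewrite divr_gt0.
  by apply: cvgD; apply: cvgMl_tmp; exact: cdiv.
have fa : 0 <= mean_eq lam u v a.
  have ge1 t : a <= t -> 0 <= g (t / a).
    by move=> h; rewrite -g1; apply: nd; rewrite // ler_pdivlMr // mul1r.
  by rewrite /mean_eq addr_ge0 // mulr_ge0 ?subr_ge0 // ge1 ?ge_min ?lexx ?orbT.
have fb : mean_eq lam u v b <= 0.
  have le1 t : 0 < t -> t <= b -> g (t / b) <= 0.
    by move=> t0 h; rewrite -g1; apply: nd; rewrite ?divr_gt0 // ler_pdivrMr // mul1r.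
  have h1 := le1 u u0; have h2 := le1 v v0.
  rewrite /mean_eq -oppr_ge0 opprD -!mulrN addr_ge0 // mulr_ge0 ?subr_ge0 // oppr_ge0.
    by rewrite h1 // le_max lexx.
  by rewrite h2 // le_max lexx orbT.
have [|c cab fc] := IVT ab c_in (v := 0).
  by rewrite ge_min fb orbT le_max fa.
exists c => //; move: cab; rewrite in_itv /= => /andP[+ _].
exact: lt_le_trans.
Qed.

Lemma repr_funP (lam x : R) : 0 <= lam <= 1 -> 0 < x ->
  0 < repr_fun g lam x /\ mean_eq lam 1 x (repr_fun g lam x) = 0.
Proof.
move=> l01 x0; have [y y0 hy] := mean_eq_ex l01 ltr01 x0.
exact: (xgetPex 1 (ex_intro (fun y => 0 < y /\ mean_eq lam 1 x y = 0) y (conj y0 hy))).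
Qed.

Lemma le_repr_fun (lam x y : R) : 0 <= lam <= 1 -> 0 < x -> 0 < y ->
  0 <= mean_eq lam 1 x y -> y <= repr_fun g lam x.
Proof.
move=> l01 x0 y0 hy; have [f0 hf] := repr_funP l01 x0.
rewrite leNgt; apply/negP => /(mean_eq_decr l01 ltr01 x0 f0).
by rewrite hf ltNge hy.
Qed.

Lemma repr_fun_le (lam x y : R) : 0 <= lam <= 1 -> 0 < x -> 0 < y ->
  mean_eq lam 1 x y <= 0 -> repr_fun g lam x <= y.
Proof.
move=> l01 x0 y0 hy; have [f0 hf] := repr_funP l01 x0.
rewrite leNgt; apply/negP => /(mean_eq_decr l01 ltr01 x0 y0).
by rewrite hf ltNge hy.
Qed.

(** If y solves the equation for x, the inequality for g at 1 / y and x / y says that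
    y^(1/p) is a subsolution of the equation for x^(1/p). *)
Lemma repr_fun_pow :
  (forall p x : R, 1 <= p -> 0 < x -> g x <= p * g (x `^ p^-1)) ->
  forall p lam x : R, 1 <= p -> 0 <= lam <= 1 -> 0 < x ->
    repr_fun g lam x <= repr_fun g lam (x `^ p^-1) `^ p.
Proof.
move=> g_pow p lam x p1 l01 x0; have /andP[l0 l1] := l01.
have p0 : 0 < p by lra.
have [f0 hf] := repr_funP l01 x0; set y := repr_fun g lam x in f0 hf *.
have le : y `^ p^-1 <= repr_fun g lam (x `^ p^-1).
  apply: le_repr_fun => //; rewrite ?powR_gt0 //.
  rewrite -(@pmulr_rge0 _ p) // -hf /mean_eq mulrDr !(mulrCA p).
  have pw t : 0 < t -> (t `^ p^-1) / (y `^ p^-1) = (t / y) `^ p^-1.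
    move=> t0; rewrite powRM ?invr_ge0 ?ltW //; congr (_ * _).
    by rewrite -(powR_inv1 (ltW f0)) -powRrM mulN1r powRN.
  have := pw 1 ltr01; rewrite powR1 => ->; rewrite pw //.
  by rewrite lerD // ler_wpM2l ?subr_ge0 // g_pow // divr_gt0.
have := @ge0_ler_powR _ p (ltW p0) (y `^ p^-1) (repr_fun g lam (x `^ p^-1)).
rewrite !nnegrE ?powR_ge0 => /(_ isT).
have f0' := (repr_funP l01 (powR_gt0 p^-1 x0)).1.
rewrite (ltW f0') => /(_ isT le).
by rewrite -powRrM mulVf ?gt_eqF // powRr1 // ltW.
Qed.

(** To first order in lam, the mean of 1 and x is 1 + lam g(x): its logarithm
    compares to lam a as g(x) compares to a. The sign sg treats the two comparisons
    at once. *)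
Lemma mean_eq_first_order (x a sg : R) : is_derive (1 : R) 1 g 1 -> 0 < x ->
  sg * sg = 1 -> 0 < sg * (g x - a) ->
  exists2 r : R, 0 < r & forall lam, 0 < lam < r ->
    0 < sg * mean_eq lam 1 x (expR (lam * a)).
Proof.
move=> dg x0 sg1 pos.
pose eta := sg * (g x - a) / 2.
have eta0 : 0 < eta by rewrite divr_gt0.
pose k (lam : R) := expR (- a * lam).
have dk : is_derive (0 : R) 1 k (- a).
  have h1 : is_derive (0 : R) 1 (fun lam : R => - a * lam) (- a).
    by apply: is_derive_eq; rewrite /GRing.scale /= mulr1.
  have h2 : is_derive (- a * 0 : R) 1 expR 1.
    by apply: is_derive_eq; rewrite mulr0 expR0.
  by have := is_derive1_comp h2 h1; rewrite mul1r.
have k0 : k 0 = 1 by rewrite /k mulr0 expR0.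
have dgk : is_derive (0 : R) 1 (g \o k) (- a).
  have dg' : is_derive (k 0) 1 g 1 by rewrite k0.
  by have := is_derive1_comp dg' dk; rewrite mul1r.
pose psi (lam : R) := sg * ((1 - lam) * g (k lam) + lam * g x) - lam * eta.
have dpsi : is_derive (0 : R) 1 psi eta.
  have -> : psi = (sg \*: (((cst 1 - id) * (g \o k)) + (g x \*: id)) - eta \*: id)%R.
    apply: funext => lam; rewrite /psi.
    change (sg * ((1 - lam) * g (k lam) + lam * g x) - lam * eta =
      sg * ((1 - lam) * g (k lam) + g x * lam) - eta * lam).
    by rewrite !(mulrC lam).
  apply: is_derive_eq.
  change (sg * ((1 - 0) * - a + g (k 0) * (0 - 1) + g x * 1) - eta * 1 = eta).
  rewrite k0 g1 mul0r /eta; lra.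
have [r r0 hr] := is_derive_cross dpsi eta0.
have ck : {for 0, continuous (fun lam : R => g (x * k lam))}.
  apply: (@continuous_comp _ _ _ (fun lam => x * k lam) g).
    apply: cvgMl_tmp; apply: differentiable_continuous; apply/derivable1_diffP.
    exact: ex_derive.
  by apply: cg; rewrite k0 mulr1.
have /cvgrPdist_lt/(_ _ eta0)/nbhs_ballP[r' /= r'0 hr'] := ck.
exists (Num.min r r'); first by rewrite lt_min r0.
move=> lam /andP[l0]; rewrite lt_min => /andP[lr lr'].
have := hr lam; rewrite l0 lr => /(_ isT)/andP[_]; rewrite add0r.
have := hr' lam; rewrite /ball /= sub0r normrN gtr0_norm // => /(_ lr').
rewrite k0 mulr1.
have kE : (expR (lam * a))^-1 = k lam by rewrite /k -expRN mulNr mulrC.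
rewrite /mean_eq mul1r kE /psi k0 g1 ltr_norml => /andP[h1 h2].
rewrite subr0 mul0r addr0 mulr0 mul0r subr0 mulr0 => h3.
have sgE : sg = 1 \/ sg = -1.
  have : (sg - 1) * (sg + 1) = sg * sg - 1 by ring.
  rewrite sg1 subrr.
  move/eqP; rewrite mulf_eq0 subr_eq0 addr_eq0.
  by case/orP => /eqP ->; [left|right].
have h4 := mulr_gt0 l0 eta0.
have key : - (lam * eta) <= sg * (lam * (g (x * k lam) - g x)).
  have h5 := ler_wpM2l (ltW l0) (ltW h1); have h6 := ler_wpM2l (ltW l0) (ltW h2).
  by case: sgE => ->; lra.
have e : sg * ((1 - lam) * g (k lam) + lam * g (x * k lam)) =
  sg * ((1 - lam) * g (k lam) + lam * g x) + sg * (lam * (g (x * k lam) - g x)) by ring.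
rewrite e; lra.
Qed.

(** If p g(x^(1/p)) < g(x), numbers a < g(x) and b > g(x^(1/p)) with p b < a can be
    inserted; for small lam the means then contradict the inequality. *)
Lemma pow_of_repr_fun : is_derive (1 : R) 1 g 1 ->
  (forall p lam x : R, 1 <= p -> 0 <= lam <= 1 -> 0 < x ->
    repr_fun g lam x <= repr_fun g lam (x `^ p^-1) `^ p) ->
  forall p x : R, 1 <= p -> 0 < x -> g x <= p * g (x `^ p^-1).
Proof.
move=> dg hf p x p1 x0; rewrite leNgt; apply/negP => lt.
have p0 : 0 < p by lra.
pose x' := x `^ p^-1; have x'0 : 0 < x' by rewrite powR_gt0.
pose gap := g x - p * g x'; have gap0 : 0 < gap by rewrite subr_gt0.
(* p b = p g(x') + gap / 3 is below a by gap / 3 *)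
pose a := g x - gap / 3; pose b := g x' + gap / (3 * p).
have pb : p * b = p * g x' + gap / 3 by rewrite /b; field; rewrite gt_eqF.
have [|r r0 hr] := @mean_eq_first_order x a 1 dg x0 (mulr1 1).
  by rewrite mul1r /a; lra.
have [||r' r'0 hr'] := @mean_eq_first_order x' b (-1) dg x'0 _.
- by rewrite mulrNN mulr1.
- by rewrite mulN1r /b opprB addrAC subrr add0r divr_gt0 // mulr_gt0.
pose lam := Num.min (Num.min r r' / 2) (2^-1).
have rr0 : 0 < Num.min r r' by rewrite lt_min r0.
have lam0 : 0 < lam by rewrite lt_min divr_gt0 //= invr_gt0.
have lamrr : lam < Num.min r r'.
  by apply: (@le_lt_trans _ _ (Num.min r r' / 2)); [rewrite ge_min lexx|lra].
have [lamr lamr'] : lam < r /\ lam < r' by apply/andP; rewrite -lt_min.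
have lam1 : lam <= 2^-1 by rewrite ge_min lexx orbT.
have l01 : 0 <= lam <= 1 by rewrite (ltW lam0) /=; lra.
have fx : expR (lam * a) <= repr_fun g lam x.
  apply: le_repr_fun => //; first exact: expR_gt0.
  by have := hr lam; rewrite lam0 lamr mul1r => /(_ isT)/ltW.
have fx' : repr_fun g lam x' <= expR (lam * b).
  apply: repr_fun_le => //; first exact: expR_gt0.
  by have := hr' lam; rewrite lam0 lamr' mulN1r oppr_gt0 => /(_ isT)/ltW.
have := hf p lam x p1 l01 x0; rewrite -/x'.
apply/negP; rewrite -ltNge; apply: lt_le_trans fx.
have f0 := (repr_funP l01 x'0).1.
apply: (@le_lt_trans _ _ (expR (lam * b) `^ p)).
  by apply: ge0_ler_powR; rewrite ?nnegrE ?(ltW p0) ?(ltW f0) ?expR_ge0.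
rewrite -expRM ltr_expR -mulrA ltr_pM2l // mulrC pb /a /gap.
by move: gap0; rewrite /gap; lra.
Qed.

(** At 1 the two sides of the hypothesis vanish, and g(s^p) and g(s) have
    derivatives p and 1 there: letting one of the two points tend to 1 leaves
    the wanted inequality at the other one. *)
Lemma pow_of_two_point : is_derive (1 : R) 1 g 1 ->
  (forall p a b : R, 1 <= p -> 0 < a -> a < 1 -> 1 < b ->
     g b * g (a `^ p) <= g a * g (b `^ p)) ->
  forall p x : R, 1 <= p -> 0 < x -> g x <= p * g (x `^ p^-1).
Proof.
move=> dg two p x p1 x0; have p0 : 0 < p by lra.
pose t := x `^ p^-1; have t0 : 0 < t by rewrite powR_gt0.
have xE : x = t `^ p by rewrite -powRrM mulVf ?gt_eqF // powRr1 // ltW.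
have dpow : is_derive (1 : R) 1 (fun s => g (s `^ p)) p.
  have h1 := is_derive1_powR p (@ltr01 R).
  have h2 : is_derive (1 `^ p : R) 1 g 1 by rewrite powR1.
  have := is_derive1_comp (f := g) (g := fun s => s `^ p) h2 h1.
  by rewrite powR1 mulr1 mul1r.
have dcomb (c d : R) : is_derive (1 : R) 1 (fun s => c * g (s `^ p) - d * g s) (c * p - d).
  have : is_derive (1 : R) 1 ((c \*: (fun s => g (s `^ p))) - d \*: g) (c *: p - d *: 1).
    exact: is_deriveB.
  by rewrite /GRing.scale /= mulr1.
rewrite {1}xE -/t; have [->|tn1] := eqVneq t 1; first by rewrite powR1 g1 mulr0.
rewrite leNgt; apply/negP => lt.
have d0 : 0 < - g t * p - - g (t `^ p) by lra.
have [r r0 hr] := is_derive_cross (dcomb _ _) d0.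
pose h := Num.min (r / 2) (2^-1).
have h0 : 0 < h by rewrite lt_min divr_gt0 //= invr_gt0.
have hr' : h < r by apply: (@le_lt_trans _ _ (r / 2)); [rewrite ge_min lexx|lra].
have h1 : h <= 2^-1 by rewrite ge_min lexx orbT.
have := hr h; rewrite h0 hr' => /(_ isT); rewrite powR1 g1 !mulr0 subr0 => /andP[hm hp].
have [t1|t1|t1] := ltgtP t 1; last by rewrite t1 eqxx in tn1.
- by have := two p t (1 + h) p1 t0 t1 ltac:(lra); move: hp; lra.
- by have := two p (1 - h) t p1 ltac:(lra) ltac:(lra) t1; move: hm; lra.
Qed.

End ScalarMeans.

(** * The equivalence *)

Section Equivalence.
Context {R : realType} {H : hilbertType R} {g : R -> R}.
Hypothesis H_neq0 : exists x : H, x != 0.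
Hypotheses (mg : operator_monotone g) (g1 : g 1 = 0).
Hypothesis cg : cont_pos g.
Hypothesis strict_g : forall a b : R, 0 < a -> a < b -> g a < g b.

Lemma op_pow_scalar (c r : R) :
  op_pow (fun x : H => c%:C *: x) r = (fun x => (c `^ r)%:C *: x).
Proof. exact: fcalc_scalar. Qed.

Lemma is_sigma_scalar (lam u v y : R) (w : 'I_2 -> R) (A : 'I_2 -> H -> H) :
  0 < y -> w ord0 = 1 - lam -> w (lift ord0 ord0) = lam ->
  A ord0 = (fun x => u%:C *: x) -> A (lift ord0 ord0) = (fun x => v%:C *: x) ->
  mean_eq (g := g) lam u v y = 0 -> is_sigma g w A (fun x => y%:C *: x).
Proof.
move=> y0 w0 w1 A0 A1 hy; split; first exact: pos_scalar.
have congrE (c : R) : op_pow (fun x : H => y%:C *: x) (- 2^-1) \o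
    (fun x => c%:C *: x) \o op_pow (fun x : H => y%:C *: x) (- 2^-1) =
    (fun x => (c / y)%:C *: x).
  rewrite op_pow_scalar; apply: funext => x /=.
  rewrite !scalerA -!rmorphM; congr (_%:C *: _).
  rewrite -mulrA mulrCA -powRD_gt0 //.
  have -> : - 2^-1 + - 2^-1 = -1 :> R by field.
  by rewrite powR_inv1 // ltW.
move=> x; rewrite !big_ord_recl big_ord0 w0 w1 A0 A1 !congrE !fcalc_scalar addr0.
rewrite !scalerA -!rmorphM -scalerDl -rmorphD.
by move: hy; rewrite /mean_eq => ->; rewrite scale0r.
Qed.

(** Scalar operators, with the weight lam chosen so that the mean of a and b
    is 1. *)
Lemma two_point_of_sigma :
  (forall (n : nat) (w : 'I_n -> R) (A : 'I_n -> H -> H) (p : R) (X Y : H -> H),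
      (1 <= n)%N -> weights w -> (forall i, pos_invertible (A i)) -> 1 <= p ->
      is_sigma g w A X -> is_sigma g w (fun i => op_pow (A i) p) Y ->
      op_le X id -> op_le Y id) ->
  forall p a b : R, 1 <= p -> 0 < a -> a < 1 -> 1 < b ->
     g b * g (a `^ p) <= g a * g (b `^ p).
Proof.
move=> h3 p a b p1 a0 a1 b1; have b0 : 0 < b by lra.
have ga : g a < 0 by rewrite -g1 strict_g.
have gb : 0 < g b by rewrite -g1 strict_g.
have gab : 0 < g b - g a by lra.
pose lam := - g a / (g b - g a).
have lamE : lam * (g b - g a) = - g a by rewrite /lam divfK // gt_eqF.
have l0 : 0 < lam by rewrite divr_gt0 // oppr_gt0.
have l1 : lam < 1 by rewrite ltr_pdivrMr // mul1r; lra.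
have l01 : 0 <= lam <= 1 by rewrite !ltW.
pose w (i : 'I_2) : R := if i == ord0 then 1 - lam else lam.
pose A (i : 'I_2) : H -> H := fun x => (if i == ord0 then a else b)%:C *: x.
have [y y0 hy] := mean_eq_ex cg g1 strict_g l01 (powR_gt0 p a0) (powR_gt0 p b0).
have := h3 2%N w A p (fun x => 1%:C *: x) (fun x => y%:C *: x) isT.
have ww : weights w.
  split=> [i|]; first by rewrite /w; case: ifP; rewrite ?subr_gt0.
  by rewrite !big_ord_recl big_ord0 /w /= addr0 subrK.
have pA i : pos_invertible (A i) by apply: pos_scalar; case: ifP.
have sX : is_sigma g w A (fun x => 1%:C *: x).
  apply: (@is_sigma_scalar lam a b) => //.
  by rewrite /mean_eq !divr1; lra.
have sY : is_sigma g w (fun i => op_pow (A i) p) (fun x => y%:C *: x).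
  by apply: (@is_sigma_scalar lam (a `^ p) (b `^ p)) => //; rewrite op_pow_scalar.
move=> /(_ ww pA p1 sX sY).
have -> : (fun x : H => 1%:C *: x) = id by apply: funext => x; rewrite scale1r.
have le_id : op_le (id : H -> H) id.
  by apply/(op_leE (symop_id H) (symop_id H)).
move=> /(_ le_id) /(op_leE (symop_id H) (symop_scalar H y)) hle.
have y1 : y <= 1.
  by apply: (scalar_form_le H_neq0) => x; have := hle x; rewrite rdotZl mul1r.
have : mean_eq (g := g) lam (a `^ p) (b `^ p) 1 <= 0.
  rewrite -hy; move: y1; rewrite le_eqVlt => /orP[/eqP ->//|y1].
  by apply: ltW; apply: mean_eq_decr; rewrite ?powR_gt0.
rewrite /mean_eq !divr1 => h.
have := ler_wpM2r (ltW gab) h; rewrite mul0r mulrDl.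
have -> : (1 - lam) * g (a `^ p) * (g b - g a) =
  g b * g (a `^ p).
  have -> : (1 - lam) * g (a `^ p) * (g b - g a) =
    ((g b - g a) - lam * (g b - g a)) * g (a `^ p) by ring.
  by rewrite lamE; ring.
have -> : lam * g (b `^ p) * (g b - g a) = - (g a * g (b `^ p)).
  by rewrite mulrAC lamE; ring.
lra.
Qed.

Lemma is_sigma_karcher (n : nat) (w : 'I_n -> R) (A : 'I_n -> H -> H) X :
  is_sigma g w A X -> forall x, karcher (g := g) w A X x = 0.
Proof.
move=> [_ hX] x; rewrite -(rdot0l x) -(hX x) rdot_suml.
by apply: eq_bigr => i _; rewrite rdotZl.
Qed.

Lemma sigma_of_pow :
  (forall p x : R, 1 <= p -> 0 < x -> g x <= p * g (x `^ p^-1)) ->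
  forall (n : nat) (w : 'I_n -> R) (A : 'I_n -> H -> H) (p : R) (X Y : H -> H),
      weights w -> (forall i, pos_invertible (A i)) -> 1 <= p ->
      is_sigma g w A X -> is_sigma g w (fun i => op_pow (A i) p) Y ->
      op_le X id -> op_le Y id.
Proof.
move=> g_pow n w A p X Y ww pA p1 sX sY Xid.
have pX := sX.1; have pY := sY.1.
have X1 x : rdot (X x) x <= rdot x x.
  by move: Xid => /(op_leE (symop_id H) (pos_symop pX)); exact.
apply/(op_leE (symop_id H) (pos_symop pY)) => x; apply: le_trans (X1 x).
apply: (karcher_comparison mg cg strict_g ww _ pX pY) => [i|y|y].
- exact: pos_pow.
- apply: (karcher_pow mg cg g_pow ww.1 pX X1 p1 pA) => z.
  by rewrite is_sigma_karcher.
- by rewrite is_sigma_karcher.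
Qed.

End Equivalence.

Theorem theorem8 (R : realType) (H : hilbertType R)
    (H_neq0 : exists x : H, x != 0) (g : R -> R) (gL : classL g) :
  ((forall p lambda x : R, 1 <= p -> 0 <= lambda <= 1 -> 0 < x ->
      repr_fun g lambda (x `^ p^-1) `^ p >= repr_fun g lambda x)
   <->
   (forall p x : R, 1 <= p -> 0 < x -> p * g (x `^ p^-1) >= g x))
  /\
  ((forall p x : R, 1 <= p -> 0 < x -> p * g (x `^ p^-1) >= g x)
   <->
   (forall (n : nat) (w : 'I_n -> R) (A : 'I_n -> H -> H) (p : R)
           (X Y : H -> H),
      (1 <= n)%N -> weights w -> (forall i, pos_invertible (A i)) -> 1 <= p ->
      is_sigma g w A X -> is_sigma g w (fun i => op_pow (A i) p) Y ->
      op_le X id -> op_le Y id)).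
Proof.
have [mg g1 dg] := gL.
have cg : cont_pos g by move=> t t0; exact: (monotone_continuous H_neq0 mg).
have sg := monotone_strict H_neq0 mg dg.
split; split.
- exact: pow_of_repr_fun cg g1 sg dg.
- exact: repr_fun_pow cg g1 sg.
- by move=> g_pow n w A p X Y _; exact: (sigma_of_pow mg cg sg g_pow).
- by move=> h3; exact: (pow_of_two_point g1 dg (two_point_of_sigma H_neq0 g1 cg sg h3)).
Qed.
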